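(* Let $d\ge2$, name the variables $z_1,\dots,z_{d-2},x,y$, and write $q=z_1^2+\cdots+z_{d-2}^2$. Consider the normal forms $A_n$, $D_{n,m}$, $D_{n,\infty}$, $E_{6,n}$, $A_\infty$, $D_{\infty,m}$, $D_{\infty,\infty}$ and $E_{6,\infty}$ listed in the context. In each case, define an element $s$ as follows, where each $\varepsilon_i$ can be either $0$ or $1$, and a term with exponent $\infty$ is omitted. Type A: for $f=q+x^2+\varepsilon_1y^n$, with $n\in\mathbb{N}_{\ge2}\cup\{\infty\}$, set $s=y$. Type D: for $f=q+xy^2+\varepsilon_2x^{2n}+\varepsilon_3x^{2m-1}$, with $m,n\in\mathbb{N}_{\ge2}\cup\{\infty\}$ (and $f$ one of the normal forms listed in the context), set $s=x^2$. Type E: for $f=q+x^3+xy^3+\varepsilon_4y^n$, with $n\in\mathbb{N}_{\ge4}$, set $s=g_{6,n}$, where $$g_{6,n}=\begin{cases}x^2+xyx+yx^2 & \text{if } n=3t+1 \text{ with } t\ge1\\ x^2+xyx+yx^2+(-1)^t3^t(3t+2)x^{2t+1} & \text{if } n=3t+2 \text{ with } t\ge1\\ x^2+xyx+yx^2+(-1)^{t+1}3^t t\,(xyx^{2t-2}+yx^{2t-1}) & \text{if } n=3t \text{ with } t\ge2.\end{cases}$$ Then the following statements hold. (1) The element $s$ is central in $\mathrm{Jac}(f)$, and furthermore $\mathrm{Jac}(f)/(s)$ is isomorphic to one of the six algebras $\Gamma_1,\dots,\Gamma_6$ listed in the context. (2) More specifically, $\mathrm{Jac}(f)/(s)$ is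 isomorphic to $\Gamma_1$ when $f$ is in the family $A_*$, to $\Gamma_2$ when $f$ is in the family $D_{*,*}$, and to $\Gamma_3$ when $f$ is in the family $E_{6,*}$. (3) For any generic central element $g$, the quotient $\mathrm{Jac}(f)/(g)$ is isomorphic to $\Gamma_1$ when $f$ is in the family $A_*$, and to $\Gamma_2$ when $f$ is in the family $D_{*,*}$.
   Context: $\mathbb{C}\langle\langle x_1,\dots,x_d\rangle\rangle$ is the ring of formal power series in $d$ noncommuting variables over $\mathbb{C}$, with two-sided maximal ideal $\mathfrak{n}$ of series with zero constant term and the $\mathfrak{n}$-adic topology; the closure of a subset $S$ is $\bigcap_{i\ge0}(S+\mathfrak{n}^i)$. The cyclic derivative $\delta_i$ is the $\mathbb{C}$-linear (termwise) map given on monomials by $\delta_i(x_{i_1}\cdots x_{i_t})=\sum_{j:\,i_j=i}x_{i_{j+1}}\cdots x_{i_t}x_{i_1}\cdots x_{i_{j-1}}$. The Jacobi algebra is $\mathrm{Jac}(f)=\mathbb{C}\langle\langle x_1,\dots,x_d\rangle\rangle/I$, where $I$ is the closure of the two-sided ideal $(\delta_1f,\dots,\delta_df)$. For $s\in\mathrm{Jac}(f)$, $(s)$ is the two-sided ideal generated by $s$. The normal forms, with $q=z_1^2+\cdots+z_{d-2}^2$, are: $A_n$: $q+x^2+y^n$ with $n\ge2$; $A_\infty$: $q+x^2$; $D_{n,m}$: $q+xy^2+x^{2n}+x^{2m-1}$ with $n,m\ge2$ and $m\le2n-1$; $D_{n,\infty}$: $q+xy^2+x^{2n}$ with $n\ge2$;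 $D_{\infty,m}$: $q+xy^2+x^{2m-1}$ with $m\ge2$; $D_{\infty,\infty}$: $q+xy^2$; $E_{6,n}$: $q+x^3+xy^3+y^n$ with $n\ge4$; $E_{6,\infty}$: $q+x^3+xy^3$. The families $A_*$, $D_{*,*}$ and $E_{6,*}$ consist of all those with the respective letter. The six algebras are the quotients $\Gamma_i$ of the free algebra $\mathbb{C}\langle x,y,z\rangle$ by the two-sided ideals generated respectively by: $\Gamma_1$: $x+y+z,\ x,\ y,\ z$; $\Gamma_2$: $x+y+z,\ x^2,\ y^2,\ z^2$; $\Gamma_3$: $x+y+z,\ x^2,\ y^3,\ z^3$; $\Gamma_4$: $x+y+z,\ x^2,\ y^3,\ z^4$; $\Gamma_5$: $x^2+y+z,\ x^4,\ z^2+xyx,\ yxy+y^2x+yx^3$; $\Gamma_6$: $x+y+z,\ x^2,\ y^3,\ z^5$. Meaning of ''generic'': let $\mathcal{Z}$ be the centre of $\mathrm{Jac}(f)$ and $\mathfrak{m}_{\mathcal{Z}}$ its Jacobson radical. A statement holds for any generic central element if for every finite dimensional vector subspace $V\subset\mathfrak{m}_{\mathcal{Z}}$ surjecting onto $\mathfrak{m}_{\mathcal{Z}}/\mathfrak{m}_{\mathcal{Z}}^2$, there is a non-empty Zariski open subset $U$ of $V$ such that the statement holds for all $g\in U$.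
   Formalization: In type E with ε_4=0 (f=E_{6,∞}), s is taken to be x²+xyx+yx² for every n; the stated g_{6,n} with its correction term is not central there when n≡0 or 2 mod 3, so the literal claim fails in those cases. *)

(* Defs.v *)
From HB Require Import structures.
From mathcomp Require Import all_boot all_order all_algebra.
From mathcomp Require Import boolp classical_sets reals complex monalg.
From mathcomp Require mpoly.

Set Implicit Arguments.
Unset Strict Implicit.
Unset Printing Implicit Defensive.

Import GRing.Theory.

Local Open Scope classical_set_scope.
Local Open Scope ring_scope.
Local Open Scope quotient_scope.

(* Associative unital algebras over a commutative ring K, as rings with a central
   ring morphism from K. The ring may be trivial, as can happen in a quotient;
   GRing.Algebra would demand 1 != 0. *)
Record pzAlg (K : comNzRingType) := PzAlg {
  alg_ring :> pzRingType;
  scalar : {rmorphism K -> alg_ring};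
  scalarC : forall (c : K) (a : alg_ring), scalar c * a = a * scalar c
}.

Definition alg_isomorphic (K : comNzRingType) (A B : pzAlg K) : Prop :=
  exists phi : {rmorphism A -> B},
    (forall c, phi (scalar A c) = scalar B c) /\ bijective phi.

Lemma in_alg_central (K : comNzRingType) (A : lalgType K)
    (scaleAr : forall (c : K) (a b : A), c *: (a * b) = a * (c *: b)) (c : K) (a : A) :
  in_alg A c * a = a * in_alg A c.
Proof. by rewrite /= -scalerAl mul1r -scaleAr mulr1. Qed.

Section Ideals.
Variable (A : pzRingType).

Definition twosided_ideal (I : set A) : Prop :=
  [/\ I 0, forall a b, I a -> I b -> I (a + b),
      forall a b, I b -> I (a * b) & forall a b, I a -> I (a * b)].

Definition left_ideal (I : set A) : Prop :=
  [/\ I 0, forall a b, I a -> I b -> I (a + b) & forall a b, I b -> I (a * b)].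

Record ideal := Ideal { ideal_set : set A; idealP : twosided_ideal ideal_set }.

Lemma twosided_ideal_smallest (S : set A) :
  twosided_ideal (smallest twosided_ideal S).
Proof.
split=> [I [[]]//|a b Ia Ib I HI|a b Ib I HI|a b Ia I HI].
- by case: (HI) => -[_ + _ _] _; apply; [apply: Ia|apply: Ib].
- by case: (HI) => -[_ _ + _] _; apply; apply: Ib.
- by case: (HI) => -[_ _ _ +] _; apply; apply: Ia.
Qed.

Definition gen_ideal (S : set A) : ideal := Ideal (twosided_ideal_smallest S).

Definition ideal_mul (I J : set A) : set A :=
  ideal_set (gen_ideal [set a * b | a in I & b in J]).

Fixpoint ideal_exp (I : set A) (n : nat) : set A :=
  if n is n'.+1 then ideal_mul (ideal_exp I n') I else setT.

Definition adic_closure (N S : set A) : set A :=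
  \bigcap_(i in setT) [set a + b | a in S & b in ideal_exp N i].

Lemma twosided_ideal_exp (N : set A) (n : nat) : twosided_ideal (ideal_exp N n).
Proof. by case: n => [|n]; [split | apply: twosided_ideal_smallest]. Qed.

Lemma twosided_ideal_adic_closure (N : set A) (I : ideal) :
  twosided_ideal (adic_closure N (ideal_set I)).
Proof.
case: I => I [I0 ID IMl IMr] /=; split=> [i _|a b Ha Hb i _|a b Hb i _|a b Ha i _];
  have [N0 ND NMl NMr] := twosided_ideal_exp N i.
- by exists 0 => //; exists 0 => //; rewrite addr0.
- have [a1 Ia1 [a2 Na2 <-]] := Ha i Logic.I.
  have [b1 Ib1 [b2 Nb2 <-]] := Hb i Logic.I.
  by exists (a1 + b1); [exact: ID|exists (a2 + b2); [exact: ND|rewrite addrACA]].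
- have [b1 Ib1 [b2 Nb2 <-]] := Hb i Logic.I.
  by exists (a * b1); [exact: IMl|exists (a * b2); [exact: NMl|rewrite mulrDr]].
- have [a1 Ia1 [a2 Na2 <-]] := Ha i Logic.I.
  by exists (a1 * b); [exact: IMr|exists (a2 * b); [exact: NMr|rewrite mulrDl]].
Qed.

Definition closure_ideal (N : set A) (I : ideal) : ideal :=
  Ideal (twosided_ideal_adic_closure N I).

Definition maximal_left_ideal (M : set A) : Prop :=
  [/\ left_ideal M, ~ M 1 &
      forall J : set A, left_ideal J -> ~ J 1 -> M `<=` J -> J = M].

Definition jacobson_radical : set A := \bigcap_(M in maximal_left_ideal) M.

End Ideals.

Section Quotient.
Variables (A : pzRingType) (I : ideal A).

Definition quot_rel (a b : A) : bool := `[< ideal_set I (a - b) >].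

Lemma quot_rel_equiv : equiv_class_of quot_rel.
Proof.
have [I0 ID IMl _] := idealP I.
split=> [a|a b|b a c]; rewrite /quot_rel.
- by rewrite subrr; apply/asboolP.
- by apply: asbool_equiv_eq; split=> H; have := IMl (-1) _ H; rewrite mulN1r opprB.
- by move=> /asboolP H1 /asboolP H2; apply/asboolP; have := ID _ _ H1 H2;
    rewrite addrA subrK.
Qed.

Canonical quot_equivrel := EquivRelPack quot_rel_equiv.
Canonical quot_encModRel := defaultEncModRel quot_rel.

Definition quot := {eq_quot quot_rel}.
HB.instance Definition _ : EqQuotient A quot_rel quot := EqQuotient.on quot.
HB.instance Definition _ := Choice.on quot.

Definition class_of (a : A) : quot := \pi_quot a.

Lemma class_eq a b : class_of a = class_of b <-> ideal_set I (a - b).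
Proof.
by split=> [/eqmodP/asboolP|H]; [|apply/eqmodP/asboolP].
Qed.

Lemma reprI a : ideal_set I (repr (class_of a) - a).
Proof. by apply/class_eq; rewrite /class_of reprK. Qed.

Lemma quotW (P : quot -> Prop) : (forall a, P (class_of a)) -> forall u, P u.
Proof. by move=> H u; rewrite -[u]reprK; apply: H. Qed.

Definition quot_zero : quot := class_of 0.
Definition quot_one : quot := class_of 1.
Definition quot_opp (u : quot) : quot := class_of (- repr u).
Definition quot_add (u v : quot) : quot := class_of (repr u + repr v).
Definition quot_mul (u v : quot) : quot := class_of (repr u * repr v).

Lemma class_opp a : quot_opp (class_of a) = class_of (- a).
Proof.
have [_ _ IMl _] := idealP I.
apply/class_eq; rewrite -opprD -[X in ideal_set _ X]mulN1r; apply: IMl; exact: reprI.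
Qed.

Lemma class_add a b : quot_add (class_of a) (class_of b) = class_of (a + b).
Proof.
have [_ ID _ _] := idealP I.
by apply/class_eq; rewrite opprD addrACA; apply: ID; apply: reprI.
Qed.

Lemma class_mul a b : quot_mul (class_of a) (class_of b) = class_of (a * b).
Proof.
have [_ ID IMl IMr] := idealP I; apply/class_eq.
set a' := repr _; set b' := repr _.
have -> : a' * b' - a * b = a' * (b' - b) + (a' - a) * b.
  by rewrite mulrBr mulrBl addrA subrK.
by apply: ID; [apply: IMl|apply: IMr]; apply: reprI.
Qed.

Definition classE := (class_opp, class_add, class_mul).

Lemma quot_addA : associative quot_add.
Proof. by elim/quotW=> a; elim/quotW=> b; elim/quotW=> c; rewrite !classE addrA. Qed.
Lemma quot_addC : commutative quot_add.
Proof. by elim/quotW=> a; elim/quotW=> b; rewrite !classE addrC. Qed.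
Lemma quot_add0 : left_id quot_zero quot_add.
Proof. by elim/quotW=> a; rewrite !classE add0r. Qed.
Lemma quot_addN : left_inverse quot_zero quot_opp quot_add.
Proof. by elim/quotW=> a; rewrite !classE addNr. Qed.
HB.instance Definition _ :=
  GRing.isZmodule.Build quot quot_addA quot_addC quot_add0 quot_addN.

Lemma quot_mulA : associative quot_mul.
Proof. by elim/quotW=> a; elim/quotW=> b; elim/quotW=> c; rewrite !classE mulrA. Qed.
Lemma quot_mul1l : left_id quot_one quot_mul.
Proof. by elim/quotW=> a; rewrite !classE mul1r. Qed.
Lemma quot_mul1r : right_id quot_one quot_mul.
Proof. by elim/quotW=> a; rewrite !classE mulr1. Qed.
Lemma quot_mulDl : left_distributive quot_mul +%R.
Proof.
by elim/quotW=> a; elim/quotW=> b; elim/quotW=> c; rewrite /GRing.add /= !classE mulrDl.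
Qed.
Lemma quot_mulDr : right_distributive quot_mul +%R.
Proof.
by elim/quotW=> a; elim/quotW=> b; elim/quotW=> c; rewrite /GRing.add /= !classE mulrDr.
Qed.
HB.instance Definition _ := GRing.Zmodule_isPzRing.Build quot
  quot_mulA quot_mul1l quot_mul1r quot_mulDl quot_mulDr.

Lemma class_of_zmod_morphism : zmod_morphism class_of.
Proof. by move=> a b; rewrite /GRing.opp /GRing.add /= !classE. Qed.
Lemma class_of_monoid_morphism : GRing.monoid_morphism class_of.
Proof. by split=> // a b; rewrite /GRing.mul /= classE. Qed.
HB.instance Definition _ :=
  GRing.isZmodMorphism.Build A quot class_of class_of_zmod_morphism.
HB.instance Definition _ :=
  GRing.isMonoidMorphism.Build A quot class_of class_of_monoid_morphism.

End Quotient.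

Section QuotientAlgebra.
Variables (K : comNzRingType) (A : pzAlg K) (I : ideal A).

Definition quot_scalar : K -> quot I := class_of I \o scalar A.
HB.instance Definition _ := GRing.RMorphism.on quot_scalar.

Lemma quot_scalarC (c : K) (u : quot I) : quot_scalar c * u = u * quot_scalar c.
Proof. by elim/quotW: u => a; rewrite /quot_scalar /= -!(rmorphM (class_of I)) /= scalarC. Qed.

Definition quot_alg : pzAlg K := PzAlg quot_scalarC.

End QuotientAlgebra.

Definition central (A : pzRingType) (z : A) : Prop := forall a, z * a = a * z.

Section Centre.
Variable A : pzRingType.

Definition in_centre : {pred A} := fun z => `[< central z >].

Record centre := Centre { centre_val :> A; centre_valP : in_centre centre_val }.

HB.instance Definition _ := [isSub for centre_val].
HB.instance Definition _ := [Choice of centre by <:].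

Lemma in_centre_subring : subring_closed in_centre.
Proof.
split=> [|z t /asboolP Hz /asboolP Ht|z t /asboolP Hz /asboolP Ht].
- by apply/asboolP => a; rewrite mul1r mulr1.
- by apply/asboolP => a; rewrite mulrBl mulrBr Hz Ht.
- by apply/asboolP => a; rewrite -mulrA Ht mulrA Hz mulrA.
Qed.

HB.instance Definition _ :=
  GRing.SubChoice_isSubPzRing.Build A in_centre centre in_centre_subring.
End Centre.

Section CentreAlgebra.
Variables (K : comNzRingType) (A : pzAlg K).

Lemma scalar_in_centre (c : K) : in_centre (scalar A c).
Proof. by apply/asboolP => a; rewrite scalarC. Qed.

Definition centre_scalar (c : K) : centre A := Centre (scalar_in_centre c).

Lemma centre_scalar_zmod_morphism : zmod_morphism centre_scalar.
Proof. by move=> a b; apply: val_inj; rewrite rmorphB /= rmorphB. Qed.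
Lemma centre_scalar_monoid_morphism : GRing.monoid_morphism centre_scalar.
Proof.
by split=> [|a b]; apply: val_inj; rewrite ?rmorphM ?rmorph1 /= ?rmorphM ?rmorph1.
Qed.
HB.instance Definition _ :=
  GRing.isZmodMorphism.Build K (centre A) centre_scalar centre_scalar_zmod_morphism.
HB.instance Definition _ :=
  GRing.isMonoidMorphism.Build K (centre A) centre_scalar centre_scalar_monoid_morphism.

Lemma centre_scalarC (c : K) (z : centre A) : centre_scalar c * z = z * centre_scalar c.
Proof. by apply: val_inj; rewrite !rmorphM /= scalarC. Qed.

Definition centre_alg : pzAlg K := PzAlg centre_scalarC.

End CentreAlgebra.

Section Generic.
Variable K : fieldType.

Definition lin_comb (A : pzAlg K) (n : nat) (e : 'I_n -> A) (c : 'I_n -> K) : A :=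
  \sum_i scalar A (c i) * e i.

(* e is a basis of the subspace W of A *)
Definition is_basis (A : pzAlg K) (n : nat) (e : 'I_n -> A) (W : set A) : Prop :=
  W = range (lin_comb e) /\ (forall c, lin_comb e c = 0 -> forall i, c i = 0).

Definition fin_dim_subspace (A : pzAlg K) (W : set A) : Prop :=
  exists n (e : 'I_n -> A), is_basis e W.

Definition zariski_open_affine (n : nat) (O : set ('I_n -> K)) : Prop :=
  exists P : set (mpoly.mpoly n K),
    O = [set c | exists2 p, P p & mpoly.meval c p != 0].

(* The topology obtained by identifying W with K^n through a basis; it does not
   depend on the basis since linear changes of coordinates are homeomorphisms. *)
Definition zariski_open (A : pzAlg K) (W U : set A) : Prop :=
  exists n (e : 'I_n -> A),
    is_basis e W /\
    exists2 O : set ('I_n -> K), zariski_open_affine O & U = lin_comb e @` O.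

Definition holds_generically (A : pzAlg K) (Q : A -> Prop) : Prop :=
  let m := @jacobson_radical (centre_alg A) in
  forall V : set (centre_alg A),
    fin_dim_subspace V -> V `<=` m ->
    (forall z, m z -> exists2 v, V v & ideal_exp m 2 (z - v)) ->
    exists U : set (centre_alg A),
      [/\ zariski_open V U, U !=set0 & forall g, U g -> Q (centre_val g)].

End Generic.

(* Formal power series in d noncommuting variables; words are sequences of
   variables, and a series is its family of coefficients. *)
Record ncps (K : Type) (d : nat) := NCPS { coef : seq 'I_d -> K }.

HB.instance Definition _ (K : Type) d := [isNew for @coef K d].
HB.instance Definition _ (K : eqType) d := [Equality of ncps K d by <:].
HB.instance Definition _ (K : choiceType) d := [Choice of ncps K d by <:].

Section PowerSeries.
Variables (K : comNzRingType) (d : nat).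
Implicit Types (f g h : ncps K d) (w : seq 'I_d).

Lemma ncpsP f g : (forall w, coef f w = coef g w) -> f = g.
Proof. by case: f g => [f] [g] /= H; congr NCPS; apply/funext. Qed.

Definition ncps_zero : ncps K d := NCPS (fun=> 0).
Definition ncps_one : ncps K d := NCPS (fun w => (w == [::])%:R).
Definition ncps_opp f : ncps K d := NCPS (fun w => - coef f w).
Definition ncps_add f g : ncps K d := NCPS (fun w => coef f w + coef g w).
Definition ncps_scale (c : K) f : ncps K d := NCPS (fun w => c * coef f w).
Definition ncps_mul f g : ncps K d :=
  NCPS (fun w => \sum_(i < (size w).+1) coef f (take i w) * coef g (drop i w)).

Lemma ncps_addA : associative ncps_add.
Proof. by move=> f g h; apply: ncpsP => w /=; rewrite addrA. Qed.
Lemma ncps_addC : commutative ncps_add.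
Proof. by move=> f g; apply: ncpsP => w /=; rewrite addrC. Qed.
Lemma ncps_add0 : left_id ncps_zero ncps_add.
Proof. by move=> f; apply: ncpsP => w /=; rewrite add0r. Qed.
Lemma ncps_addN : left_inverse ncps_zero ncps_opp ncps_add.
Proof. by move=> f; apply: ncpsP => w /=; rewrite addNr. Qed.
HB.instance Definition _ :=
  GRing.isZmodule.Build (ncps K d) ncps_addA ncps_addC ncps_add0 ncps_addN.

Definition ncps_shift a f : ncps K d := NCPS (fun w => coef f (a :: w)).

Lemma coef_mul_nil f g : coef (ncps_mul f g) [::] = coef f [::] * coef g [::].
Proof. by rewrite /= big_ord_recl big_ord0 addr0. Qed.

Lemma coef_mul_cons f g a w : coef (ncps_mul f g) (a :: w) =
  coef f [::] * coef g (a :: w) + coef (ncps_mul (ncps_shift a f) g) w.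
Proof. by rewrite /= big_ord_recl. Qed.

Lemma ncps_mulDl : left_distributive ncps_mul +%R.
Proof.
move=> f g h; apply: ncpsP => w /=; rewrite -big_split /=.
by apply: eq_bigr => i _; rewrite mulrDl.
Qed.
Lemma ncps_mulDr : right_distributive ncps_mul +%R.
Proof.
move=> f g h; apply: ncpsP => w /=; rewrite -big_split /=.
by apply: eq_bigr => i _; rewrite mulrDr.
Qed.

Lemma ncps_mulZl c f g : ncps_mul (ncps_scale c f) g = ncps_scale c (ncps_mul f g).
Proof.
apply: ncpsP => w /=; rewrite mulr_sumr.
by apply: eq_bigr => i _; rewrite mulrA.
Qed.
Lemma ncps_mulZr c f g : ncps_mul f (ncps_scale c g) = ncps_scale c (ncps_mul f g).
Proof.
apply: ncpsP => w /=; rewrite mulr_sumr.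
by apply: eq_bigr => i _; rewrite mulrCA.
Qed.

Lemma ncps_mulA : associative ncps_mul.
Proof.
move=> f g h; apply: ncpsP => w; elim: w f g h => [|a w IHw] f g h.
  by rewrite !coef_mul_nil mulrA.
rewrite !coef_mul_cons IHw coef_mul_nil.
have -> : ncps_shift a (ncps_mul f g) =
    ncps_scale (coef f [::]) (ncps_shift a g) + ncps_mul (ncps_shift a f) g.
  by apply: ncpsP => v; apply: coef_mul_cons.
by rewrite ncps_mulDl ncps_mulZl /= mulrDr !addrA mulrA.
Qed.

Lemma ncps_mul1l : left_id ncps_one ncps_mul.
Proof.
move=> f; apply: ncpsP => w /=; rewrite big_ord_recl /= take0 drop0 mul1r.
case: w => [|a w]; first by rewrite big_ord0 addr0.
by rewrite big1 ?addr0 // => i _; rewrite /= mul0r.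
Qed.
Lemma ncps_mul1r : right_id ncps_one ncps_mul.
Proof.
move=> f; apply: ncpsP => w /=.
rewrite big_ord_recr /= take_size drop_size mulr1 big1 ?add0r // => -[i Hi] _ /=.
by rewrite -size_eq0 size_drop subn_eq0 leqNgt Hi mulr0.
Qed.
Lemma ncps_one_neq0 : ncps_one != 0.
Proof. by apply/eqP => /(congr1 (@coef K d ^~ [::])) /eqP; rewrite /= oner_eq0. Qed.
HB.instance Definition _ := GRing.Zmodule_isNzRing.Build (ncps K d)
  ncps_mulA ncps_mul1l ncps_mul1r ncps_mulDl ncps_mulDr ncps_one_neq0.

Lemma ncps_scaleA a b f : ncps_scale a (ncps_scale b f) = ncps_scale (a * b) f.
Proof. by apply: ncpsP => w /=; rewrite mulrA. Qed.
Lemma ncps_scale1 : left_id 1 ncps_scale.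
Proof. by move=> f; apply: ncpsP => w /=; rewrite mul1r. Qed.
Lemma ncps_scaleDr : right_distributive ncps_scale +%R.
Proof. by move=> c f g; apply: ncpsP => w /=; rewrite mulrDr. Qed.
Lemma ncps_scaleDl f : {morph ncps_scale^~ f : a b / a + b}.
Proof. by move=> a b; apply: ncpsP => w /=; rewrite mulrDl. Qed.
HB.instance Definition _ := GRing.Zmodule_isLmodule.Build K (ncps K d)
  ncps_scaleA ncps_scale1 ncps_scaleDr ncps_scaleDl.

Lemma ncps_scaleAl (c : K) f g : c *: (f * g) = (c *: f) * g.
Proof. by rewrite [RHS]ncps_mulZl. Qed.
Lemma ncps_scaleAr (c : K) f g : c *: (f * g) = f * (c *: g).
Proof. by rewrite [RHS]ncps_mulZr. Qed.
HB.instance Definition _ := GRing.Lmodule_isLalgebra.Build K (ncps K d) ncps_scaleAl.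
HB.instance Definition _ := GRing.Lalgebra_isAlgebra.Build K (ncps K d) ncps_scaleAr.

Definition ncps_alg : pzAlg K := PzAlg (in_alg_central ncps_scaleAr).

Definition ncvar (i : 'I_d) : ncps K d := NCPS (fun w => (w == [:: i])%:R).

Definition ncps_max : set (ncps K d) := [set f | coef f [::] = 0].

(* The words occurring (with multiplicity) in the cyclic derivative with respect
   to x_i of the monomial u. *)
Definition cyc_words (i : 'I_d) (u : seq 'I_d) : seq (seq 'I_d) :=
  [seq drop j.+1 u ++ take j u | j <- iota 0 (size u) & nth i u j == i].

(* Only the words u of length |w| + 1 contribute to the coefficient of w. *)
Definition cyc_deriv (i : 'I_d) f : ncps K d :=
  NCPS (fun w => \sum_(u : (size w).+1.-tuple 'I_d)
                   coef f u *+ count_mem w (cyc_words i u)).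

Definition jacobi_ideal f : ideal ncps_alg :=
  closure_ideal ncps_max (gen_ideal (range (cyc_deriv^~ f))).

Definition Jac f : pzAlg K := quot_alg (jacobi_ideal f).

Definition jac_class f (s : ncps K d) : Jac f := class_of (jacobi_ideal f) s.

Definition Jac_quot f (s : Jac f) : pzAlg K := quot_alg (gen_ideal [set s]).

End PowerSeries.

Section FreeAlgebra.
Variables (K : comNzRingType) (I : choiceType).

Lemma malg_scaleAr (c : K) (a b : {malg K[{fmonom I}]}) :
  c *: (a * b) = a * (c *: b).
Proof.
rewrite /GRing.mul /= [in RHS](fgmulrwl (msuppZ_le c b)).
rewrite fgmulr scaler_sumr; apply: eq_bigr => k2 _.
rewrite scaler_sumr; apply: eq_bigr => k1 _.
by apply/malgP => k; rewrite !(mcoeffZ, mcoeffU) mulrCA mulrnAr.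
Qed.

Definition free_alg : pzAlg K := PzAlg (in_alg_central malg_scaleAr).

End FreeAlgebra.

Section Gamma.
Variable K : fieldType.

Definition free3 : pzAlg K := free_alg K 'I_3.

Definition free3_var (i : 'I_3) : free3 := (<< fmu i >> : {malg K[{fmonom 'I_3}]}).

Local Notation x := (free3_var 0).
Local Notation y := (free3_var 1).
Local Notation z := (free3_var 2).

(* The index is 0-based. *)
Definition relations (i : 'I_6) : seq free3 :=
  nth [::]
    [:: [:: x + y + z; x; y; z];
        [:: x + y + z; x ^+ 2; y ^+ 2; z ^+ 2];
        [:: x + y + z; x ^+ 2; y ^+ 3; z ^+ 3];
        [:: x + y + z; x ^+ 2; y ^+ 3; z ^+ 4];
        [:: x ^+ 2 + y + z; x ^+ 4; z ^+ 2 + x * y * x;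
            y * x * y + y ^+ 2 * x + y * x ^+ 3];
        [:: x + y + z; x ^+ 2; y ^+ 3; z ^+ 5]] i.

Definition Gamma_ (i : 'I_6) : pzAlg K :=
  quot_alg (gen_ideal [set r : free3 | r \in relations i]).

End Gamma.

Definition Gamma1 (K : fieldType) : pzAlg K := Gamma_ K 0.
Definition Gamma2 (K : fieldType) : pzAlg K := Gamma_ K 1.
Definition Gamma3 (K : fieldType) : pzAlg K := Gamma_ K 2.

(* Exponents in N together with infinity (None). *)
Definition exponent := option nat.
Definition geq_exp (e : exponent) (n : nat) : bool := if e is Some m then (n <= m)%N else true.
(* a term with infinite exponent is omitted *)
Definition pow (A : pzRingType) (a : A) (e : exponent) : A :=
  if e is Some n then a ^+ n else 0.

Section NormalForms.
Variables (K : fieldType) (k : nat).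

(* d = k + 2 variables, in the order z_1, ..., z_k, x, y *)
Local Notation S := (ncps K k.+2).
Definition zvar (i : 'I_k) : S := ncvar K (inord i).
Definition xvar : S := ncvar K (inord k).
Definition yvar : S := ncvar K (inord k.+1).
Definition zquad : S := \sum_(i < k) zvar i ^+ 2.

Local Notation x := xvar.
Local Notation y := yvar.
Local Notation q := zquad.

Definition familyA : set S := [set f |
  (exists2 n, (2 <= n)%N & f = q + x ^+ 2 + y ^+ n) \/ f = q + x ^+ 2].

Definition familyD : set S := [set f |
  [\/ exists n m, [/\ (2 <= n)%N, (2 <= m)%N, (m <= 2 * n - 1)%N &
        f = q + x * y ^+ 2 + x ^+ (2 * n) + x ^+ (2 * m - 1)],
      exists2 n, (2 <= n)%N & f = q + x * y ^+ 2 + x ^+ (2 * n),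
      exists2 m, (2 <= m)%N & f = q + x * y ^+ 2 + x ^+ (2 * m - 1) |
      f = q + x * y ^+ 2]].

Definition familyE6 : set S := [set f |
  (exists2 n, (4 <= n)%N & f = q + x ^+ 3 + x * y ^+ 3 + y ^+ n) \/
  f = q + x ^+ 3 + x * y ^+ 3].

Definition potA (eps1 : bool) (n : exponent) : S :=
  q + x ^+ 2 + eps1%:R * pow y n.

Definition potD (eps2 eps3 : bool) (n m : exponent) : S :=
  q + x * y ^+ 2 + eps2%:R * pow x (omap (fun n => 2 * n)%N n)
                 + eps3%:R * pow x (omap (fun m => 2 * m - 1)%N m).

Definition potE (eps4 : bool) (n : nat) : S :=
  q + x ^+ 3 + x * y ^+ 3 + eps4%:R * y ^+ n.

(* The correction terms for n = 3t+2 and n = 3t have x-degree tending to infinity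
   with n, so that they are omitted when n is infinite. *)
Definition g6 (e : exponent) : S :=
  x ^+ 2 + x * y * x + y * x ^+ 2 +
  if e is Some n then
    let t := (n %/ 3)%N in
    match (n %% 3)%N with
    | 0 => ((-1) ^+ t.+1 * 3 ^+ t * t%:R : K) *:
             (x * y * x ^+ (2 * t - 2) + y * x ^+ (2 * t - 1))
    | 1 => 0
    | _ => ((-1) ^+ t * 3 ^+ t * (3 * t + 2)%:R : K) *: x ^+ (2 * t + 1)
    end
  else 0.

(* The pairs (f, s). If eps4 = 0 then f is the form with infinite exponent and s is
   taken to be g6 at infinity: the finite corrections are not central there. *)
Variant potential_elt : S -> S -> Prop :=
| PotA (eps1 : bool) (n : exponent) of geq_exp n 2 :
    potential_elt (potA eps1 n) y
| PotD (eps2 eps3 : bool) (n m : exponent)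
    of geq_exp n 2 & geq_exp m 2 & familyD (potD eps2 eps3 n m) :
    potential_elt (potD eps2 eps3 n m) (x ^+ 2)
| PotE (eps4 : bool) (n : nat) of (4 <= n)%N :
    potential_elt (potE eps4 n) (g6 (if eps4 then Some n else None)).

End NormalForms.

(* Main.v *)
From HB Require Import structures.
From Stdlib Require QArith.
From mathcomp Require Import all_boot all_order all_algebra.
From mathcomp Require Import boolp classical_sets reals complex monalg finmap ring ssrZ.
From mathcomp Require Import (canonicals) mpoly.
Require Import Defs.

(** Why the theorem is true.

    Every isomorphism is obtained from two morphisms that are inverse on generators
    ([iso_criterion]). Out of the presented algebra one evaluates the free algebra.
    Out of the Jacobi algebra one evaluates power series, which is possible
    without any topology in an algebra where all sufficiently long words in the images of
    the variables vanish ([nil_eval]); such an evaluation kills all series of high order,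
    hence the closed ideal as soon as it kills the derivatives, and it is determined by the
    images of the variables ([nil_eval_hom]). Centrality of an element is tested on the
    variables, because the Jacobi ideal is closed ([jac_central]).

    In type A the derivatives give [x = 0] and [z_j = 0], and everything is a series in
    [y]. In type D they say that [x] and [y] anticommute and that [y^2] is a series in [x]
    of order two; so [x^2] is central, and modulo [x^2] two anticommuting
    generators of square zero remain, which is [Gamma2].

    In type E the relations are [3 x^2 + y^3 = 0] and
    [y y x + y x y + x y y + eps n y^(n-1) = 0]. The first makes [c = x^2] central and
    [y^3 = - 3 c]; the second says how [x y x y] and [y x y x] differ, and the correction term
    of [s] is designed to compensate this ([e6_comm_Y]). Modulo [s] the element [T = c x] satisfies
    [T (1 + y + eta) = - y T] with [eta] of positive order; iterating this and using
    [y^3 = - 3 c] gives [T = T * 3 c w^3] with [w] invertible, whence [T = 0] ([e6_socle]). What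
    remains is an algebra where each element is [p(y) + q(y) x + r(y) x y], and only the
    exponents 4, 5, 6 leave a trace of [y^n]. Explicit polynomial changes of variables
    ([change4] to [change7]) bring it to the relations [u^2 = 0],
    [u v^2 + v u v + v^2 u = 0] and [v^3 = N u v u]; all the identities are verified by computing
    normal forms with rational coefficients ([norm_eq]). With [r^2 = - N] the elements
    [X = - 2 r u] and [Y = v + r u] satisfy [X^2 = Y^3 = (X + Y)^3 = 0], which is [Gamma3].

    For generic central elements, the Jacobi algebra is local, and in types A and D every
    central element without constant term is a multiple [s u] of [s]. In type D this is
    seen by testing commutators against linear functionals on coefficients of degree two and
    three that vanish on the Jacobi ideal ([central_low]). A further functional sends [s u] to
    the constant term of [u]; where it does not vanish, [u] is a unit and [s u]
    generates the same ideal as [s] ([generic_nontrivial]). Finally, the three families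
    are disjoint, as coefficients of degree two and three show. *)

Set Implicit Arguments.
Unset Strict Implicit.
Unset Printing Implicit Defensive.

Import Order.TTheory GRing.Theory Num.Theory.
Local Open Scope classical_set_scope.
Local Open Scope ring_scope.

(** * Ideals, quotients and the free algebra *)

Section Ideals.
Variables (A B : pzRingType).

Lemma gen_ideal_in (S : set A) a : S a -> ideal_set (gen_ideal S) a.
Proof. by move=> Sa I [_ SI]; apply: SI. Qed.

Lemma gen_ideal_min (S J : set A) :
  twosided_ideal J -> S `<=` J -> ideal_set (gen_ideal S) `<=` J.
Proof. by move=> HJ SJ a; apply; split. Qed.

(** With [gen_ideal_min], a morphism vanishes on an ideal as soon as it does on generators. *)
Lemma ker_ideal (f : {rmorphism A -> B}) : twosided_ideal [set a | f a = 0].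
Proof.
split=> /= [|a b fa fb|a b fb|a b fa]; first exact: rmorph0.
- by rewrite rmorphD fa fb addr0.
- by rewrite rmorphM fb mulr0.
- by rewrite rmorphM fa mul0r.
Qed.

Lemma class_surj (I : ideal A) (u : quot I) : exists a, u = class_of I a.
Proof. by exists (repr u); rewrite /class_of reprK. Qed.

End Ideals.

Section QuotientLift.
Variables (A B : pzRingType) (I : ideal A) (f : {rmorphism A -> B}).
Hypothesis fI : forall a, ideal_set I a -> f a = 0.

(** The vanishing proof is an argument so that the ring morphism structure can be
    attached to the map. *)
Definition quot_map (_ : forall a, ideal_set I a -> f a = 0) (u : quot I) : B :=
  f (repr u).
Local Notation g := (quot_map fI).

Lemma quot_mapE a : g (class_of I a) = f a.
Proof. by apply/eqP; rewrite -subr_eq0 -rmorphB fI //; apply: reprI. Qed.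

Lemma quot_mapB : zmod_morphism g.
Proof.
move=> u v; have [a ->] := class_surj u; have [b ->] := class_surj v.
by rewrite -rmorphB !quot_mapE rmorphB.
Qed.

Lemma quot_mapM : GRing.monoid_morphism g.
Proof.
split; first by rewrite -(rmorph1 (class_of I)) quot_mapE rmorph1.
move=> u v; have [a ->] := class_surj u; have [b ->] := class_surj v.
by rewrite -rmorphM !quot_mapE rmorphM.
Qed.

HB.instance Definition _ := GRing.isZmodMorphism.Build _ _ g quot_mapB.
HB.instance Definition _ := GRing.isMonoidMorphism.Build _ _ g quot_mapM.

End QuotientLift.
Arguments quot_map : simpl never.

Section FreeAlgebra.
Variables (K : fieldType) (B : pzAlg K).
Implicit Types (g : free3 K).

Definition fm_eval (a : 'I_3 -> B) (m : fmonom 'I_3) : B :=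
  \prod_(i <- (m : seq 'I_3)) a i.

(** The value at the letters [a] of an element of the free algebra, a finite sum of words. *)
Definition free_eval (a : 'I_3 -> B) (g : {malg K[fmonom 'I_3]}) : B :=
  \sum_(m <- msupp g) scalar B g@_m * fm_eval a m.

Section Eval.
Variable a : 'I_3 -> B.

(** Sums over a common support make evaluation visibly additive. *)
Lemma free_evalEw (D : {fset fmonom 'I_3}) (g : {malg K[fmonom 'I_3]}) :
  (msupp g `<=` D)%fset ->
  free_eval a g = \sum_(m <- D) scalar B g@_m * fm_eval a m.
Proof.
move=> le; rewrite /free_eval (big_fset_incl _ le) => //= m mD /mcoeff_outdom ->.
by rewrite rmorph0 mul0r.
Qed.

Lemma free_evalB : zmod_morphism (free_eval a).
Proof.
move=> g h; set D := (msupp g `|` msupp h)%fset.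
rewrite (@free_evalEw D) ?msuppB_le // (@free_evalEw D g) ?fsubsetUl //.
rewrite (@free_evalEw D h) ?fsubsetUr // -sumrB.
by apply: eq_bigr => m _; rewrite mcoeffB rmorphB mulrBl.
Qed.

HB.instance Definition _ := GRing.isZmodMorphism.Build _ _ (free_eval a) free_evalB.

Lemma free_evalU c m : free_eval a << c *g m >> = scalar B c * fm_eval a m.
Proof. by rewrite (free_evalEw msuppU_le) big_seq_fset1 mcoeffUU. Qed.

Lemma free_evalM : GRing.monoid_morphism (free_eval a).
Proof.
split=> [|g h].
  by rewrite /GRing.one /= free_evalU /fm_eval fm1 big_nil rmorph1 mulr1.
rewrite malgME raddf_sum [X in X * _]/free_eval mulr_suml; apply: eq_bigr => m _.
rewrite raddf_sum mulr_sumr; apply: eq_bigr => n _.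
rewrite /= free_evalU rmorphM /fm_eval fmM big_cat /= -!mulrA; congr (_ * _).
by rewrite !mulrA; congr (_ * _); rewrite scalarC.
Qed.

HB.instance Definition _ := GRing.isMonoidMorphism.Build _ _ (free_eval a) free_evalM.

Lemma free_eval_var i : free_eval a (free3_var K i) = a i.
Proof. by rewrite /free3_var free_evalU /fm_eval fmU big_seq1 rmorph1 mul1r. Qed.

Lemma free_eval_scalar c : free_eval a (scalar (free3 K) c) = scalar B c.
Proof.
by rewrite /= -mul_malgC mulr1 free_evalU /fm_eval fm1 big_nil mulr1.
Qed.

End Eval.

Lemma free3_hom_eq (phi psi : {rmorphism free3 K -> B}) :
  (forall c, phi (scalar _ c) = psi (scalar _ c)) ->
  (forall i, phi (free3_var K i) = psi (free3_var K i)) -> phi =1 psi.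
Proof.
move=> Hc Hv g; rewrite [g]monalgE !raddf_sum; apply: eq_bigr => m _ /=.
have -> : << g@_m *g m >> = scalar (free3 K) g@_m * << m >> :> free3 K.
  by rewrite /= -mul_malgC mulr1 {1}/GRing.mul /= fgmulUU mul1m mulr1.
rewrite !rmorphM Hc; congr (_ * _).
case: m => /= s; elim: s => [|i s IHs].
  have -> : << FMonom [::] >> = 1 :> free3 K.
    by rewrite /GRing.one /=; congr (<< _ *g _ >>); apply/val_inj; rewrite /= fm1.
  by rewrite !rmorph1.
have -> : << FMonom (i :: s) >> = free3_var K i * << FMonom s >> :> free3 K.
  rewrite /free3_var {1}/GRing.mul /= fgmulUU mulr1; congr (<< _ *g _ >>).
  by apply/val_inj; rewrite /= fmM fmU.
by rewrite !rmorphM Hv IHs.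
Qed.

End FreeAlgebra.

(** * Noncommutative power series *)

Section Series.
Variables (K : comNzRingType) (d : nat).
Implicit Types (f g : ncps K d) (w : seq 'I_d).

Lemma coefD f g w : coef (f + g) w = coef f w + coef g w. Proof. by []. Qed.
Lemma coefN f w : coef (- f) w = - coef f w. Proof. by []. Qed.
Lemma coef1 w : coef (1 : ncps K d) w = (w == [::])%:R. Proof. by []. Qed.
Lemma coefZ c f w : coef (c *: f) w = c * coef f w. Proof. by []. Qed.

Lemma coef_sum (I : Type) (r : seq I) (P : pred I) (F : I -> ncps K d) w :
  coef (\sum_(i <- r | P i) F i) w = \sum_(i <- r | P i) coef (F i) w.
Proof. by elim/big_rec2: _ => // i x y _ <-. Qed.

Lemma coefM0 f g : coef (f * g) [::] = coef f [::] * coef g [::].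
Proof. exact: coef_mul_nil. Qed.

Lemma coefM_cons f g a w : coef (f * g) (a :: w) =
  coef f [::] * coef g (a :: w) + coef (ncps_shift a f * g) w.
Proof. exact: coef_mul_cons. Qed.

Definition mono w : ncps K d := NCPS (fun v => (v == w)%:R).

Lemma mono_nil : mono [::] = 1. Proof. by []. Qed.

Lemma shift_var (a i : 'I_d) : ncps_shift a (ncvar K i) = (i == a)%:R.
Proof.
by apply: ncpsP => w /=; rewrite eqseq_cons eq_sym; case: eqP; case: w.
Qed.

Lemma shiftM a f g : ncps_shift a (f * g) =
  coef f [::] *: ncps_shift a g + ncps_shift a f * g.
Proof. by apply: ncpsP => w /=; exact: coefM_cons. Qed.

Lemma coef_var_mul i g w : coef (ncvar K i * g) w =
  if w is a :: v then (i == a)%:R * coef g v else 0.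
Proof.
case: w => [|a w]; first by rewrite coefM0 mul0r.
by rewrite coefM_cons mul0r add0r shift_var -mulr_natl mulr1 mulr_natl; case: eqP => _;
   rewrite ?mul1r ?mul0r.
Qed.

Lemma mono_cons i w : mono (i :: w) = ncvar K i * mono w.
Proof.
apply: ncpsP => -[|a v]; rewrite coef_var_mul //= eqseq_cons eq_sym.
by case: eqP; rewrite ?mul1r ?mul0r.
Qed.

Lemma mono_nseq i n : mono (nseq n i) = ncvar K i ^+ n.
Proof. by elim: n => [|n IH] //=; rewrite mono_cons IH exprS. Qed.

(** Splitting a series along the first letter of its words is what allows induction
    on the degree throughout. *)
Lemma ncps_decomp f :
  f = in_alg (ncps K d) (coef f [::]) + \sum_i ncvar K i * ncps_shift i f.
Proof.
apply: ncpsP => -[|a w]; rewrite coefD coef_sum coefZ coef1.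
  by rewrite eqxx mulr1 big1 ?addr0 // => i _; rewrite coef_var_mul.
rewrite [_ == _](_ : _ = false) // mulr0 add0r (bigD1 a) // coef_var_mul eqxx mul1r.
by rewrite big1 => [|i ia]; rewrite ?coef_var_mul ?(negPf ia) ?mul0r //= addr0.
Qed.

(** The powers of the maximal ideal, described by coefficients. *)
Definition order_ge n : set (ncps K d) :=
  [set f | forall w, (size w < n)%N -> coef f w = 0].

Lemma order_geM m n f g : order_ge m f -> order_ge n g -> order_ge (m + n) (f * g).
Proof.
move=> fm gn w wmn; rewrite {1}/GRing.mul /=; apply: big1 => i _.
case: (ltnP (size (take i w)) m) => [/fm->|mi]; first by rewrite mul0r.
rewrite gn ?mulr0 // size_drop -(ltn_add2l m) (leq_ltn_trans _ wmn) //.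
move: mi; rewrite size_take; case: ltnP => iw mi; last first.
  by have /eqP -> : (size w - i == 0)%N; [rewrite subn_eq0|rewrite addn0].
by rewrite -[leqRHS](subnKC (ltnW iw)) leq_add2r.
Qed.

Lemma order_ge_ideal n : twosided_ideal (order_ge n : set (ncps_alg K d)).
Proof.
split=> [w //|f g fn gn w wn|f g gn|f g fn].
- by rewrite coefD fn // gn // addr0.
- exact: (@order_geM 0 n).
- by rewrite -[n]addn0; apply: order_geM.
Qed.

Lemma ideal_exp_order n f : ideal_exp (@ncps_max K d : set (ncps_alg K d)) n f ->
  order_ge n f.
Proof.
elim: n f => [|n IHn] f //=; apply: gen_ideal_min; first exact: order_ge_ideal.
move=> _ [g gn [h h1 <-]]; rewrite -addn1; apply: order_geM; first exact: IHn.
by case.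
Qed.

(** The inverse is the geometric series, which has finitely many terms in each degree. *)
Lemma series_unit f : coef f [::] = 0 -> exists g, (1 - f) * g = 1 /\ g * (1 - f) = 1.
Proof.
move=> f0; have fn n : order_ge n (f ^+ n).
  elim: n => [|n IHn] //; rewrite exprS -add1n; apply: order_geM => //.
  by case=> // _; rewrite f0.
pose g : ncps K d := NCPS (fun w => \sum_(i < (size w).+1) coef (f ^+ i) w).
have gE n w : (size w < n)%N -> coef g w = coef (\sum_(i < n) f ^+ i) w.
  move=> wn; rewrite coef_sum /= -[RHS](big_mkord xpredT (fun i => coef (f ^+ i) w)).
  rewrite (big_cat_nat (n := (size w).+1)) //= big_mkord.
  rewrite [X in _ + X]big_nat_cond [X in _ + X]big1 ?addr0 // => i /andP[/andP[wi _] _].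
  exact: (fn i).
(* Modulo every power of the maximal ideal the inverse is a partial geometric sum. *)
have gO n : order_ge n (g - \sum_(i < n) f ^+ i).
  by move=> w wn; rewrite coefD coefN (gE n) // subrr.
have O0 h : (forall n, order_ge n h) -> h = 0.
  by move=> hO; apply: ncpsP => w; rewrite (hO (size w).+1).
have telescope n : (1 - f) * (\sum_(i < n) f ^+ i) = 1 - f ^+ n.
  by rewrite -[1 - f]opprB mulNr -subrX1 opprB.
have telescope' n : (\sum_(i < n) f ^+ i) * (1 - f) = 1 - f ^+ n.
  rewrite -telescope; apply/esym/commr_sum => i _.
  by apply/commr_sym/commrB; [exact: commr1|exact/commr_sym/commrX].
exists g; split; apply/eqP; rewrite -subr_eq0; apply/eqP/O0 => n.
  have -> : (1 - f) * g - 1 = (1 - f) * (g - \sum_(i < n) f ^+ i) - f ^+ n.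
    by rewrite mulrBr telescope -addrA -opprD subrK.
  have [_ OD OM _] := order_ge_ideal n.
  by apply: OD; [apply: OM|rewrite -mulN1r; apply: OM].
have -> : g * (1 - f) - 1 = (g - \sum_(i < n) f ^+ i) * (1 - f) - f ^+ n.
  by rewrite mulrBl telescope' -addrA -opprD subrK.
have [_ OD OM OMr] := order_ge_ideal n.
by apply: OD; [apply: OMr|rewrite -mulN1r; apply: OM].
Qed.

End Series.

(** * Evaluation of power series in algebras where long words vanish *)

Definition preserves_scalars (K : comNzRingType) (A B : pzAlg K) (phi : A -> B) :=
  forall c, phi (scalar A c) = scalar B c.

Section TruncatedEvaluation.
Variables (K : comNzRingType) (d : nat) (A : pzAlg K) (e : 'I_d -> A).
Implicit Types (f g : ncps K d) (w : seq 'I_d).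

Definition word_eval w : A := \prod_(i <- w) e i.

Lemma word_eval_rcons w i : word_eval (rcons w i) = word_eval w * e i.
Proof. by rewrite /word_eval big_rcons. Qed.

(** The sum of [coef f w * word_eval w] over the words of length less than [n], organized
    along the first letter. *)
Fixpoint trunc_eval n f : A :=
  if n is n'.+1 then
    scalar A (coef f [::]) + \sum_i e i * trunc_eval n' (ncps_shift i f)
  else 0.

Lemma trunc_evalS n f : trunc_eval n.+1 f =
  scalar A (coef f [::]) + \sum_i e i * trunc_eval n (ncps_shift i f).
Proof. by []. Qed.

Lemma trunc_evalB n : zmod_morphism (trunc_eval n).
Proof.
elim: n => [|n IHn] f g; first by rewrite /= subr0.
rewrite !trunc_evalS coefD coefN rmorphB -!addrA; congr (_ + _).
rewrite opprD addrCA; congr (_ + _); rewrite -sumrB; apply: eq_bigr => i _.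
by rewrite -mulrBr -IHn.
Qed.

HB.instance Definition _ n :=
  GRing.isZmodMorphism.Build _ _ (trunc_eval n) (@trunc_evalB n).

Lemma trunc_evalZ n c f : trunc_eval n (c *: f) = scalar A c * trunc_eval n f.
Proof.
elim: n f => [|n IHn] f; first by rewrite /= mulr0.
rewrite !trunc_evalS coefZ rmorphM mulrDr mulr_sumr; congr (_ + _); apply: eq_bigr => i _.
have -> : ncps_shift i (c *: f) = c *: ncps_shift i f by apply: ncpsP.
by rewrite IHn !mulrA scalarC.
Qed.

Lemma trunc_eval_order n f : order_ge n f -> trunc_eval n f = 0.
Proof.
elim: n f => //= n IHn f fn; rewrite fn // rmorph0 add0r big1 // => i _.
by rewrite IHn ?mulr0 // => w wn; apply: fn.
Qed.

Variable n : nat.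
Hypothesis words0 : forall w, size w = n.+1 -> word_eval w = 0.

Lemma word_eval_long w : (n < size w)%N -> word_eval w = 0.
Proof.
move=> nw; rewrite -(cat_take_drop n.+1 w) /word_eval big_cat /=.
by rewrite -/(word_eval _) words0 ?mul0r // size_takel.
Qed.

(** Cutting at any length beyond [n] has the same effect, since the words that
    differ are zero; the prefix [w] is what an induction along words needs. *)
Lemma trunc_eval_stable l m w f : (n < size w + l)%N -> (n < size w + m)%N ->
  word_eval w * trunc_eval l f = word_eval w * trunc_eval m f.
Proof.
elim: l m w f => [|l IHl] [|m] w f; rewrite ?addn0 => nl nm;
  try by rewrite word_eval_long ?mul0r.
rewrite !trunc_evalS !mulrDr !mulr_sumr; congr (_ + _); apply: eq_bigr => i _.
by rewrite !mulrA -word_eval_rcons (IHl m) // size_rcons addSnnS.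
Qed.

(** Truncated evaluation is multiplicative only because long words vanish: both sides
    contain all pairs of words of total length at most [n], and the further pairs
    on the right are zero. *)
Lemma trunc_eval_mul l w f g : (n < size w + l)%N ->
  word_eval w * trunc_eval l (f * g) =
  word_eval w * (trunc_eval l f * trunc_eval n.+1 g).
Proof.
elim: l w f g => [|l IHl] w f g nl.
  by rewrite word_eval_long ?mul0r //; rewrite addn0 in nl.
rewrite [trunc_eval l.+1 f]trunc_evalS mulrDl mulrDr.
have -> : word_eval w * (scalar A (coef f [::]) * trunc_eval n.+1 g) =
    word_eval w * (scalar A (coef f [::]) * trunc_eval l.+1 g).
  rewrite !mulrA -!scalarC -!mulrA (@trunc_eval_stable n.+1 l.+1) //.
  by rewrite ltn_addl.
have [G GE] : exists G, trunc_eval n.+1 g = G by eexists.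
rewrite GE.
rewrite !trunc_evalS coefM0 rmorphM mulr_suml !mulrDr !mulr_sumr -addrA.
congr (_ + _); rewrite -big_split /=; apply: eq_bigr => i _.
rewrite shiftM raddfD /= trunc_evalZ !mulrDr; congr (_ + _).
  by rewrite !mulrA; congr (_ * _); rewrite -!mulrA -scalarC.
rewrite -[in RHS]mulrA !mulrA -word_eval_rcons.
by rewrite IHl ?GE ?mulrA // size_rcons addSnnS.
Qed.

Lemma trunc_eval_monoid : GRing.monoid_morphism (trunc_eval n.+1).
Proof.
split=> [|f g].
  rewrite trunc_evalS coef1 rmorph1 big1 ?addr0 // => i _.
  have -> : ncps_shift i (1 : ncps K d) = 0 by apply: ncpsP.
  by rewrite raddf0 mulr0.
have := @trunc_eval_mul n.+1 [::] f g (ltnSn n).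
by rewrite /word_eval big_nil !mul1r.
Qed.

(** When all words of a given length vanish in [A], power series can be evaluated in [A]
    without any topology. The proof is an argument so that the ring morphism
    structure can be attached to the map. *)
Definition nil_eval (_ : forall w, size w = n.+1 -> word_eval w = 0) :
  ncps_alg K d -> A := trunc_eval n.+1.
Local Notation ev := (nil_eval words0).
HB.instance Definition _ := GRing.isZmodMorphism.Build _ _ ev (@trunc_evalB n.+1).
HB.instance Definition _ := GRing.isMonoidMorphism.Build _ _ ev trunc_eval_monoid.

Lemma nil_eval_scalar : preserves_scalars ev.
Proof. by move=> c; rewrite /nil_eval trunc_evalZ trunc_eval_monoid.1 mulr1. Qed.

Lemma nil_eval_order f : order_ge n.+1 f -> ev f = 0.
Proof. exact: trunc_eval_order. Qed.

(** No continuity has to be assumed: a morphism that agrees with the evaluation on letters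
    sends a series of order [n.+1] to a combination of words of that length, which are zero. *)
Lemma nil_eval_hom (theta : {rmorphism ncps_alg K d -> A}) :
  preserves_scalars theta -> (forall i, theta (ncvar K i) = e i) -> theta =1 ev.
Proof.
move=> thC thV f.
have aux l w g : (n < size w + l)%N ->
    word_eval w * theta g = word_eval w * trunc_eval l g.
  elim: l w g => [|l IHl] w g nl.
    by rewrite word_eval_long ?mul0r //; rewrite addn0 in nl.
  rewrite [in LHS](ncps_decomp g) rmorphD raddf_sum /= thC !mulrDr !mulr_sumr.
  congr (_ + _); apply: eq_bigr => i _.
  by rewrite rmorphM thV !mulrA -word_eval_rcons IHl // size_rcons addSnnS.
have := aux n.+1 [::] f (ltnSn n).
by rewrite /word_eval big_nil !mul1r.
Qed.

Lemma nil_eval_var i : ev (ncvar K i) = e i.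
Proof.
rewrite /nil_eval trunc_evalS rmorph0 add0r (bigD1 i) //= shift_var eqxx.
rewrite big1 ?addr0 => [|j ji]; last by rewrite shift_var eq_sym (negPf ji) raddf0 mulr0.
rewrite mulr1n; case: n words0 => [|n'] w0.
  by rewrite mulr0; have := w0 [:: i] erefl; rewrite /word_eval big_seq1 => ->.
rewrite trunc_evalS coef1 rmorph1 big1 ?addr0 ?mulr1 // => j _.
have -> : ncps_shift j (1 : ncps K d) = 0 by apply: ncpsP.
by rewrite raddf0 mulr0.
Qed.

End TruncatedEvaluation.

Section JacobiQuotient.
Variables (K : fieldType) (d : nat) (f : ncps K d).

(** An element of the closure differs from the algebraic ideal by a series of arbitrarily
    high order, so an ideal that contains all series of order [n] absorbs the closure. *)
Lemma jacobi_min n (J : set (ncps_alg K d)) :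
  twosided_ideal J -> order_ge n `<=` J -> (forall i, J (cyc_deriv i f)) ->
  ideal_set (jacobi_ideal f) `<=` J.
Proof.
move=> HJ nJ dJ g /(_ n Logic.I) [a Ia [b /ideal_exp_order/nJ Jb <-]].
have [_ JD _ _] := HJ; apply: JD => //.
by apply: gen_ideal_min Ia => // _ [i _ <-].
Qed.

Lemma jacobi_deriv i : ideal_set (jacobi_ideal f) (cyc_deriv i f).
Proof.
move=> n _; exists (cyc_deriv i f); first by apply: gen_ideal_in; exists i.
by exists 0; [case: (twosided_ideal_exp (@ncps_max K d : set (ncps_alg K d)) n)|rewrite addr0].
Qed.

Variable u : Jac f.

Definition jq : ncps_alg K d -> Jac_quot u :=
  class_of (gen_ideal [set u]) \o class_of (jacobi_ideal f).
HB.instance Definition _ := GRing.RMorphism.on jq.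

Lemma jq_surj b : exists g, b = jq g.
Proof.
have [a ->] := class_surj b; have [g ->] := class_surj a.
by exists g.
Qed.

Lemma jq_deriv i : jq (cyc_deriv i f) = 0.
Proof.
rewrite /jq /= (_ : class_of (jacobi_ideal f) _ = 0) ?rmorph0 //.
by rewrite -(rmorph0 (class_of _)); apply/class_eq; rewrite subr0; apply: jacobi_deriv.
Qed.

Lemma class_gen : class_of (gen_ideal [set u]) u = 0.
Proof. by rewrite -(rmorph0 (class_of _)); apply/class_eq; rewrite subr0; apply: gen_ideal_in. Qed.

Lemma jq_scalar : preserves_scalars jq. Proof. by []. Qed.

(** The universal property of the quotient of the Jacobi algebra, for targets in which long
    words vanish. *)
Lemma nil_hom_lift (G : pzAlg K) (e : 'I_d -> G) n s :
  u = jac_class f s ->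
  forall words0 : forall w, size w = n.+1 -> word_eval e w = 0,
  (forall i, nil_eval words0 (cyc_deriv i f) = 0) -> nil_eval words0 s = 0 ->
  exists2 chi : {rmorphism Jac_quot u -> G},
    preserves_scalars chi & forall i, chi (jq (ncvar K i)) = e i.
Proof.
move=> us w0 d0 s0.
have k1 g : ideal_set (jacobi_ideal f) g -> nil_eval w0 g = 0.
  move: g; apply: (@jacobi_min n.+1 [set g | nil_eval w0 g = 0]); first exact: ker_ideal.
    by move=> g; apply: (@nil_eval_order _ _ _ _ _ w0).
  by move=> i; apply: d0.
have k2 a : ideal_set (gen_ideal [set u]) a -> quot_map k1 a = 0.
  move: a; apply: (@gen_ideal_min _ _ [set a | quot_map k1 a = 0]); first exact: ker_ideal.
  by move=> a /= ->; rewrite us /jac_class quot_mapE.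
exists (quot_map k2) => [c|i].
  exact: (etrans (quot_mapE k2 _) (etrans (quot_mapE k1 _) (nil_eval_scalar w0 c))).
exact: (etrans (quot_mapE k2 _) (etrans (quot_mapE k1 _) (nil_eval_var w0 i))).
Qed.

Lemma gamma_hom_lift (i : 'I_6) (B : pzAlg K) (a : 'I_3 -> B) :
  (forall r, r \in relations K i -> free_eval a r = 0) ->
  exists2 psi : {rmorphism Gamma_ K i -> B},
    preserves_scalars psi & forall j, psi (class_of _ (free3_var K j)) = a j.
Proof.
move=> ra.
have k r : ideal_set (gen_ideal [set r : free3 K | r \in relations K i]) r ->
    free_eval a r = 0.
  by move: r; apply: (@gen_ideal_min _ _ [set r | free_eval a r = 0]); [exact: ker_ideal|exact: ra].
exists (quot_map k) => [c|j].
  exact: (etrans (quot_mapE k _) (free_eval_scalar a c)).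
exact: (etrans (quot_mapE k _) (free_eval_var a j)).
Qed.

(** The two composites fix the generators, and this suffices on both sides: trivially for
    the free algebra, and by uniqueness of evaluation for power series. *)
Lemma jac_gamma_iso (i : 'I_6) n
    (chi : {rmorphism Jac_quot u -> Gamma_ K i})
    (psi : {rmorphism Gamma_ K i -> Jac_quot u}) :
  (forall w, size w = n.+1 -> word_eval (fun i => jq (ncvar K i)) w = 0) ->
  preserves_scalars chi -> preserves_scalars psi ->
  (forall i, psi (chi (jq (ncvar K i))) = jq (ncvar K i)) ->
  (forall j, let v := class_of _ (free3_var K j) in chi (psi v) = v) ->
  alg_isomorphic (Jac_quot u) (Gamma_ K i).
Proof.
move=> w0 chiC psiC pc cp; exists chi; split=> //; exists psi => [b|g].
  have [g ->] := jq_surj b.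
  pose theta : {rmorphism ncps_alg K d -> Jac_quot u} := psi \o chi \o jq.
  rewrite [RHS](nil_eval_hom w0 jq_scalar) //; apply: (nil_eval_hom w0 (theta := theta)).
    by move=> c; rewrite /= jq_scalar chiC psiC.
  by move=> j; apply: pc.
have [r ->] := class_surj g.
pose G : {rmorphism free3 K -> Gamma_ K i} := class_of _.
apply: (@free3_hom_eq _ _ (chi \o psi \o G) G) => [c|j]; last exact: cp.
by rewrite /= psiC chiC.
Qed.

End JacobiQuotient.

(** * Cyclic derivatives of the potentials *)

Section CyclicDerivative.
Variables (K : comNzRingType) (d : nat).
Implicit Types (f g : ncps K d) (i j : 'I_d).

Lemma cyc_derivB i : zmod_morphism (@cyc_deriv K d i).
Proof.
move=> f g; apply: ncpsP => w; rewrite coefD coefN /= -sumrB.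
by apply: eq_bigr => u _; rewrite mulrnBl.
Qed.

HB.instance Definition _ i :=
  GRing.isZmodMorphism.Build _ _ (@cyc_deriv K d i) (@cyc_derivB i).

Lemma size_cyc_words i u v : v \in cyc_words i u -> size u = (size v).+1.
Proof.
case/mapP=> m; rewrite mem_filter mem_iota add0n => /andP[_ mu] ->.
by rewrite size_cat size_drop size_takel ?(ltnW mu) // -addSn -subSn // subSS subnK // ltnW.
Qed.

Lemma cyc_deriv_mono i u :
  cyc_deriv i (mono K u) = \sum_(v <- cyc_words i u) mono K v.
Proof.
apply: ncpsP => w; rewrite coef_sum /=.
transitivity ((count_mem w (cyc_words i u))%:R : K).
  case: (eqVneq (size u) (size w).+1) => [uw|uw]; last first.
    rewrite big1 => [|t _].
      suff /count_memPn -> : w \notin cyc_words i u by [].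
      by apply/negP => /size_cyc_words E; rewrite E eqxx in uw.
    by case: eqP => [E|_]; rewrite ?mul0rn //; move: uw; rewrite -E size_tuple eqxx.
  have uT : size u == (size w).+1 by apply/eqP.
  rewrite (bigD1 (Tuple uT)) //= eqxx big1 ?addr0 // => t tu.
  by case: eqP => [E|_]; rewrite ?mul0rn //; case/eqP: tu; apply: val_inj.
elim: (cyc_words i u) => [|v s IHs]; rewrite ?big_nil // big_cons -IHs /=.
by rewrite natrD eq_sym.
Qed.

Lemma cyc_deriv_expn i j n : cyc_deriv i (ncvar K j ^+ n) =
  if i == j then ncvar K j ^+ n.-1 *+ n else 0.
Proof.
rewrite -mono_nseq cyc_deriv_mono /cyc_words size_nseq.
case: eqP => [->|/eqP ij].
  rewrite (@eq_in_filter _ _ xpredT) ?filter_predT => [|m]; last first.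
    by rewrite nth_nseq if_same eqxx.
  have -> : [seq drop m.+1 (nseq n j) ++ take m (nseq n j) | m <- iota 0 n] =
      [seq nseq n.-1 j | m <- iota 0 n].
    apply/eq_in_map => m; rewrite mem_iota add0n => mn.
    rewrite drop_nseq take_nseq ?(ltnW mn) // -nseqD.
    by congr (nseq _ _); move: mn; case: (n) => // p; rewrite ltnS subSS => /subnK.
  by rewrite big_map big_const_seq count_predT size_iota iter_addr_0 mono_nseq.
rewrite (@eq_in_filter _ _ pred0) ?filter_pred0 ?big_nil // => m.
by rewrite mem_iota add0n leq0n /= nth_nseq => ->; rewrite eq_sym (negPf ij).
Qed.

End CyclicDerivative.

Section Variables.
Variables (K : fieldType) (k : nat).
Local Notation xi := (inord k : 'I_k.+2).
Local Notation yi := (inord k.+1 : 'I_k.+2).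
Local Notation zi j := (inord (nat_of_ord j) : 'I_k.+2).
Local Notation x := (xvar K k).
Local Notation y := (yvar K k).

Lemma xi_neq_yi : xi != yi.
Proof. by rewrite -val_eqE /= !inordK // neq_ltn ltnSn. Qed.

Lemma zi_val (j : 'I_k) : zi j = j :> nat.
Proof. by rewrite inordK // (leq_trans (ltn_ord j)) // !leqW. Qed.

Lemma zi_neq_xi (j : 'I_k) : zi j != xi.
Proof. by rewrite -val_eqE /= zi_val inordK // neq_ltn ltn_ord. Qed.

Lemma zi_neq_yi (j : 'I_k) : zi j != yi.
Proof. by rewrite -val_eqE /= zi_val inordK // neq_ltn leqW. Qed.

Lemma zi_inj (i j : 'I_k) : (zi i == zi j) = (i == j).
Proof. by rewrite -!val_eqE /= !zi_val. Qed.

Lemma letterP (P : 'I_k.+2 -> Prop) : P xi -> P yi -> (forall j : 'I_k, P (zi j)) -> forall i, P i.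
Proof.
move=> Px Py Pz i; case: (ltngtP i k) => ik.
- by have := Pz (Ordinal ik); rewrite /= inord_val.
- have E : i = k.+1 :> nat by apply/eqP; rewrite eqn_leq ik -ltnS ltn_ord.
  by rewrite -(inord_val i) E.
- by rewrite -(inord_val i) ik.
Qed.

Lemma deriv_q_x : cyc_deriv xi (zquad K k) = 0.
Proof.
rewrite raddf_sum big1 // => j _; rewrite /= cyc_deriv_expn.
by rewrite eq_sym (negPf (zi_neq_xi j)).
Qed.

Lemma deriv_q_y : cyc_deriv yi (zquad K k) = 0.
Proof.
rewrite raddf_sum big1 // => j _; rewrite /= cyc_deriv_expn.
by rewrite eq_sym (negPf (zi_neq_yi j)).
Qed.

Lemma deriv_q_z (j : 'I_k) : cyc_deriv (zi j) (zquad K k) = zvar K j *+ 2.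
Proof.
rewrite raddf_sum (bigD1 j) //= cyc_deriv_expn eqxx expr1 big1 ?addr0 // => i ij.
by rewrite /= cyc_deriv_expn zi_inj eq_sym (negPf ij).
Qed.

Lemma monoxyn n : x * y ^+ n = mono K (xi :: nseq n yi).
Proof. by rewrite mono_cons mono_nseq. Qed.

Let yx : (yi == xi) = false. Proof. by rewrite eq_sym (negPf xi_neq_yi). Qed.

Lemma deriv_xyn_z n (j : 'I_k) : cyc_deriv (zi j) (x * y ^+ n) = 0.
Proof.
rewrite monoxyn cyc_deriv_mono /cyc_words (@eq_in_filter _ _ pred0) ?filter_pred0 ?big_nil // => m.
rewrite mem_iota add0n /= size_nseq; case: m => [|m] /= mn.
  by rewrite eq_sym (negPf (zi_neq_xi j)).
by rewrite nth_nseq ifT // eq_sym (negPf (zi_neq_yi j)).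
Qed.

Lemma deriv_xyy_x : cyc_deriv xi (x * y ^+ 2) = y ^+ 2.
Proof. by rewrite monoxyn cyc_deriv_mono /cyc_words /= !eqxx yx big_seq1 -mono_nseq. Qed.

Lemma deriv_xyy_y : cyc_deriv yi (x * y ^+ 2) = y * x + x * y.
Proof.
rewrite monoxyn cyc_deriv_mono /cyc_words /= !eqxx (negPf xi_neq_yi).
by rewrite big_cons big_seq1 !mono_cons mono_nil !mulr1.
Qed.

Lemma deriv_xyyy_x : cyc_deriv xi (x * y ^+ 3) = y ^+ 3.
Proof. by rewrite monoxyn cyc_deriv_mono /cyc_words /= !eqxx yx big_seq1 -mono_nseq. Qed.

Lemma deriv_xyyy_y : cyc_deriv yi (x * y ^+ 3) = y * y * x + y * x * y + x * y * y.
Proof.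
rewrite monoxyn cyc_deriv_mono /cyc_words /= !eqxx (negPf xi_neq_yi).
by rewrite !big_cons big_nil !mono_cons mono_nil !mulr1 addr0 !mulrA addrA.
Qed.

(** The derivative of [pow a e]. *)
Definition dpow (A : pzRingType) (a : A) (e : exponent) : A :=
  if e is Some n then a ^+ n.-1 *+ n else 0.

Lemma deriv_eps (b : bool) i (g : ncps K k.+2) :
  cyc_deriv i (b%:R * g) = b%:R * cyc_deriv i g.
Proof. by case: b; rewrite ?mul1r // !mul0r raddf0. Qed.

Lemma deriv_pow i j e : cyc_deriv i (pow (ncvar K j) e) =
  if i == j then dpow (ncvar K j) e else 0 :> ncps K k.+2.
Proof. by case: e => [n|] /=; rewrite ?cyc_deriv_expn // raddf0 if_same. Qed.

Definition derivE := (deriv_q_x, deriv_q_y, deriv_q_z, deriv_xyn_z, deriv_xyy_x,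
  deriv_xyy_y, deriv_xyyy_x, deriv_xyyy_y, deriv_eps, deriv_pow, cyc_deriv_expn).

Section PotA.
Variables (b : bool) (n : exponent).
Let f := potA K k b n.

Lemma potA_x : cyc_deriv xi f = x *+ 2.
Proof. by rewrite !raddfD /= !derivE eqxx (negPf xi_neq_yi) /= expr1 add0r mulr0 addr0. Qed.
Lemma potA_y : cyc_deriv yi f = b%:R * dpow y n.
Proof. by rewrite !raddfD /= !derivE eqxx yx /= !add0r. Qed.
Lemma potA_z j : cyc_deriv (zi j) f = zvar K j *+ 2.
Proof.
by rewrite !raddfD /= !derivE (negPf (zi_neq_xi j)) (negPf (zi_neq_yi j)) mulr0 !addr0.
Qed.
End PotA.

Section PotD.
Variables (b c : bool) (n m : exponent).
Let f := potD K k b c n m.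

Lemma potD_x : cyc_deriv xi f = y ^+ 2 + b%:R * dpow x (omap (fun n => 2 * n)%N n)
  + c%:R * dpow x (omap (fun m => 2 * m - 1)%N m).
Proof. by rewrite !raddfD /= !derivE eqxx /= !add0r. Qed.
Lemma potD_y : cyc_deriv yi f = y * x + x * y.
Proof. by rewrite !raddfD /= !derivE yx /= !add0r !mulr0 !addr0. Qed.
Lemma potD_z j : cyc_deriv (zi j) f = zvar K j *+ 2.
Proof. by rewrite !raddfD /= !derivE (negPf (zi_neq_xi j)) !mulr0 !addr0. Qed.
End PotD.

Section PotE.
Variables (b : bool) (n : nat).
Let f := potE K k b n.

Lemma potE_x : cyc_deriv xi f = x ^+ 2 *+ 3 + y ^+ 3.
Proof. by rewrite !raddfD /= !derivE eqxx (negPf xi_neq_yi) /= add0r mulr0 addr0. Qed.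
Lemma potE_y : cyc_deriv yi f =
  y * y * x + y * x * y + x * y * y + b%:R * (y ^+ n.-1 *+ n).
Proof. by rewrite !raddfD /= !derivE eqxx yx /= !add0r. Qed.
Lemma potE_z j : cyc_deriv (zi j) f = zvar K j *+ 2.
Proof.
by rewrite !raddfD /= !derivE (negPf (zi_neq_xi j)) (negPf (zi_neq_yi j)) mulr0 !addr0.
Qed.
End PotE.

End Variables.

(** * Closedness of the Jacobi ideal and a criterion for isomorphism *)

Section Closure.
Variables (K : fieldType) (d : nat).
Local Notation S := (ncps_alg K d).
Local Notation maxid := (@ncps_max K d : set S).

Lemma ideal_exp_mul n (c g : S) : ncps_max c -> ideal_exp maxid n g ->
  ideal_exp maxid n.+1 (c * g).
Proof.
elim: n c g => [|n IHn] c g mc.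
  have [_ _ _ Mr] := twosided_ideal_exp maxid 1.
  by move=> _; apply: Mr; apply: gen_ideal_in; exists 1 => //; exists c; rewrite ?mul1r.
move=> Hg; move: c mc; move: g Hg.
apply: (@gen_ideal_min _ _ [set g | forall c, ncps_max c -> ideal_exp maxid n.+2 (c * g)]).
  have [M0 MD Ml Mr] := twosided_ideal_exp maxid n.+2.
  split=> [c _|a b Ha Hb c mc|a b Hb c mc|a b Ha c mc].
  - by rewrite mulr0.
  - by rewrite mulrDr; apply: MD; [apply: Ha|apply: Hb].
  - by rewrite mulrA; apply: Hb; apply: etrans (coefM0 c a) _; rewrite mc mul0r.
  - by rewrite mulrA; apply: Mr; apply: Ha.
move=> _ [a Ha [b mb <-]] c mc; rewrite mulrA.
by apply: gen_ideal_in; exists (c * a); [apply: IHn|exists b].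
Qed.

Lemma order_ge_exp n (g : S) : order_ge n g -> ideal_exp maxid n g.
Proof.
elim: n g => [|n IHn] g gn //.
have [M0 MD Ml Mr] := twosided_ideal_exp maxid n.+1.
rewrite (ncps_decomp g) gn // rmorph0 add0r.
elim/big_ind: _ => // i _; apply: ideal_exp_mul => //.
by apply: IHn => w wn; apply: gn.
Qed.

Variable f : ncps K d.
Local Notation cls := (class_of (jacobi_ideal f)).

(** The ideal is closed, so it contains every series congruent to series of arbitrarily high
    order. *)
Lemma jacobi_closed (h : S) :
  (forall n, exists2 g : S, order_ge n g & cls h = cls g) -> cls h = 0.
Proof.
move=> H; rewrite -(rmorph0 cls); apply/class_eq; rewrite subr0 => n _.
have [g gn /class_eq/(_ n Logic.I) [a Ia [b Nb ab]]] := H n.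
exists a => //; exists (b + g); last by rewrite addrA ab subrK.
by have [_ ND _ _] := twosided_ideal_exp maxid n; apply: ND => //; apply: order_ge_exp.
Qed.

(** Commutation with the letters propagates to words, and to series because the Jacobi ideal
    is closed. *)
Lemma jac_central (s : S) :
  (forall i, cls s * cls (ncvar K i) = cls (ncvar K i) * cls s) -> central (cls s).
Proof.
move=> Hs u; have [g ->] := class_surj u; apply/eqP; rewrite -subr_eq0 -!rmorphM -rmorphB.
apply/eqP/jacobi_closed => n; elim: n g => [|n IHn] g.
  by exists (s * g - g * s).
rewrite rmorphB !rmorphM {1 2}(ncps_decomp g) !(rmorphD, raddf_sum) /=.
rewrite mulrDr mulrDl opprD addrACA.
rewrite -!rmorphM -(rmorphB cls) /= -scalerAl mul1r -scalerAr mulr1 subrr rmorph0 add0r.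
rewrite mulr_sumr mulr_suml -sumrB.
elim/big_ind: _ => [|a b [a' Oa ->] [b' Ob ->]|i _].
- by exists 0; rewrite ?rmorph0.
- exists (a' + b'); last by rewrite rmorphD.
  by have [_ OD _ _] := @order_ge_ideal K d n.+1; apply: OD.
have [r Or Er] := IHn (ncps_shift i g).
exists (ncvar K i * r); first by rewrite -add1n; apply: order_geM => // -[].
rewrite !rmorphM /= -Er rmorphB !rmorphM mulrBr !mulrA; congr (_ - _).
by rewrite Hs.
Qed.

End Closure.

Section Char0.
Variables (K : numFieldType) (A : pzAlg K).

Lemma alg_mulrn_eq0 (a : A) n : a *+ n.+1 = 0 -> a = 0.
Proof.
move=> an; have := congr1 (fun b => scalar A n.+1%:R^-1 * b) an.
rewrite /= mulr0 -[a *+ _]mulr_natl -(rmorph_nat (scalar A)) mulrA -rmorphM.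
rewrite mulVf ?rmorph1 ?mul1r //.
by rewrite pnatr_eq0.
Qed.
End Char0.

Definition bin_word (A : pzRingType) (X Y : A) (bs : seq bool) : A :=
  \prod_(b <- bs) (if b then X else Y).

Lemma gamma_nth (K : fieldType) (i : 'I_6) n : (n < size (relations K i))%N ->
  class_of (gen_ideal [set r : free3 K | r \in relations K i]) (nth 0 (relations K i) n) = 0.
Proof.
move=> Hn; rewrite -(rmorph0 (class_of _)); apply/class_eq; rewrite subr0.
by apply: gen_ideal_in; apply: mem_nth.
Qed.

Section Criterion.
Variables (K : numFieldType) (k : nat).
Local Notation xi := (inord k : 'I_k.+2).
Local Notation yi := (inord k.+1 : 'I_k.+2).
Local Notation zi j := (inord (nat_of_ord j) : 'I_k.+2).
Local Notation x := (xvar K k).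
Local Notation y := (yvar K k).

Section Letters.
Variables (A : pzAlg K) (X Y : A).

(** All the variables [z_j] are sent to zero, as the relations [2 z_j = 0] force. *)
Definition letters (i : 'I_k.+2) : A :=
  if i == xi then X else if i == yi then Y else 0.

Lemma letters_x : letters xi = X. Proof. by rewrite /letters eqxx. Qed.
Lemma letters_y : letters yi = Y.
Proof. by rewrite /letters eqxx eq_sym (negPf (xi_neq_yi k)). Qed.
Lemma letters_z (j : 'I_k) : letters (zi j) = 0.
Proof. by rewrite /letters (negPf (zi_neq_xi j)) (negPf (zi_neq_yi j)). Qed.

(** A word that involves some [z_j] is zero, so only the words in [X] and [Y] matter. *)
Lemma letters_words n : (forall bs, size bs = n -> bin_word X Y bs = 0) ->
  forall w, size w = n -> word_eval letters w = 0.
Proof.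
move=> H w wn.
have [->//|[bs bw ->]] : word_eval letters w = 0 \/
    exists2 bs, size bs = size w & word_eval letters w = bin_word X Y bs.
  elim: w {wn} => [|i w [E|[bs bw E]]].
  - by right; exists [::]; rewrite // /word_eval /bin_word !big_nil.
  - by left; rewrite /word_eval big_cons -/(word_eval _ _) E mulr0.
  rewrite /word_eval big_cons -/(word_eval _ _) E.
  elim/(@letterP k): i => [||j].
  - by right; exists (true :: bs); rewrite /= ?bw // letters_x /bin_word big_cons.
  - by right; exists (false :: bs); rewrite /= ?bw // letters_y /bin_word big_cons.
  - by left; rewrite letters_z mul0r.
by apply: H; rewrite bw.
Qed.
End Letters.

Variables (f s : ncps K k.+2) (i : 'I_6).
Local Notation u := (jac_class f s).
Local Notation B := (Jac_quot u).
Local Notation G := (Gamma_ K i).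
Local Notation v j := (class_of _ (free3_var K j) : G).
Local Notation J := (jq u).

Lemma jq_s : J s = 0. Proof. exact: class_gen. Qed.

(** The common scheme of the three types. The pair [X, Y] in [Gamma_ K i] defines a morphism
    from the quotient of the Jacobi algebra, the triple [a] defines one in the other
    direction, and the last two hypotheses say that they are inverse on generators. *)
Lemma iso_criterion n (X Y : G) (a : 'I_3 -> B) :
  (forall j : 'I_k, J (zvar K j) = 0) ->
  (forall bs, size bs = n.+1 -> bin_word (J x) (J y) bs = 0) ->
  (forall bs, size bs = n.+1 -> bin_word X Y bs = 0) ->
  (forall theta : {rmorphism ncps_alg K k.+2 -> G}, preserves_scalars theta ->
     theta x = X -> theta y = Y -> (forall j : 'I_k, theta (zvar K j) = 0) ->
     (forall i, theta (cyc_deriv i f) = 0) /\ theta s = 0) ->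
  (forall r, r \in relations K i -> free_eval a r = 0) ->
  (forall psi : {rmorphism G -> B}, preserves_scalars psi ->
     (forall j, psi (v j) = a j) -> psi X = J x /\ psi Y = J y) ->
  (forall chi : {rmorphism B -> G}, preserves_scalars chi ->
     chi (J x) = X -> chi (J y) = Y -> forall j, chi (a j) = v j) ->
  alg_isomorphic B G.
Proof.
move=> Jz WB WG HG HB Hpsi Hchi.
have w0 := letters_words WG.
have Jl j : J (ncvar K j) = letters (J x) (J y) j.
  by elim/(@letterP k): j => [||j]; rewrite ?letters_x ?letters_y ?letters_z //; apply: Jz.
have evx : nil_eval w0 x = X := etrans (nil_eval_var w0 _) (letters_x X Y).
have evy : nil_eval w0 y = Y := etrans (nil_eval_var w0 _) (letters_y X Y).
have evz j : nil_eval w0 (zvar K j) = 0 := etrans (nil_eval_var w0 _) (letters_z X Y j).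
have [ev_d ev_s] := HG (nil_eval w0) (nil_eval_scalar w0) evx evy evz.
have [chi chiC chiV] := @nil_hom_lift _ _ f u G _ n s erefl w0 ev_d ev_s.
have [psi psiC psiV] := @gamma_hom_lift _ i B a HB.
have [psiX psiY] := Hpsi psi psiC psiV.
have chiX : chi (J x) = X := etrans (chiV _) (letters_x X Y).
have chiY : chi (J y) = Y := etrans (chiV _) (letters_y X Y).
apply: (@jac_gamma_iso _ _ _ u i n chi psi) => // [w wn|j|j].
- by apply: etrans (letters_words WB wn); apply: eq_bigr => j _; apply: Jl.
- by rewrite chiV Jl; elim/(@letterP k): j => [||j];
     rewrite ?letters_x ?letters_y ?letters_z ?rmorph0 //.
- by rewrite /= psiV Hchi.
Qed.
End Criterion.

(** * Types A and D *)

Lemma ord3P (P : 'I_3 -> Prop) : P 0 -> P 1 -> P 2 -> forall j, P j.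
Proof.
move=> P0 P1 P2 [[|[|[|//]]] Hj].
- by rewrite (_ : Ordinal Hj = 0) //; apply/val_inj.
- by rewrite (_ : Ordinal Hj = 1) //; apply/val_inj.
- by rewrite (_ : Ordinal Hj = 2) //; apply/val_inj.
Qed.

(** Anticommutation reorders any word of length three until a letter is repeated. *)
Lemma anticomm_words (A : pzRingType) (X Y : A) :
  X * X = 0 -> Y * Y = 0 -> Y * X = - (X * Y) ->
  forall bs, size bs = 3 -> bin_word X Y bs = 0.
Proof.
move=> XX YY YX; have XYX : X * (Y * X) = 0 by rewrite YX mulrN mulrA XX mul0r oppr0.
have YXY : Y * (X * Y) = 0 by rewrite mulrA YX mulNr -mulrA YY mulr0 oppr0.
case=> // -[] [] // -[] [] // -[] [] // _; rewrite /bin_word !big_cons big_nil mulr1;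
  rewrite ?XYX ?YXY ?XX ?YY ?mulr0 // mulrA ?XX ?YY mul0r //.
Qed.

Lemma sum0_anticomm (A : pzRingType) (X Y Z : A) :
  X * X = 0 -> Y * Y = 0 -> Z * Z = 0 -> X + Y + Z = 0 ->
  Z = - (X + Y) /\ Y * X = - (X * Y).
Proof.
move=> XX YY ZZ /eqP; rewrite addrC addr_eq0 => /eqP ZE; split=> //.
move: ZZ; rewrite ZE mulrNN mulrDl !mulrDr XX YY add0r addr0 => /eqP.
by rewrite addr_eq0 => /eqP ->; rewrite opprK.
Qed.

Lemma anticomm_sum (A : pzRingType) (X Y : A) :
  X * X = 0 -> Y * Y = 0 -> Y * X = - (X * Y) -> (- (X + Y)) ^+ 2 = 0.
Proof.
move=> XX YY YX; rewrite expr2 mulrNN mulrDl !mulrDr XX YY YX add0r addr0.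
by rewrite subrr.
Qed.

Lemma geq_double n : geq_exp n 2 -> geq_exp (omap (fun n => 2 * n)%N n) 3.
Proof. by case: n => //= n n2; rewrite (leq_trans _ (leq_mul (leqnn 2) n2)). Qed.

Lemma geq_doubleB1 m : geq_exp m 2 -> geq_exp (omap (fun m => 2 * m - 1)%N m) 3.
Proof.
by case: m => //= m m2; rewrite (leq_trans _ (leq_sub2r 1 (leq_mul (leqnn 2) m2))).
Qed.

Section TypesAD.
Variables (K : numFieldType) (k : nat).
Local Notation xi := (inord k : 'I_k.+2).
Local Notation yi := (inord k.+1 : 'I_k.+2).
Local Notation x := (xvar K k).
Local Notation y := (yvar K k).
Local Notation S := (ncps_alg K k.+2).

Lemma rmorph_dpow (A B : pzRingType) (phi : {rmorphism A -> B}) a e :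
  phi (dpow a e) = dpow (phi a) e.
Proof. by case: e => [n|] /=; rewrite ?rmorph0 // rmorphMn rmorphXn. Qed.

Lemma dpow0 (A : pzRingType) (a : A) m e : a ^+ m = 0 -> geq_exp e m.+1 -> dpow a e = 0.
Proof.
case: e => [[|n]|] //= am mn; rewrite -(subnK (n := n) (m := m)) //.
by rewrite exprD am mulr0 mul0rn.
Qed.

Lemma alg_hom_double (A : pzAlg K) (theta : {rmorphism S -> A}) a :
  theta (a *+ 2) = 0 -> theta a = 0.
Proof. by rewrite rmorphMn; apply: alg_mulrn_eq0. Qed.

Section JacobiRelations.
Variables (A : pzAlg K) (theta : {rmorphism S -> A}).

Section A.
Variables (b : bool) (n : exponent).
Hypothesis theta0 : forall i, theta (cyc_deriv i (potA K k b n)) = 0.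

Lemma relA_x : theta x = 0.
Proof. by apply: alg_hom_double; rewrite -(theta0 xi) potA_x. Qed.

Lemma relA_z j : theta (zvar K j) = 0.
Proof. by apply: alg_hom_double; rewrite -[RHS](theta0 (inord j)) potA_z. Qed.
End A.

Section D.
Variables (b c : bool) (n m : exponent).
Hypothesis theta0 : forall i, theta (cyc_deriv i (potD K k b c n m)) = 0.

Lemma relD_y : theta y * theta x = - (theta x * theta y).
Proof.
apply/eqP; rewrite -subr_eq0 opprK -!rmorphM -rmorphD -(potD_y _ _ b c n m); apply/eqP/theta0.
Qed.

Lemma relD_x : theta y ^+ 2 = 
  - (b%:R * dpow (theta x) (omap (fun n => 2 * n)%N n)
   + c%:R * dpow (theta x) (omap (fun m => 2 * m - 1)%N m)).
Proof.
apply/eqP; rewrite -subr_eq0 opprK addrA; apply/eqP; rewrite -(theta0 xi) potD_x.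
by rewrite !rmorphD !rmorphM !rmorph_nat !rmorph_dpow.
Qed.

Lemma relD_z j : theta (zvar K j) = 0.
Proof. by apply: alg_hom_double; rewrite -[RHS](theta0 (inord j)) potD_z. Qed.
End D.
End JacobiRelations.

(** The powers of [x] that remain in the derivatives have exponent at least two. *)
Lemma potD_kill (A : pzAlg K) (theta : {rmorphism S -> A}) b c n m :
  geq_exp n 2 -> geq_exp m 2 ->
  theta x * theta x = 0 -> theta y * theta y = 0 ->
  theta y * theta x = - (theta x * theta y) -> (forall j : 'I_k, theta (zvar K j) = 0) ->
  (forall i, theta (cyc_deriv i (potD K k b c n m)) = 0) /\ theta (x ^+ 2) = 0.
Proof.
rewrite -!expr2 => n2 m2 xx yy yx tz; split; last by rewrite rmorphXn.
elim/(@letterP k) => [||j].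
- rewrite potD_x !rmorphD rmorphXn /= yy !rmorphM /= !rmorph_nat !rmorph_dpow.
  by rewrite !(@dpow0 _ _ 2) ?geq_double ?geq_doubleB1 // !mulr0 !addr0.
- by rewrite potD_y rmorphD !rmorphM /= yx addNr.
- by rewrite potD_z rmorphMn /= tz mul0rn.
Qed.

Lemma cls_deriv (f : ncps K k.+2) i : class_of (jacobi_ideal f) (cyc_deriv i f) = 0.
Proof.
by rewrite -(rmorph0 (class_of _)); apply/class_eq; rewrite subr0; apply: jacobi_deriv.
Qed.

Definition jac_proj (f : ncps K k.+2) : {rmorphism S -> Jac f} :=
  class_of (jacobi_ideal f).

Lemma typeA_central b n : central (jac_class (potA K k b n) y).
Proof.
apply: jac_central; elim/(@letterP k) => [||j] //.
- have E := relA_x (theta := jac_proj _) (@cls_deriv (potA K k b n)).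
  by rewrite [class_of _ (ncvar K xi)]E mulr0 mul0r.
- have E := relA_z (theta := jac_proj _) (@cls_deriv (potA K k b n)) j.
  by rewrite [class_of _ (ncvar K (inord j))]E mulr0 mul0r.
Qed.

(** The derivative with respect to [y] says that [x] and [y] anticommute, hence the square
    of [x] commutes with [y]. *)
Lemma typeD_central b c n m : central (jac_class (potD K k b c n m) (x ^+ 2)).
Proof.
apply: jac_central; elim/(@letterP k) => [||j].
- by rewrite -!rmorphM -exprSr -exprS.
- have E := relD_y (theta := jac_proj _) (@cls_deriv (potD K k b c n m)).
  set p := jac_proj _ in E.
  change (p (x ^+ 2) * p y = p y * p (x ^+ 2)).
  by rewrite rmorphXn expr2 [RHS]mulrA E mulNr -!mulrA E mulrN opprK.
- have E := relD_z (theta := jac_proj _) (@cls_deriv (potD K k b c n m)) j.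
  by rewrite [class_of _ (ncvar K (inord j))]E mulr0 mul0r.
Qed.

Lemma typeA_iso b n : geq_exp n 2 ->
  alg_isomorphic (Jac_quot (jac_class (potA K k b n) y)) (Gamma1 K).
Proof.
move=> n2; set f := potA K k b n; set u := jac_class f y.
have Jx : jq u x = 0 by apply: relA_x; apply: (@jq_deriv _ _ _ u).
have Jy : jq u y = 0 := jq_s f y.
apply: (@iso_criterion _ _ _ _ _ 0 0 0 (fun=> 0)).
- by move=> j; apply: relA_z; apply: (@jq_deriv _ _ _ u).
- by case=> // b' [] // _; rewrite /bin_word big_seq1 Jx Jy if_same.
- by case=> // b' [] // _; rewrite /bin_word big_seq1 if_same.
- move=> theta _ tx ty tz; split=> //; elim/(@letterP k) => [||j].
  + by rewrite potA_x rmorphMn /= tx mul0rn.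
  + by rewrite potA_y rmorphM /= rmorph_dpow (@dpow0 _ _ 1) ?ty ?mulr0.
  + by rewrite potA_z rmorphMn /= tz mul0rn.
- move=> r /(nthP 0)[l lr <-]; case: l lr => [|[|[|[|//]]]] _ /=;
  by rewrite ?rmorphD /= !free_eval_var ?addr0.
- by move=> psi _ _; rewrite Jx Jy rmorph0.
- move=> chi _ _ _ j; rewrite rmorph0; apply/esym.
  elim/ord3P: j; [exact: (@gamma_nth K 0 1)|exact: (@gamma_nth K 0 2)|exact: (@gamma_nth K 0 3)].
Qed.

(** Modulo the square of [x] the derivative with respect to [x] reduces to the square
    of [y]. *)
Lemma typeD_relations b c n m (f := potD K k b c n m) (u := jac_class f (x ^+ 2)) :
  geq_exp n 2 -> geq_exp m 2 ->
  [/\ jq u x * jq u x = 0, jq u y * jq u y = 0 & jq u y * jq u x = - (jq u x * jq u y)].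
Proof.
move=> n2 m2.
have J0 := @jq_deriv _ _ f u.
have JX : jq u x * jq u x = 0 by rewrite -rmorphM -expr2; apply: jq_s.
have JY : jq u y * jq u y = 0.
  by rewrite -expr2 (relD_x J0) !(@dpow0 _ _ 2) ?geq_double ?geq_doubleB1 ?expr2 // !mulr0 addr0 oppr0.
by split=> //; apply: (relD_y J0).
Qed.

(** Both algebras are generated by two anticommuting elements of square zero: in [Gamma2] the
    third generator is [- (x + y)], and its square is zero exactly when [x] and [y]
    anticommute. *)
Lemma typeD_iso b c n m : geq_exp n 2 -> geq_exp m 2 ->
  alg_isomorphic (Jac_quot (jac_class (potD K k b c n m) (x ^+ 2))) (Gamma2 K).
Proof.
move=> n2 m2; set f := potD K k b c n m; set u := jac_class f (x ^+ 2).
pose G := Gamma2 K; pose v j : G := class_of _ (free3_var K j).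
have vX : v 0 * v 0 = 0.
  by rewrite -rmorphM; apply: (@gamma_nth K 1 1).
have vY : v 1 * v 1 = 0.
  by rewrite -rmorphM; apply: (@gamma_nth K 1 2).
have vZ : v 2 * v 2 = 0.
  by rewrite -rmorphM; apply: (@gamma_nth K 1 3).
have vXYZ : v 0 + v 1 + v 2 = 0.
  by have := @gamma_nth K 1 0 isT; rewrite /= !rmorphD.
have [vS vC] := sum0_anticomm vX vY vZ vXYZ.
have J0 := @jq_deriv _ _ f u.
have [JX JY JC] := typeD_relations b c n2 m2.
apply: (@iso_criterion _ _ _ _ 1 2 (v 0) (v 1)
  (fun j => nth 0 [:: jq u x; jq u y; - (jq u x + jq u y)] j)).
- by move=> j; apply: (relD_z J0).
- exact: (anticomm_words JX JY JC).
- exact: (anticomm_words vX vY vC).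
- move=> theta _ tx ty tz; apply: (potD_kill _ _ n2 m2) tz; rewrite ?tx ?ty.
  + exact: vX.
  + exact: vY.
  + exact: vC.
- move=> r /(nthP 0)[l lr <-]; case: l lr => [|[|[|[|//]]]] _ /=.
  + by rewrite !rmorphD /= !free_eval_var /= subrr.
  + by rewrite rmorphXn /= free_eval_var.
  + by rewrite rmorphXn /= free_eval_var.
  + rewrite rmorphXn /= free_eval_var; exact: (anticomm_sum JX JY JC).
- by move=> psi _ psiV; rewrite !psiV.
- move=> chi _ cx cy; elim/ord3P => //=.
  by rewrite rmorphN rmorphD /= cx cy -vS.
Qed.

End TypesAD.

(** * Generic central elements *)

Lemma ideal_ext (A : pzRingType) (I J : ideal A) : ideal_set I = ideal_set J -> I = J.
Proof.
case: I J => [I HI] [J HJ] /= E; move: HI; rewrite E => HI.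
by congr Ideal; apply: Prop_irrelevance.
Qed.

Lemma gen_ideal_unit (A : pzRingType) (s u v : A) : u * v = 1 ->
  gen_ideal [set s * u] = gen_ideal [set s].
Proof.
move=> uv; apply: ideal_ext; apply/seteqP; split.
  apply: gen_ideal_min => [|_ ->]; first exact: idealP.
  by have [_ _ _ M] := idealP (gen_ideal [set s]); exact: (M _ _ (gen_ideal_in erefl)).
apply: gen_ideal_min => [|_ ->]; first exact: idealP.
have [_ _ _ M] := idealP (gen_ideal [set s * u]).
by have := M _ v (gen_ideal_in erefl); rewrite -mulrA uv mulr1.
Qed.

Section Generic.
Variables (K : fieldType) (A : pzAlg K) (eps : {rmorphism A -> K}) (s : A).
Hypothesis eps_scalar : forall c, eps (scalar A c) = c.
Hypothesis eps_unit : forall a, eps a != 0 -> exists b, a * b = 1 /\ b * a = 1.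
Hypothesis s_central : central s.
Hypothesis eps_s : eps s = 0.
Hypothesis central_div : forall z, central z -> eps z = 0 -> exists u, z = s * u.

Local Notation Z := (centre_alg A).
Local Notation m := (@jacobson_radical Z).

Lemma centreP (z : Z) : central (centre_val z).
Proof. by case: z => z /= /asboolP. Qed.

Lemma centre_valM (a b : Z) : centre_val (a * b) = centre_val a * centre_val b.
Proof. by []. Qed.
Lemma centre_valD (a b : Z) : centre_val (a + b) = centre_val a + centre_val b.
Proof. by []. Qed.
Lemma centre_valB (a b : Z) : centre_val (a - b) = centre_val a - centre_val b.
Proof. by []. Qed.

Definition eps0 : set Z := [set z | eps (centre_val z) = 0].

Lemma eps0_ideal : twosided_ideal eps0.
Proof.
split; rewrite /eps0 /mkset.
- exact: rmorph0.
- by move=> a b ea eb; rewrite centre_valD rmorphD ea eb addr0.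
- by move=> a b eb; rewrite centre_valM rmorphM eb mulr0.
- by move=> a b ea; rewrite centre_valM rmorphM ea mul0r.
Qed.

(** The kernel of the augmentation is a maximal left ideal of the centre, because an element
    outside it is congruent to a nonzero scalar. *)
Lemma jacobson_eps0 : m `<=` eps0.
Proof.
have [E0 ED EMl _] := eps0_ideal.
move=> z; apply; split=> {z}; first by split.
  by move=> /= E; have := oner_neq0 K; rewrite -(rmorph1 eps) E eqxx.
move=> J [J0 JD JM] J1 EJ; apply/seteqP; split=> // z Jz.
apply: contrapT => /eqP ez; apply: J1.
pose c := eps (centre_val z); pose cz : Z := scalar Z c.
have Jc : J cz.
  rewrite -[cz](subrK z) addrC; apply: JD => //; apply: EJ.
  by rewrite /eps0 /mkset centre_valB rmorphB /= eps_scalar subrr.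
rewrite -(rmorph1 (scalar Z)) -(mulVf ez) rmorphM; exact: JM.
Qed.

Definition sZ : Z := Centre (asboolT s_central).

(** If a maximal left ideal missed [s], one of its elements would be of the form [1 - b s],
    which is invertible: its augmentation is one, and the inverse of a central
    element is central. *)
Lemma jacobson_s : m sZ.
Proof.
move=> M [[M0 MD MM] M1 Mmax]; apply: contrapT => Ms.
pose J : set Z := [set z | exists2 a, M a & exists b, z = a + b * sZ].
have JM : M `<=` J by move=> z Mz; exists z => //; exists 0; rewrite mul0r addr0.
have Js : J sZ by exists 0 => //; exists 1; rewrite mul1r add0r.
have Jl : left_ideal J.
  split=> [|_ _ [a Ma [b ->]] [a' Ma' [b' ->]]|c _ [a Ma [b ->]]]; first exact: JM.
    by exists (a + a'); [exact: MD|exists (b + b'); rewrite mulrDl addrACA].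
  by exists (c * a); [exact: MM|exists (c * b); rewrite mulrDr mulrA].
have [a Ma [b ab]] : J 1.
  by apply: contrapT => J1; apply: Ms; rewrite -(Mmax J Jl J1 JM).
have ae : eps (centre_val a) = 1.
  have -> : a = 1 - b * sZ by rewrite ab addrK.
  by rewrite centre_valB rmorphB centre_valM rmorphM eps_s mulr0 subr0 rmorph1.
have [c [ac ca]] : exists c, centre_val a * c = 1 /\ c * centre_val a = 1.
  by apply: eps_unit; rewrite ae oner_eq0.
have cC : central c.
  move=> e; rewrite -[LHS]mulr1 -ac !mulrA -(mulrA c e) -(centreP a e) (mulrA c).
  by rewrite ca mul1r.
apply: M1; have -> : 1 = Centre (asboolT cC) * a :> Z by apply: val_inj.
exact: MM.
Qed.

(** A product of two multiples of [s] is [s] times an element of augmentation zero. *)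
Lemma jacobson_sq (z : Z) : ideal_exp m 2 z ->
  exists2 w, centre_val z = s * w & eps w = 0.
Proof.
move: z; apply: (@gen_ideal_min _ _ [set z : Z | exists2 w, centre_val z = s * w & eps w = 0]).
  split=> [|a b [w aw ew] [w' bw ew']|a b [w bw ew]|a b [w aw ew]].
  - by exists 0; rewrite ?mulr0 ?rmorph0.
  - by exists (w + w'); rewrite ?rmorphD ?ew ?ew' ?addr0 // centre_valD aw bw mulrDr.
  - exists (centre_val a * w); last by rewrite rmorphM ew mulr0.
    by rewrite centre_valM bw !mulrA s_central.
  - by exists (w * centre_val b); rewrite ?rmorphM ?ew ?mul0r // centre_valM aw mulrA.
move=> _ [a Ha [b mb <-]].
have ea : eps0 a.
  move: a Ha; apply: gen_ideal_min; first exact: eps0_ideal.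
  move=> _ [c _ [e me <-]]; have [_ _ EM _] := eps0_ideal.
  by apply: EM; apply: jacobson_eps0.
have [u au] := central_div (centreP a) ea.
have [v bv] := central_div (centreP b) (jacobson_eps0 mb).
exists (u * (s * v)); last by rewrite !rmorphM /= eps_s mul0r mulr0.
by rewrite centre_valM au bv !mulrA.
Qed.

Lemma centre_lin_comb n (e : 'I_n -> Z) c :
  centre_val (lin_comb e c) = \sum_i scalar A (c i) * centre_val (e i).
Proof. exact: (big_morph _ centre_valD erefl). Qed.

Variable Q : A -> Prop.
Hypothesis Qs : forall u v, u * v = 1 -> Q (s * u).

(** Here the maximal ideal of the centre is zero, so every admissible element is [s] itself. *)
Lemma generic_trivial : s = 0 -> holds_generically Q.
Proof.
move=> s0; rewrite /holds_generically /= => V [n [e eV]] Vm _; have [VE _] := eV; exists V; split.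
- exists n, e; split=> //; exists setT; last by rewrite VE.
  exists (fun q : mpoly.mpoly n K => q = 1); apply/seteqP; split=> // c _; exists 1 => //.
  by rewrite mpoly.meval1 oner_eq0.
- by exists (lin_comb e (fun=> 0)); rewrite VE; exists (fun=> 0).
- move=> g /Vm/jacobson_eps0 eg; have [u ->] := central_div (centreP g) eg.
  by rewrite s0 mul0r -(mul0r 1) -s0; apply: (@Qs 1 1); rewrite mulr1.
Qed.

Variable lam : {additive A -> K}.
Hypothesis lam_scalar : forall c a, lam (scalar A c * a) = c * lam a.
Hypothesis lam_s : forall u, lam (s * u) = eps u.

(** The open set is the locus where the linear form [lam] does not vanish. It meets every
    admissible [V] because [V] contains [s] up to the square of the radical, where
    [lam] vanishes; and on it an element [s u] has [eps u] nonzero, so it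
    generates the same ideal as [s]. *)
Lemma generic_nontrivial : holds_generically Q.
Proof.
rewrite /holds_generically /= => V [n [e eV]] Vm Vs; have [VE _] := eV.
pose p : mpoly.mpoly n K :=
  \sum_i lam (centre_val (e i)) *: mpoly.mpolyX K (mpoly.mnm1 i).
have pE c : mpoly.meval c p = lam (centre_val (lin_comb e c)).
  rewrite centre_lin_comb !raddf_sum; apply: eq_bigr => i _.
  by rewrite /= mpoly.mevalZ mpoly.mevalXU lam_scalar mulrC.
pose O : set ('I_n -> K) := [set c | mpoly.meval c p != 0].
exists (lin_comb e @` O); split.
- exists n, e; split=> //; exists O => //; exists (eq p).
  by apply/seteqP; split=> c /= => [pc|[q <- pc]] //; exists p.
- have [v Vv /jacobson_sq[w vw ew]] := Vs _ jacobson_s.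
  move: Vv; rewrite VE => -[c _ cv]; exists v; exists c => //.
  rewrite /O /mkset pE cv.
  have -> : centre_val v = s * (1 - w).
    by rewrite mulrBr -vw centre_valB opprB mulr1 addrC subrK.
  by rewrite lam_s rmorphB rmorph1 ew subr0 oner_eq0.
move=> g [c Oc cg]; have Vg : V g by rewrite VE; exists c.
have [u gu] := central_div (centreP g) (jacobson_eps0 (Vm _ Vg)).
have [|b [ub _]] := @eps_unit u.
  by move: Oc; rewrite /O /mkset pE cg gu lam_s.
by rewrite gu; apply: Qs ub.
Qed.

End Generic.

(** * Functionals on the Jacobi algebra, and generic central elements in type A *)

Section QuotientFunctional.
Variables (K : fieldType) (A : pzRingType) (I : ideal A) (mu : {additive A -> K}).
Hypothesis muI : forall a, ideal_set I a -> mu a = 0.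

Definition quot_functional (_ : forall a, ideal_set I a -> mu a = 0) (u : quot I) : K :=
  mu (repr u).
Local Notation lam := (quot_functional muI).

Lemma quot_functionalE a : lam (class_of I a) = mu a.
Proof. by apply/eqP; rewrite -subr_eq0 -raddfB muI //; apply: reprI. Qed.

Lemma quot_functionalB : zmod_morphism lam.
Proof.
move=> u v; have [a ->] := class_surj u; have [b ->] := class_surj v.
by rewrite -rmorphB !quot_functionalE raddfB.
Qed.

HB.instance Definition _ := GRing.isZmodMorphism.Build _ _ lam quot_functionalB.
End QuotientFunctional.
Arguments quot_functional : simpl never.

Section LowCoefficients.
Variables (K : fieldType) (d : nat).
Implicit Types (f g h : ncps K d) (l m n : 'I_d).

Lemma coefM1 g h l : coef (g * h) [:: l] =
  coef g [::] * coef h [:: l] + coef g [:: l] * coef h [::].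
Proof. by rewrite coefM_cons coefM0. Qed.

Lemma coefM2 g h l m : coef (g * h) [:: l; m] = coef g [::] * coef h [:: l; m] +
  (coef g [:: l] * coef h [:: m] + coef g [:: l; m] * coef h [::]).
Proof. by rewrite coefM_cons coefM1. Qed.

Lemma coefM3 g h l m n : coef (g * h) [:: l; m; n] =
  coef g [::] * coef h [:: l; m; n] + (coef g [:: l] * coef h [:: m; n] +
  (coef g [:: l; m] * coef h [:: n] + coef g [:: l; m; n] * coef h [::])).
Proof. by rewrite coefM_cons coefM2. Qed.

Definition coefM_low := (coefM0, coefM1, coefM2, coefM3).

Definition coef_const (g : ncps_alg K d) : K := coef g [::].
Lemma coef_constB : zmod_morphism coef_const. Proof. by []. Qed.
Lemma coef_constM : GRing.monoid_morphism coef_const.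
Proof. by split=> // g h; rewrite /coef_const -coefM0. Qed.
HB.instance Definition _ := GRing.isZmodMorphism.Build _ _ coef_const coef_constB.
HB.instance Definition _ := GRing.isMonoidMorphism.Build _ _ coef_const coef_constM.

Variable f : ncps K d.
Local Notation p := (class_of (jacobi_ideal f)).

(** A functional that depends on finitely many coefficients vanishes on the closed ideal as
    soon as it vanishes on the two-sided multiples of the derivatives. *)
Lemma functional_kills (mu : {additive ncps_alg K d -> K}) (N : nat) :
  (forall g, order_ge N g -> mu g = 0) ->
  (forall i a b, mu (a * cyc_deriv i f * b) = 0) ->
  forall g, ideal_set (jacobi_ideal f) g -> mu g = 0.
Proof.
move=> mun muf g /(@jacobi_min _ _ f N [set g | forall a b, mu (a * g * b) = 0]).
rewrite -[X in mu X = 0]mulr1 -[X in mu (X * _) = 0]mul1r; apply.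
- split=> [a b|h h' Hh Hh' a b|h h' Hh' a b|h h' Hh a b].
  + by rewrite mulr0 mul0r raddf0.
  + by rewrite mulrDr mulrDl raddfD /= Hh Hh' addr0.
  + by rewrite mulrA; apply: Hh'.
  + by rewrite mulrA -mulrA; apply: Hh.
- move=> h hn a b; apply: mun; have [_ _ Ml Mr] := @order_ge_ideal K d N.
  by apply: Mr; apply: Ml.
- by move=> i a b; apply: muf.
Qed.

Hypothesis deriv0 : forall i, coef (cyc_deriv i f) [::] = 0.

Lemma const_kills g : ideal_set (jacobi_ideal f) g -> coef_const g = 0.
Proof.
move: g; apply: (@functional_kills coef_const 1) => [h h1|i a b]; first exact: (h1 [::]).
apply: etrans (coefM0 _ b) _; rewrite (_ : coef _ [::] = 0) ?mul0r //.
by apply: etrans (coefM0 a _) _; rewrite deriv0 mulr0.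
Qed.

(** The constant term, a morphism on the Jacobi algebra since the derivatives have none. *)
Definition jac_eps : {rmorphism Jac f -> K} := quot_map const_kills.

Lemma jac_epsE g : jac_eps (p g) = coef g [::].
Proof. exact: (quot_mapE const_kills). Qed.

Lemma jac_eps_scalar c : jac_eps (scalar (Jac f) c) = c.
Proof. by apply: etrans (jac_epsE _) _; rewrite /= -[RHS]mulr1. Qed.

(** The Jacobi algebra is local: divide by the constant term and take a geometric series. *)
Lemma jac_eps_unit a : jac_eps a != 0 -> exists b, a * b = 1 /\ b * a = 1.
Proof.
have [g ->] := class_surj a; rewrite jac_epsE => c0.
set c := coef g [::] in c0; have [|h [hl hr]] := @series_unit K d (1 - c^-1 *: g).
  by rewrite coefD coefN coefZ coef1 mulVf ?subrr.
rewrite subKr in hl hr; exists (p (c^-1 *: h)); rewrite -!rmorphM -!(rmorph1 p).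
rewrite -scalerAr in hr; rewrite -scalerAl in hl.
by split; congr (p _); [rewrite -scalerAr|rewrite -scalerAl].
Qed.

End LowCoefficients.

Section GenericA.
Variables (K : numFieldType) (k : nat) (b : bool) (n : exponent).
Hypothesis n2 : geq_exp n 2.
Local Notation xi := (inord k : 'I_k.+2).
Local Notation yi := (inord k.+1 : 'I_k.+2).
Local Notation zi j := (inord (nat_of_ord j) : 'I_k.+2).
Local Notation x := (xvar K k).
Local Notation y := (yvar K k).
Local Notation S := (ncps_alg K k.+2).
Let f := potA K k b n.
Local Notation p := (jac_proj f).

Lemma coef_eps (c : bool) (g : ncps K k.+2) w : coef (c%:R * g) w = c%:R * coef g w.
Proof. by case: c; rewrite ?mul1r ?mul0r. Qed.

Lemma coef_expn i m w : coef (ncvar K i ^+ m : ncps K k.+2) w = (w == nseq m i)%:R.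
Proof. by rewrite -mono_nseq. Qed.

Lemma coefMn (g : ncps K k.+2) m w : coef (g *+ m) w = coef g w *+ m.
Proof. by elim: m => // m IH; rewrite !mulrS coefD IH. Qed.

Lemma coef_dpow i e w : coef (dpow (ncvar K i : ncps K k.+2) e) w =
  if e is Some m then (w == nseq m.-1 i)%:R *+ m else 0.
Proof. by case: e => [m|] //=; rewrite coefMn coef_expn. Qed.

Lemma coef_dpow_short i e w : geq_exp e (size w).+2 ->
  coef (dpow (ncvar K i : ncps K k.+2) e) w = 0.
Proof.
rewrite coef_dpow; case: e => //= m wm; case: eqP => [E|_]; last by rewrite mul0rn.
by move: wm; rewrite E size_nseq; case: m {E} => //= m; rewrite ltnn.
Qed.

Lemma potA_deriv0 i : coef (cyc_deriv i f) [::] = 0.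
Proof.
elim/(@letterP k): i => [||j]; rewrite /f ?potA_x ?potA_y ?potA_z ?coefMn ?mul0rn //.
by rewrite coef_eps coef_dpow_short ?mulr0.
Qed.

(** In type A every letter except [y] is zero in the Jacobi algebra, so an element without
    constant term is a multiple of [y]. *)
Lemma potA_central_div z : central z -> jac_eps potA_deriv0 z = 0 ->
  exists u, z = p y * u.
Proof.
move=> _; have [g ->] := class_surj z; rewrite jac_epsE => g0.
exists (p (ncps_shift yi g)); rewrite -[class_of _ g]/(p g).
rewrite {1}(ncps_decomp g) g0 rmorph0 add0r raddf_sum (bigD1 yi) //=.
rewrite big1 ?addr0; first by rewrite -rmorphM.
move=> i; elim/(@letterP k): i => [_||j _]; last 2 first.
- by rewrite eqxx.
- by rewrite rmorphM [p (ncvar _ _)](relA_z (theta := p) (@cls_deriv _ _ f)) mul0r.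
- by rewrite rmorphM [p (ncvar _ _)](relA_x (theta := p) (@cls_deriv _ _ f)) mul0r.
Qed.

Definition coef_y (g : S) : K := coef g [:: yi].
HB.instance Definition _ := GRing.isZmodMorphism.Build _ _ coef_y (fun _ _ => erefl).

(** The linear form is the coefficient of [y]. It is not defined on the Jacobi algebra when the
    potential contains the square of [y], but then [y] itself is zero there. *)
Lemma typeA_generic : holds_generically
  (fun g : Jac f => alg_isomorphic (Jac_quot g) (Gamma1 K)).
Proof.
have Qs u v : u * v = 1 -> alg_isomorphic (Jac_quot (p y * u)) (Gamma1 K).
  by move=> uv; rewrite /Jac_quot (gen_ideal_unit _ uv); apply: typeA_iso.
have ey : jac_eps potA_deriv0 (p y) = 0 by rewrite jac_epsE.
have cy : central (p y) := @typeA_central K k b n.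
have [/andP[/eqP nE bE]|nb] := boolP ((n == Some 2) && b).
  apply: (generic_trivial (jac_eps_scalar potA_deriv0) potA_central_div Qs).
  apply: alg_hom_double; rewrite -(@cls_deriv _ _ f yi) /f potA_y bE nE mul1r.
  by rewrite /dpow expr1.
have muI := @functional_kills _ _ f coef_y 2 (fun g g2 => g2 [:: yi] isT).
have muf i a c : coef_y (a * cyc_deriv i f * c) = 0.
  suff E : coef (cyc_deriv i f) [:: yi] = 0.
    rewrite /coef_y; apply: etrans (coefM1 (a * _) c yi) _.
    by rewrite coefM0 coefM1 potA_deriv0 E !mulr0 addr0 !mul0r addr0.
  elim/(@letterP k): i => [||j]; rewrite /f ?potA_x ?potA_y ?potA_z ?coefMn.
  - by rewrite [coef _ _](_ : _ = 0) ?mul0rn //= eqseq_cons eq_sym (negPf (xi_neq_yi k)).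
  - rewrite coef_eps; case: b nb => nb; rewrite ?mul0r // mul1r coef_dpow_short //.
    by case: (n) n2 nb => //= m; rewrite leq_eqVlt andbT => /orP[/eqP <-|].
  - by rewrite [coef _ _](_ : _ = 0) ?mul0rn //= eqseq_cons eq_sym (negPf (zi_neq_yi j)).
pose lam : {additive Jac f -> K} := quot_functional (muI muf).
apply: (generic_nontrivial (jac_eps_scalar potA_deriv0) (@jac_eps_unit _ _ _ potA_deriv0)
  cy ey potA_central_div Qs (lam := lam)).
- move=> c a; have [g ->] := class_surj a.
  rewrite -[scalar _ c]/(p (in_alg S c)) -rmorphM /= !quot_functionalE.
  exact: (congr1 (fun h : ncps K k.+2 => coef h [:: yi]) (mulr_algl c (g : ncps K k.+2))).
- move=> u; have [g ->] := class_surj u; rewrite -rmorphM /= quot_functionalE jac_epsE.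
  by rewrite /coef_y; apply: etrans (coefM1 _ _ _) _; rewrite mul0r add0r /= eqxx mul1r.
Qed.

End GenericA.

(** * Generic central elements in type D *)

Section GenericD.
Variables (K : numFieldType) (k : nat) (b c : bool) (n m : exponent).
Hypotheses (n2 : geq_exp n 2) (m2 : geq_exp m 2).
Local Notation xi := (inord k : 'I_k.+2).
Local Notation yi := (inord k.+1 : 'I_k.+2).
Local Notation x := (xvar K k).
Local Notation y := (yvar K k).
Local Notation S := (ncps_alg K k.+2).
Let f := potD K k b c n m.
Local Notation p := (jac_proj f).

(** The square of [x] occurs in the derivative with respect to [x] when the potential contains
    the cube of [x]. The relation then reads [y^2 + deriv_xx * x^2 = 0] up to higher order,
    and the functionals below carry a correction by this coefficient. *)
Let deriv_xx := coef (cyc_deriv xi f) [:: xi; xi].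

Let yx : (yi == xi) = false. Proof. by rewrite eq_sym (negPf (xi_neq_yi k)). Qed.

Lemma coef_dpow_other i l e w : l \in w -> l != i ->
  coef (dpow (ncvar K i : ncps K k.+2) e) w = 0.
Proof.
move=> lw li; rewrite coef_dpow; case: e => // h; case: eqP => [E|_]; last by rewrite mul0rn.
by move: lw; rewrite E mem_nseq (negPf li) andbF.
Qed.

Lemma potD_low i (r := cyc_deriv i f) :
  [/\ coef r [::] = 0, coef r [:: xi] = 0, coef r [:: yi] = 0,
      coef r [:: xi; xi] = deriv_xx * coef r [:: yi; yi] & coef r [:: xi; yi] = coef r [:: yi; xi]] /\
  [/\ coef r [:: xi; xi; yi] = 0, coef r [:: xi; yi; xi] = 0,
      coef r [:: yi; xi; xi] = 0 & coef r [:: yi; yi; yi] = 0].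
Proof.
rewrite {}/r; elim/(@letterP k): i => [||j].
- have E w : coef (cyc_deriv xi f) w = (w == [:: yi; yi])%:R +
      b%:R * coef (dpow x (omap (fun n => 2 * n)%N n)) w +
      c%:R * coef (dpow x (omap (fun m => 2 * m - 1)%N m)) w.
    by rewrite /f potD_x !coefD !coef_eps coef_expn.
  have Ey w : yi \in w -> coef (cyc_deriv xi f) w = (w == [:: yi; yi])%:R.
    by move=> yw; rewrite E !(coef_dpow_other _ yw) ?yx // !mulr0 !addr0.
  have E0 w : (size w < 2)%N -> coef (cyc_deriv xi f) w = 0.
    have h e : geq_exp e 3 -> (size w < 2)%N -> geq_exp e (size w).+2.
      by case: e => //= e e3 w2; apply: leq_trans e3.
    move=> w2; rewrite E !coef_dpow_short ?h ?geq_double ?geq_doubleB1 // !mulr0 !addr0.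
    by case: eqP w2 => // ->.
  rewrite (E0 [::]) // (E0 [:: xi]) // (E0 [:: yi]) //.
  rewrite (Ey [:: yi; yi]) ?(Ey [:: xi; yi]) ?(Ey [:: yi; xi]) ?(Ey [:: xi; xi; yi])
    ?(Ey [:: xi; yi; xi]) ?(Ey [:: yi; xi; xi]) ?(Ey [:: yi; yi; yi]) ?inE ?eqxx ?orbT //.
  by rewrite !eqseq_cons ?eqxx ?yx ?(negPf (xi_neq_yi k)) /= mulr1.
- have E w : coef (cyc_deriv yi f) w = (w == [:: yi; xi])%:R + (w == [:: xi; yi])%:R.
    have -> : cyc_deriv yi f = mono K [:: yi; xi] + mono K [:: xi; yi] by
      rewrite /f potD_y !mono_cons mono_nil !mulr1.
    by [].
  by rewrite !E !eqseq_cons ?eqxx ?yx ?(negPf (xi_neq_yi k)) /= !addr0 add0r mulr0.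
- have E w : coef (cyc_deriv (inord j : 'I_k.+2) f) w = (w == [:: inord j])%:R *+ 2.
    by rewrite /f potD_z coefMn.
  by rewrite !E !eqseq_cons ![xi == _]eq_sym ![yi == _]eq_sym (negPf (zi_neq_xi j)) (negPf (zi_neq_yi j))
    /= !mul0rn mulr0.
Qed.

Lemma potD_deriv0 i : coef (cyc_deriv i f) [::] = 0.
Proof. by have [[]] := potD_low i. Qed.

(** A linear form on low degree coefficients descends to the Jacobi algebra when it vanishes on
    the Jacobi ideal; three such forms are used. In degree two the ideal is
    spanned by [x y + y x] and [y^2 + deriv_xx * x^2], up to the variables [z_j]. *)
Definition comm_xy (g : S) : K := coef g [:: xi; yi] - coef g [:: yi; xi].
Lemma comm_xyB : zmod_morphism comm_xy.
Proof. by move=> g h; rewrite /comm_xy !coefD !coefN; ring. Qed.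
HB.instance Definition _ := GRing.isZmodMorphism.Build _ _ comm_xy comm_xyB.

Definition alt_xxy (g : S) : K := coef g [:: xi; xi; yi] - coef g [:: xi; yi; xi] +
  coef g [:: yi; xi; xi] - deriv_xx * coef g [:: yi; yi; yi].
Lemma alt_xxyB : zmod_morphism alt_xxy.
Proof. by move=> g h; rewrite /alt_xxy !coefD !coefN; ring. Qed.
HB.instance Definition _ := GRing.isZmodMorphism.Build _ _ alt_xxy alt_xxyB.

Definition coef_xx (g : S) : K := coef g [:: xi; xi] - deriv_xx * coef g [:: yi; yi].
Lemma coef_xxB : zmod_morphism coef_xx.
Proof. by move=> g h; rewrite /coef_xx !coefD !coefN; ring. Qed.
HB.instance Definition _ := GRing.isZmodMorphism.Build _ _ coef_xx coef_xxB.

Lemma comm_xy_kills g : ideal_set (jacobi_ideal f) g -> comm_xy g = 0.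
Proof.
move: g; apply: (@functional_kills _ _ f comm_xy 3) => [g g3|i u v].
  by rewrite /= /comm_xy !g3 // subrr.
have [[r0 rx ry rxx rxy] _] := potD_low i.
rewrite /= /comm_xy; change (GRing.mul (GRing.mul u _) v) with ((u : ncps K k.+2) * cyc_deriv i f * v).
rewrite !coefM_low r0 rx ry rxy; ring.
Qed.

Lemma coef_xx_kills g : ideal_set (jacobi_ideal f) g -> coef_xx g = 0.
Proof.
move: g; apply: (@functional_kills _ _ f coef_xx 3) => [g g3|i u v].
  by rewrite /= /coef_xx !g3 // mulr0 subrr.
have [[r0 rx ry rxx rxy] _] := potD_low i.
rewrite /= /coef_xx; change (GRing.mul (GRing.mul u _) v) with ((u : ncps K k.+2) * cyc_deriv i f * v).
rewrite !coefM_low r0 rx ry rxx; ring.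
Qed.

Lemma alt_xxy_kills g : ideal_set (jacobi_ideal f) g -> alt_xxy g = 0.
Proof.
move: g; apply: (@functional_kills _ _ f alt_xxy 4) => [g g4|i u v].
  by rewrite /= /alt_xxy !g4 // mulr0 !subr0 addr0.
have [[r0 rx ry rxx rxy] [rxxy rxyx ryxx ryyy]] := potD_low i.
rewrite /= /alt_xxy; change (GRing.mul (GRing.mul u _) v) with ((u : ncps K k.+2) * cyc_deriv i f * v).
rewrite !coefM_low r0 rx ry rxx rxy rxxy rxyx ryxx ryyy; ring.
Qed.

Lemma two_neq0 (t : K) : t + t = 0 -> t = 0.
Proof. by rewrite -mulr2n => /eqP; rewrite mulrn_eq0 => /eqP. Qed.

(** Test [g x - x g] and [g y - y g], which lie in the Jacobi ideal, against the functionals: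
    in degree two they isolate twice a linear coefficient of [g], in degree three
    twice the difference of the coefficients of [x y] and [y x]. *)
Lemma central_low (g : ncps K k.+2) : central (p g) ->
  [/\ coef g [:: xi] = 0, coef g [:: yi] = 0 & coef g [:: xi; yi] = coef g [:: yi; xi]].
Proof.
move=> gC.
have cI (h : ncps K k.+2) : ideal_set (jacobi_ideal f) (g * h - h * g).
  by apply/class_eq; rewrite [LHS](rmorphM p) [RHS](rmorphM p); apply: gC.
have /= cx := comm_xy_kills (cI x); have /= cy := comm_xy_kills (cI y).
have /= ax := alt_xxy_kills (cI x).
move: cx cy ax; rewrite /comm_xy /alt_xxy !coefD !coefN !coefM_low /=.
rewrite !eqseq_cons !eqxx yx (negPf (xi_neq_yi k)) /= => cx cy ax; split.
- by apply: two_neq0; rewrite -[RHS]cy; ring.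
- by apply: two_neq0; rewrite -[LHS]opprK -[RHS]oppr0 -[X in _ = - X]cx; ring.
- apply/eqP; rewrite -subr_eq0; apply/eqP/two_neq0.
  by rewrite -[LHS]opprK -[RHS]oppr0 -[X in _ = - X]ax; ring.
Qed.

Lemma sum_letters (A : zmodType) (F : 'I_k.+2 -> A) :
  (forall j : 'I_k, F (inord j) = 0) -> \sum_i F i = F xi + F yi.
Proof.
move=> Fz; rewrite (bigD1 xi) //= (bigD1 yi) ?yx //= big1 ?addr0 // => i.
by elim/(@letterP k): i => [|| j] //; rewrite ?eqxx ?andbF.
Qed.

(** All words of length three vanish in such an algebra, and the words of length two reduce
    to [X * Y], whose coefficient is the difference of two coefficients of [g]. *)
Lemma trunc_eval3_eq0 (A : pzAlg K) (X Y : A) (g : ncps K k.+2) :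
  X * X = 0 -> Y * Y = 0 -> Y * X = - (X * Y) -> coef g [::] = 0 ->
  coef g [:: xi] = 0 -> coef g [:: yi] = 0 -> coef g [:: xi; yi] = coef g [:: yi; xi] ->
  trunc_eval (letters X Y) 3 g = 0.
Proof.
move=> XX YY YX g0 gx gy gxy.
have L n' (h : ncps K k.+2) : trunc_eval (letters X Y) n'.+1 h = scalar A (coef h [::]) +
    (X * trunc_eval (letters X Y) n' (ncps_shift xi h) +
     Y * trunc_eval (letters X Y) n' (ncps_shift yi h)).
  by rewrite trunc_evalS sum_letters ?letters_x ?letters_y // => j; rewrite letters_z mul0r.
rewrite !L /= g0 gx gy gxy !rmorph0 !mulr0 !addr0 !add0r !mulrDr !mulrA XX YY YX.
by rewrite !mul0r add0r addr0 mulNr subrr.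
Qed.

(** By the constraints on its low degree coefficients, a central element without constant term
    dies in the four-dimensional quotient by the square of [x]. *)
Lemma potD_central_div z : central z -> jac_eps potD_deriv0 z = 0 ->
  exists u, z = p (x ^+ 2) * u.
Proof.
have [g ->] := class_surj z; rewrite jac_epsE => gC g0.
have [gx gy gxy] := central_low gC.
set u := p (x ^+ 2).
have uC : central u := @typeD_central K k b c n m.
have [JX JY JC] := @typeD_relations K k b c n m n2 m2.
have uI : twosided_ideal [set z : Jac f | exists v, z = u * v].
  split=> [|_ _ [v ->] [w ->]|a _ [v ->]|_ a [v ->]].
  - by exists 0; rewrite mulr0.
  - by exists (v + w); rewrite mulrDr.
  - by exists (a * v); rewrite !mulrA uC.
  - by exists (v * a); rewrite mulrA.
suff /class_eq : jq u g = class_of _ 0.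
  rewrite subr0; move: (class_of _ g); apply: gen_ideal_min => // _ ->.
  by exists 1; rewrite mulr1.
have J0 := @jq_deriv _ _ f u.
have Jl j : jq u (ncvar K j) = letters (jq u x) (jq u y) j.
  elim/(@letterP k): j => [||j]; rewrite ?letters_x ?letters_y ?letters_z //.
  exact: (relD_z J0).
have w0 := letters_words (k := k) (anticomm_words JX JY JC).
rewrite (nil_eval_hom w0 (@jq_scalar _ _ f u) Jl) rmorph0.
exact: (trunc_eval3_eq0 JX JY JC g0 gx gy gxy).
Qed.

Lemma typeD_generic : holds_generically
  (fun g : Jac f => alg_isomorphic (Jac_quot g) (Gamma2 K)).
Proof.
have Qs u v : u * v = 1 -> alg_isomorphic (Jac_quot (p (x ^+ 2) * u)) (Gamma2 K).
  by move=> uv; rewrite /Jac_quot (gen_ideal_unit _ uv); apply: typeD_iso.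
have ex : jac_eps potD_deriv0 (p (x ^+ 2)) = 0.
  by rewrite jac_epsE expr2 coefM0 mul0r.
have cx : central (p (x ^+ 2)) := @typeD_central K k b c n m.
pose lam : {additive Jac f -> K} := quot_functional coef_xx_kills.
apply: (generic_nontrivial (jac_eps_scalar potD_deriv0) (@jac_eps_unit _ _ _ potD_deriv0)
  cx ex potD_central_div Qs (lam := lam)).
- move=> e a; have [g ->] := class_surj a.
  rewrite -[scalar _ e]/(p (in_alg S e)) -rmorphM /= !quot_functionalE.
  have E w : coef (in_alg S e * g) w = e * coef g w.
    exact: (congr1 (fun h : ncps K k.+2 => coef h w) (mulr_algl e (g : ncps K k.+2))).
  by rewrite /= /coef_xx !E mulrBr mulrCA.
- move=> u; have [g ->] := class_surj u; rewrite -rmorphM /= quot_functionalE jac_epsE.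
  rewrite /= /coef_xx.
  have E l h : coef (x ^+ 2 * g) [:: l; h] = ([:: l; h] == [:: xi; xi])%:R * coef g [::].
    apply: etrans (coefM2 (x ^+ 2 : ncps K k.+2) g l h) _.
    by rewrite !coef_expn [[:: l] == _]eqseq_cons andbF !mul0r !add0r.
  by rewrite !E !eqseq_cons !eqxx yx /= mul1r mul0r mulr0 subr0.
Qed.

End GenericD.

(** * Normal forms in two-generator algebras *)

(** The identities of type E are checked by computing with rational coefficients, for which the
    binary representation of [Q] is efficient; [q2k] transports the results to [K]. *)
Section RationalScalars.
Local Notation Q := QArith_base.Q.
Local Notation Z := BinNums.Z.
Variable K : numFieldType.

Definition z2k (z : Z) : K := (int_of_Z z)%:~R.
Definition q2k (q : Q) : K :=
  z2k (QArith_base.Qnum q) / z2k (BinNums.Zpos (QArith_base.Qden q)).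

Definition ratQ (c : rat) : Q := QArith_base.Qmake (Z_of_int (numq c))
  (if Z_of_int (denq c) is BinNums.Zpos p then p else BinNums.xH).

Lemma z2kM a b : z2k (BinInt.Z.mul a b) = z2k a * z2k b.
Proof. by rewrite /z2k (rmorphM int_of_Z a b) rmorphM. Qed.
Lemma z2k_posM p q : z2k (BinNums.Zpos (BinPos.Pos.mul p q)) =
  z2k (BinNums.Zpos p) * z2k (BinNums.Zpos q).
Proof. exact: (z2kM (BinNums.Zpos p) (BinNums.Zpos q)). Qed.
Lemma z2kD a b : z2k (BinInt.Z.add a b) = z2k a + z2k b.
Proof. by rewrite /z2k (rmorphD int_of_Z a b) rmorphD. Qed.

Lemma z2k_pos p : z2k (BinNums.Zpos p) != 0.
Proof. by rewrite /z2k intr_eq0 -(rmorph0 int_of_Z) (inj_eq (can_inj int_of_ZK)). Qed.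

Lemma q2kM a b : q2k (QArith_base.Qmult a b) = q2k a * q2k b.
Proof.
case: a b => [a p] [b q]; rewrite /q2k /= z2kM z2k_posM.
by rewrite invfM mulrACA.
Qed.

Lemma q2kD a b : q2k (QArith_base.Qplus a b) = q2k a + q2k b.
Proof.
case: a b => [a p] [b q]; rewrite /q2k /= z2kD z2k_posM !z2kM.
by rewrite addf_div ?z2k_pos.
Qed.

Lemma q2k_eq a b : QArith_base.Qeq a b -> q2k a = q2k b.
Proof.
case: a b => [a p] [b q]; rewrite /QArith_base.Qeq /q2k /= => /(congr1 z2k).
by rewrite !z2kM => E; apply/eqP; rewrite eqr_div ?z2k_pos // E.
Qed.

Lemma q2k_red a : q2k (Qreduction.Qred a) = q2k a.
Proof. exact/q2k_eq/Qreduction.Qred_correct. Qed.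

Lemma q2k_rat c : q2k (ratQ c) = ratr c.
Proof.
rewrite /q2k /ratQ /ratr /= /z2k Z_of_intK; congr (_ / _%:~R).
have := denq_gt0 c; rewrite -{1}(Z_of_intK (denq c)).
by case E: (Z_of_int (denq c)) => [|p|p] //; rewrite -E Z_of_intK.
Qed.
End RationalScalars.

(** Expressions in two noncommuting variables, so that identities in an algebra can be
    reflected as computations. *)
Inductive nexpr := NX | NY | NC of rat | NAdd of nexpr & nexpr | NMul of nexpr & nexpr.

Declare Scope nexpr_scope.
Delimit Scope nexpr_scope with NE.
Bind Scope nexpr_scope with nexpr.
Notation "a + b" := (NAdd a b) : nexpr_scope.
Notation "a * b" := (NMul a b) : nexpr_scope.
Notation "c %:C" := (NC c) : nexpr_scope.
Definition npow (a : nexpr) n := iter n (NMul a) (NC 1).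
Notation "a ^ n" := (npow a n) : nexpr_scope.
Definition nsub a b := NAdd a (NMul (NC (-1)) b).
Notation "a - b" := (nsub a b) : nexpr_scope.

Fixpoint nsubst (U V : nexpr) (e : nexpr) : nexpr :=
  match e with
  | NX => U | NY => V | NC c => NC c
  | NAdd a b => NAdd (nsubst U V a) (nsubst U V b)
  | NMul a b => NMul (nsubst U V a) (nsubst U V b)
  end.

Section Evaluation.
Variables (K : numFieldType) (A : pzAlg K).

Fixpoint neval (x y : A) (e : nexpr) : A :=
  match e with
  | NX => x | NY => y | NC c => scalar A (ratr c)
  | NAdd a b => neval x y a + neval x y b
  | NMul a b => neval x y a * neval x y b
  end.

Lemma neval_subst x y U V e :
  neval x y (nsubst U V e) = neval (neval x y U) (neval x y V) e.
Proof. by elim: e => //= a -> b ->. Qed.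

Lemma neval_sub x y a b : neval x y (nsub a b) = neval x y a - neval x y b.
Proof. by rewrite /= !rmorphN1 mulN1r. Qed.

End Evaluation.

Lemma neval_hom (K : numFieldType) (A B : pzAlg K) (phi : {rmorphism A -> B}) x y e :
  preserves_scalars phi -> phi (neval x y e) = neval (phi x) (phi y) e.
Proof. by move=> phiC; elim: e => //= [a <- b <-|a <- b <-]; rewrite ?rmorphD ?rmorphM. Qed.

(** Both the quotient of the Jacobi algebra of type E and [Gamma3] have presentations by two
    generators in which the words [x x], [x y x] and [x y y + y x y + y y x] are
    polynomials in [y] without terms of degree less than three, while [y^3 x] and [y^6]
    vanish. The parameters are the coefficients of these polynomials. *)
Record e6_params := E6Params { e6_xx : rat; e6_xyx3 : rat; e6_xyx4 : rat;
  e6_r3 : rat; e6_r4 : rat; e6_r5 : rat }.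

Section Relations.
Local Open Scope nexpr_scope.
Definition e6_rels (p : e6_params) : seq nexpr :=
  [:: NX * NX - (e6_xx p)%:C * NY ^ 3;
      NX * NY * NX - ((e6_xyx3 p)%:C * NY ^ 3 + (e6_xyx4 p)%:C * NY ^ 4);
      NX * NY * NY + NY * NX * NY + NY * NY * NX
        - ((e6_r3 p)%:C * NY ^ 3 + (e6_r4 p)%:C * NY ^ 4 + (e6_r5 p)%:C * NY ^ 5);
      NY ^ 3 * NX; NY ^ 6].
End Relations.

Definition e6_pair (K : numFieldType) (A : pzAlg K) (p : e6_params) (x y : A) : Prop :=
  forall i, (i < 5)%N -> neval x y (nth NX (e6_rels p) i) = 0.

Section Normalisation.
Local Notation Q := QArith_base.Q.
Local Notation "0q" := (QArith_base.Qmake BinNums.Z0 BinNums.xH).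
Local Notation "1q" := (QArith_base.Qmake (BinNums.Zpos BinNums.xH) BinNums.xH).
Local Notation "-1q" := (QArith_base.Qmake (BinNums.Zneg BinNums.xH) BinNums.xH).

Definition qadd a b := Qreduction.Qred (QArith_base.Qplus a b).
Definition qmul a b := Qreduction.Qred (QArith_base.Qmult a b).

Fixpoint padd (a b : seq Q) : seq Q :=
  match a, b with
  | c :: a', d :: b' => qadd c d :: padd a' b'
  | [::], _ => b
  | _, [::] => a
  end.
Definition pscale (c : Q) (a : seq Q) : seq Q := map (qmul c) a.
Definition pshift n (a : seq Q) : seq Q := ncons n 0q a.

(** The element [p + q x + r x y], with [p], [q] and [r] polynomials in [y] given by their lists
    of coefficients. *)
Record nform := NForm { nf1 : seq Q; nfx : seq Q; nfxy : seq Q }.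

Variable p : e6_params.

(** Powers of [y] from the sixth on are zero, and from the third on when followed by [x]. *)
Definition ntrunc (t : nform) := NForm (take 6 (nf1 t)) (take 3 (nfx t)) (take 3 (nfxy t)).
Definition nadd (t u : nform) :=
  NForm (padd (nf1 t) (nf1 u)) (padd (nfx t) (nfx u)) (padd (nfxy t) (nfxy u)).
Definition nscale c (t : nform) :=
  NForm (pscale c (nf1 t)) (pscale c (nfx t)) (pscale c (nfxy t)).
Definition nzero := NForm [::] [::] [::].

Definition nmulx (t : nform) := ntrunc (NForm
  (padd (pscale (ratQ (e6_xx p)) (pshift 3 (nfx t)))
     (padd (pscale (ratQ (e6_xyx3 p)) (pshift 3 (nfxy t)))
           (pscale (ratQ (e6_xyx4 p)) (pshift 4 (nfxy t)))))
  (nf1 t) [::]).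

(** Right multiplication by [y] produces [r x y y], which the cubic relation rewrites by moving
    a [y] to the left. *)
Definition nmuly (t : nform) := ntrunc (NForm
  (padd (pshift 1 (nf1 t))
     (padd (pscale (ratQ (e6_r3 p)) (pshift 3 (nfxy t)))
     (padd (pscale (ratQ (e6_r4 p)) (pshift 4 (nfxy t)))
           (pscale (ratQ (e6_r5 p)) (pshift 5 (nfxy t))))))
  (pscale -1q (pshift 2 (nfxy t)))
  (padd (nfx t) (pscale -1q (pshift 1 (nfxy t))))).

Fixpoint nmulp (t : nform) (a : seq Q) : nform :=
  if a is c :: a' then nadd (nscale c t) (nmulp (nmuly t) a') else nzero.

Definition nmul (t u : nform) := nadd (nmulp t (nf1 u))
  (nadd (nmulx (nmulp t (nfx u))) (nmuly (nmulx (nmulp t (nfxy u))))).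

Fixpoint norm (e : nexpr) : nform :=
  match e with
  | NX => NForm [::] [:: 1q] [::]
  | NY => NForm [:: 0q; 1q] [::] [::]
  | NC c => NForm [:: ratQ c] [::] [::]
  | NAdd a b => nadd (norm a) (norm b)
  | NMul a b => nmul (norm a) (norm b)
  end.

Definition nform0 (t : nform) : bool :=
  let z := all (fun q : Q => if QArith_base.Qnum q is BinNums.Z0 then true else false) in
  [&& z (nf1 t), z (nfx t) & z (nfxy t)].

Section Soundness.
Variables (K : numFieldType) (A : pzAlg K) (x y : A).
Hypothesis xy : e6_pair p x y.

Local Notation sc c := (scalar A (q2k K c)).
Local Notation sr c := (scalar A (ratr c)).

Lemma pair_xx : x * x = sr (e6_xx p) * y ^+ 3.
Proof. by apply/eqP; rewrite -subr_eq0 -(xy (i := 0)) // neval_sub /= !rmorph1 !mulr1. Qed.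
Lemma pair_xyx : x * y * x = sr (e6_xyx3 p) * y ^+ 3 + sr (e6_xyx4 p) * y ^+ 4.
Proof. by apply/eqP; rewrite -subr_eq0 -(xy (i := 1)) // neval_sub /= !rmorph1 !mulr1. Qed.
Lemma pair_r : x * y * y + y * x * y + y * y * x =
  sr (e6_r3 p) * y ^+ 3 + sr (e6_r4 p) * y ^+ 4 + sr (e6_r5 p) * y ^+ 5.
Proof. by apply/eqP; rewrite -subr_eq0 -(xy (i := 2)) // neval_sub /= !rmorph1 !mulr1. Qed.
Lemma pair_y3x : y ^+ 3 * x = 0.
Proof. by rewrite -(xy (i := 3)) // /= !rmorph1 !mulr1. Qed.
Lemma pair_y6 : y ^+ 6 = 0.
Proof. by rewrite -(xy (i := 4)) // /= !rmorph1 !mulr1. Qed.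

Definition evl (a : seq Q) : A := foldr (fun c r => sc c + y * r) 0 a.
Definition evn (t : nform) : A := evl (nf1 t) + evl (nfx t) * x + evl (nfxy t) * (x * y).

Lemma sc0 : sc 0q = 0. Proof. by rewrite /q2k /z2k /= mul0r rmorph0. Qed.
Lemma sc1 : sc 1q = 1. Proof. by rewrite /q2k /z2k /= divr1 rmorph1. Qed.
Lemma scN1 : sc -1q = -1. Proof. by rewrite /q2k /z2k /= divr1 rmorphN1. Qed.

Lemma evl_add a b : evl (padd a b) = evl a + evl b.
Proof.
elim: a b => [|c a IH] [|d b] /=; rewrite ?add0r ?addr0 //.
by rewrite IH /qadd q2k_red q2kD rmorphD mulrDr addrACA.
Qed.

Lemma evl_scale c a : evl (pscale c a) = sc c * evl a.
Proof.
elim: a => [|d a IH] /=; rewrite ?mulr0 // IH /qmul q2k_red q2kM rmorphM mulrDr.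
by congr (_ + _); rewrite !mulrA; congr (_ * _); rewrite scalarC.
Qed.

Lemma evl_shift n a : evl (pshift n a) = y ^+ n * evl a.
Proof.
elim: n => [|n IH]; first by rewrite mul1r.
by rewrite /pshift /= -/(pshift n a) IH sc0 add0r exprS mulrA.
Qed.

Lemma evl_comm a : GRing.comm y (evl a).
Proof.
elim: a => [|c a IH] /=; first by rewrite /GRing.comm mulr0 mul0r.
apply: commrD; first by rewrite /GRing.comm scalarC.
by apply: commrM.
Qed.

Lemma evl_take n a : evl a = evl (take n a) + y ^+ n * evl (drop n a).
Proof.
elim: n a => [|n IH] [|c a] /=; rewrite ?mul1r ?add0r ?mulr0 ?addr0 //.
by rewrite [in LHS](IH a) mulrDr addrA exprS mulrA.
Qed.

Lemma evn_trunc t : evn (ntrunc t) = evn t.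
Proof.
have tr3 a b : evl (take 3 a) * (x * b) = evl a * (x * b).
  have C : y ^+ 3 * evl (drop 3 a) = evl (drop 3 a) * y ^+ 3.
    by apply/esym/commrX/esym; apply: evl_comm.
  by rewrite [in RHS](evl_take 3 a) mulrDl C -(mulrA _ _ (x * b)) (mulrA (y ^+ 3) x) pair_y3x
     mul0r mulr0 addr0.
have trx a : evl (take 3 a) * x = evl a * x by have := tr3 a 1; rewrite mulr1.
by rewrite /evn /= trx tr3 [in RHS](evl_take 6 (nf1 t)) pair_y6 mul0r addr0.
Qed.

Lemma evn_add t u : evn (nadd t u) = evn t + evn u.
Proof.
by rewrite /evn /= !evl_add !mulrDl [RHS]addrACA [X in _ = X + _]addrACA.
Qed.

Lemma evn_scale c t : evn (nscale c t) = sc c * evn t.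
Proof. by rewrite /evn /= !evl_scale !mulrDr !mulrA. Qed.

Lemma evl_monom a c n : evl a * (sr c * y ^+ n) = sr c * (y ^+ n * evl a).
Proof.
have -> : y ^+ n * evl a = evl a * y ^+ n by apply/esym/commrX/esym; apply: evl_comm.
by rewrite !mulrA; congr (_ * _); rewrite scalarC.
Qed.

Lemma evn_form a b c : evn (NForm a b c) = evl a + evl b * x + evl c * (x * y).
Proof. by []. Qed.

Lemma evn_mulx t : evn (nmulx t) = evn t * x.
Proof.
rewrite /nmulx evn_trunc evn_form !evl_add !evl_scale !evl_shift !q2k_rat mul0r addr0 /evn.
rewrite !mulrDl addrC -[RHS]addrA; congr (_ + (_ + _)).
  by rewrite -[RHS]mulrA pair_xx evl_monom.
by rewrite -[RHS]mulrA pair_xyx mulrDr !evl_monom.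
Qed.

(** The only nontrivial term is [x y y], a polynomial in [y] minus [y x y] minus [y y x]. *)
Lemma evn_muly t : evn (nmuly t) = evn t * y.
Proof.
rewrite /nmuly evn_trunc evn_form !evl_add !evl_scale !evl_shift !q2k_rat !scN1 !mulN1r expr1 /evn.
set r := (X in _ * evl (nf1 t) + X); set s := nfxy t in r *.
have sy n : y ^+ n * evl s = evl s * y ^+ n by apply/esym/commrX/esym; apply: evl_comm.
have E : evl s * (x * y) * y = r - y * evl s * (x * y) - y ^+ 2 * evl s * x.
  have -> : evl s * (x * y) * y = evl s * (x * y * y) by rewrite !mulrA.
  have -> : x * y * y = (x * y * y + y * x * y + y * y * x) - y * x * y - y * y * x.
    by rewrite addrAC addrK addrK.
  rewrite pair_r !mulrBr !mulrDr !evl_monom /r addrA; congr (_ - _ - _).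
    by rewrite (evl_comm s) !mulrA.
  by rewrite sy expr2 !mulrA.
rewrite !mulrDl E !mulNr -(evl_comm (nf1 t)) -!addrA; congr (_ + _).
do 3![rewrite [RHS]addrCA; congr (_ + _)]; rewrite mulrA addrCA; congr (_ + _).
by rewrite addrC.
Qed.

Lemma evn_zero : evn nzero = 0. Proof. by rewrite /evn /= !mul0r !addr0. Qed.

Lemma evn_mulp t a : evn (nmulp t a) = evn t * evl a.
Proof.
elim: a t => [|c a IH] t /=; first by rewrite evn_zero mulr0.
by rewrite evn_add evn_scale IH evn_muly [RHS]mulrDr -mulrA -scalarC.
Qed.

Lemma evn_mul t u : evn (nmul t u) = evn t * evn u.
Proof.
rewrite /nmul !evn_add evn_muly !evn_mulx !evn_mulp [evn u]/evn !mulrDr !mulrA addrA.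
by [].
Qed.

Lemma evn_norm e : evn (norm e) = neval x y e.
Proof.
elim: e => [||c|a IHa b IHb|a IHa b IHb] /=.
- by rewrite /evn /= sc1 mulr0 addr0 mul1r mul0r addr0 add0r.
- by rewrite /evn /= sc0 sc1 !mulr0 !addr0 add0r mulr1 !mul0r !addr0.
- by rewrite /evn /= q2k_rat mulr0 !mul0r !addr0.
- by rewrite evn_add IHa IHb.
- by rewrite evn_mul IHa IHb.
Qed.

Lemma evn_nform0 t : nform0 t -> evn t = 0.
Proof.
have z a : all (fun q : Q => if QArith_base.Qnum q is BinNums.Z0 then true else false) a ->
    evl a = 0.
  elim: a => //= -[n d] a IH /andP[n0 /IH ->]; rewrite mulr0 addr0.
  by case: n n0 => // _; rewrite /q2k /z2k /= mul0r rmorph0.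
by case/and3P=> z1 z2 z3; rewrite /evn !z // !mul0r !addr0.
Qed.

Lemma norm_eq0 e : nform0 (norm e) -> neval x y e = 0.
Proof. by move=> /evn_nform0 <-; rewrite evn_norm. Qed.

Lemma norm_eq a b : nform0 (norm (nsub a b)) -> neval x y a = neval x y b.
Proof. by move=> /norm_eq0; rewrite neval_sub => /eqP; rewrite subr_eq0 => /eqP. Qed.

End Soundness.

Lemma e6_pair_subst (q : e6_params) (U V : nexpr) :
  all (fun r => nform0 (norm (nsubst U V r))) (e6_rels q) ->
  forall (K : numFieldType) (A : pzAlg K) (x y : A),
  e6_pair p x y -> e6_pair q (neval x y U) (neval x y V).
Proof.
move=> /(all_nthP NX) H K A x y xy i i5; rewrite -neval_subst; apply: (norm_eq0 xy).
exact: H.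
Qed.

End Normalisation.

Section Cases.
Local Open Scope nexpr_scope.

(** The first three values come from the relations [3 x^2 + y^3 = 0] and [s = 0] of the quotient
    of the Jacobi algebra; the last three come from the term [y^n]. *)
Definition jac_params (a b c : rat) : e6_params :=
  E6Params (- 1 / 3) (1 / 3) (1 / 3) a b c.
(** The relations [u u = 0], [u v v + v u v + v v u = 0] and [v v v = N u v u], which for a
    square root of [- N] are equivalent to those of [Gamma3]. *)
Definition gamma_params (N : rat) : e6_params := E6Params 0 N^-1 0 0 0 0.

(** A cubic change of the variable [y]; its coefficients solve the equations that the new
    relations impose degree by degree. *)
Definition cubic_var (w : nexpr) : nexpr := w + (1/4)%:C * w ^ 2 + (3/16)%:C * w ^ 3.
(** The compositional inverse of [cubic_var] modulo the sixth power. *)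
Definition cubic_var_inv (v : nexpr) : nexpr := v - (1/4)%:C * v ^ 2 - (1/16)%:C * v ^ 3
  + (5/32)%:C * v ^ 4 - (11/128)%:C * v ^ 5.

(** That is [x / (1 - y)], since [x y^3] vanishes. Its square is zero because the relations for
    [jac_params] make the words [x x], [x y x] and [x y y x] add up to zero. *)
Definition sq0_var : nexpr := NX * (1%:C + NY + NY ^ 2).

(** A pair of mutually inverse changes of variables: [ch_U], [ch_V] express the variables
    of [gamma_params ch_N] through those of [ch_params], and [ch_P], [ch_Q] conversely. *)
Record e6_change := E6Change { ch_params : e6_params; ch_N : rat;
  ch_U : nexpr; ch_V : nexpr; ch_P : nexpr; ch_Q : nexpr }.

(** For exponent at least seven, or without the term [y^n], that term does not reach the
    algebra. For smaller exponents the variables receive corrections that absorb it; for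
    exponent four it also changes the constant [ch_N]. *)
Definition change7 : e6_change := let Q := cubic_var_inv NY in
  E6Change (jac_params 0 0 0) 3 sq0_var (cubic_var NY) (NX * (1%:C - Q)) Q.
Definition change6 : e6_change := let Q := cubic_var_inv NY in
  E6Change (jac_params 0 0 (-6)) 3 (sq0_var + 2%:C * NY ^ 3) (cubic_var NY)
    ((NX - 2%:C * Q ^ 3) * (1%:C - Q)) Q.
Definition change5 : e6_change :=
  let Q := (1%:C - (15/2)%:C * NX) * cubic_var_inv NY - (25/4)%:C * cubic_var_inv NY ^ 3 in
  E6Change (jac_params 0 (-5) 0) 3 sq0_var
    (cubic_var (NY + (15/2)%:C * sq0_var * NY + (25/4)%:C * NY ^ 3)) (NX * (1%:C - Q)) Q.
Definition change4 : e6_change :=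
  let Q := (-11)%:C * cubic_var_inv NY - 6%:C * NX in
  E6Change (jac_params (-4) 0 0) (- 3 / 11) sq0_var (cubic_var ((-1/11)%:C * (NY + 6%:C * sq0_var)))
    (NX * (1%:C - Q)) Q.

Definition change_ok (ch : e6_change) : bool :=
  let p := ch_params ch in let q := gamma_params (ch_N ch) in
  let: E6Change _ _ U V P Q := ch in
  [&& all (fun r => nform0 (norm p (nsubst U V r))) (e6_rels q),
      all (fun r => nform0 (norm q (nsubst P Q r))) (e6_rels p),
      nform0 (norm p (nsub (nsubst U V P) NX)), nform0 (norm p (nsub (nsubst U V Q) NY)),
      nform0 (norm q (nsub (nsubst P Q U) NX)) & nform0 (norm q (nsub (nsubst P Q V) NY))].

(** Each check expands the relations of one algebra at the new variables of the other, and
    compares the composites of the two changes with the identity. *)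
Lemma change7_ok : change_ok change7. Proof. by vm_cast_no_check (erefl true). Qed.
Lemma change6_ok : change_ok change6. Proof. by vm_cast_no_check (erefl true). Qed.
Lemma change5_ok : change_ok change5. Proof. by vm_cast_no_check (erefl true). Qed.
Lemma change4_ok : change_ok change4. Proof. by vm_cast_no_check (erefl true). Qed.
End Cases.

(** Nilpotency is verified by running through the binary tree of words. *)
Fixpoint words_vanish p n (t : nform) : bool :=
  if n is n'.+1 then words_vanish p n' (nmulx p t) && words_vanish p n' (nmuly p t)
  else nform0 t.

Lemma words_vanishP p n t (K : numFieldType) (A : pzAlg K) (x y : A) :
  e6_pair p x y -> words_vanish p n t ->
  forall bs, size bs = n -> evn x y t * bin_word x y bs = 0.
Proof.
move=> xy; elim: n t => [|n IH] t /=.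
  by move=> t0 [] // _; rewrite (evn_nform0 _ _ t0) mul0r.
case/andP=> Hx Hy [|b bs] // [sz]; rewrite /bin_word big_cons -/(bin_word x y bs) mulrA.
by case: b; [rewrite -(evn_mulx xy)|rewrite -(evn_muly xy)]; apply: IH.
Qed.

Definition nf_one : nform := norm (gamma_params 0) (NC 1).

Lemma e6_words p : words_vanish p 6 nf_one ->
  forall (K : numFieldType) (A : pzAlg K) (x y : A), e6_pair p x y ->
  forall bs, size bs = 6 -> bin_word x y bs = 0.
Proof.
move=> wv K A x y xy bs sz; have := words_vanishP xy wv sz.
by rewrite /evn /= q2k_rat !mul0r mulr0 !addr0 !rmorph1 mul1r.
Qed.

Lemma words7 : words_vanish (ch_params change7) 6 nf_one.
Proof. by vm_cast_no_check (erefl true). Qed.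
Lemma words6 : words_vanish (ch_params change6) 6 nf_one.
Proof. by vm_cast_no_check (erefl true). Qed.
Lemma words5 : words_vanish (ch_params change5) 6 nf_one.
Proof. by vm_cast_no_check (erefl true). Qed.
Lemma words4 : words_vanish (ch_params change4) 6 nf_one.
Proof. by vm_cast_no_check (erefl true). Qed.

(** * The central element of type E *)

Lemma cancel_ends (V : zmodType) (a b d e : V) : a + b + d - (d + e + a) = b - e.
Proof.
have -> : d + e + a = e + (a + d) by rewrite [d + e]addrC -addrA [d + a]addrC.
have -> : a + b + d = b + (a + d) by rewrite -addrA addrCA.
by rewrite opprD addrACA subrr addr0.
Qed.

Lemma cancel_swap (V : zmodType) (a b d : V) : a - b + (d + b - (a + d)) = 0.
Proof. by rewrite [a + d]addrC opprD [d + b + _]addrACA subrr add0r addrA subrK subrr. Qed.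

Section E6Algebra.
Variables (K : numFieldType) (A : pzAlg K) (X Y : A) (b : bool) (n : nat).
Hypothesis n4 : (4 <= n)%N.
Hypothesis rel_x : X ^+ 2 *+ 3 + Y ^+ 3 = 0.
Hypothesis rel_y : Y * Y * X + Y * X * Y + X * Y * Y + b%:R * (Y ^+ n.-1 *+ n) = 0.
Local Notation sc c := (scalar A c).
Local Notation c := (X ^+ 2).
Local Notation t := (n %/ 3)%N.

Lemma e6_Y3 : Y ^+ 3 = sc (-3) * c.
Proof.
move/eqP: rel_x; rewrite addrC addr_eq0 => /eqP ->.
by rewrite rmorphN rmorph_nat mulNr mulr_natl.
Qed.

Lemma e6_cY : GRing.comm c Y.
Proof.
have : GRing.comm (Y ^+ 3) Y by apply/commr_sym/commrX.
rewrite /GRing.comm e6_Y3 mulrA -scalarC -!mulrA => /eqP.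
rewrite -subr_eq0 -mulrBr => /eqP /(congr1 (fun a => sc (- 3)^-1 * a)).
rewrite mulr0 mulrA -rmorphM mulVf ?rmorph1 ?mul1r; last by rewrite oppr_eq0 pnatr_eq0.
by move/eqP; rewrite subr_eq0 => /eqP.
Qed.

Lemma e6_cX : GRing.comm c X. Proof. exact/commr_sym/commrX. Qed.

(** The [y]-relation, multiplied by [X] on the left and on the right; the difference loses the
    words with a square of [X], which is central. *)
Lemma e6_swap : Y * X * Y * X - X * Y * X * Y =
  X * (b%:R * (Y ^+ n.-1 *+ n)) - b%:R * (Y ^+ n.-1 *+ n) * X.
Proof.
set r := _ * (_ *+ n).
have E : Y * Y * X + Y * X * Y + X * Y * Y = - r.
  by apply/eqP; rewrite -addr_eq0 rel_y.
have <- : (- r) * X - X * (- r) = Y * X * Y * X - X * Y * X * Y.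
  rewrite -E !mulrDl !mulrDr !mulrA.
  have -> : Y * Y * X * X = X * X * Y * Y.
    by rewrite -mulrA -!expr2 -[RHS]mulrA -expr2; apply/esym/commrX/e6_cY.
  exact: cancel_ends.
by rewrite mulNr mulrN opprK addrC.
Qed.

(** The correction terms of [g6], for arbitrary elements of an algebra. *)
Definition e6_corr : A :=
  match (n %% 3)%N with
  | 0 => sc ((-1) ^+ t.+1 * 3 ^+ t * t%:R) *
           (X * Y * X ^+ (2 * t - 2) + Y * X ^+ (2 * t - 1))
  | 1 => 0
  | _ => sc ((-1) ^+ t * 3 ^+ t * (3 * t + 2)%:R) * X ^+ (2 * t + 1)
  end.

Definition e6_elt : A :=
  c + X * Y * X + Y * c + (if b then e6_corr else 0).

Lemma e6_t_gt0 : (0 < t)%N. Proof. by rewrite divn_gt0 // (leq_trans _ n4). Qed.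

Lemma e6_t_gt1 : (n %% 3 = 0)%N -> (1 < t)%N.
Proof.
move=> n3; have := n4; rewrite {1}(divn_eq n 3) n3 addn0.
by case: (t) => [|[|]].
Qed.

(** Since the square of [X] is central, the correction is a power of it times an element of low
    degree, in which form commutators are immediate. *)
Lemma e6_corrE : e6_corr =
  match (n %% 3)%N with
  | 0 => sc ((-1) ^+ t.+1 * 3 ^+ t * t%:R) * (c ^+ t.-1 * (X * Y + Y * X))
  | 1 => 0
  | _ => sc ((-1) ^+ t * 3 ^+ t * (3 * t + 2)%:R) * (c ^+ t * X)
  end.
Proof.
have Xe j : X ^+ (2 * j) = c ^+ j by rewrite exprM.
rewrite /e6_corr; case: (n %% 3)%N => [|[|j]] //; last by rewrite addn1 exprSr Xe.
have [s ->] : exists s, t = s.+1 by exists t.-1; rewrite prednK // e6_t_gt0.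
rewrite mulnS addKn Xe /=; have -> : (2 + 2 * s - 1 = (2 * s).+1)%N by rewrite add2n subn1.
rewrite [X ^+ (2 * s).+1]exprS Xe [Y * (X * _)]mulrA; congr (_ * _).
by rewrite mulrDr; congr (_ + _); apply/commrX/commr_sym/commrM; (exact: e6_cX || exact: e6_cY).
Qed.

Lemma e6_comm_X : GRing.comm e6_elt X.
Proof.
rewrite /GRing.comm /e6_elt !mulrDl !mulrDr; congr (_ + _).
  rewrite -!addrA; congr (_ + _); first exact: e6_cX.
  have -> : X * Y * X * X = X * (Y * c) by rewrite expr2 !mulrA.
  have -> : X * (X * Y * X) = Y * c * X.
    by rewrite [LHS]mulrA [X * (X * Y)]mulrA -expr2 e6_cY.
  exact: addrC.
case: b; last by rewrite mul0r mulr0.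
rewrite e6_corrE; case: (n %% 3)%N => [|[|j]]; rewrite ?mul0r ?mulr0 //; apply/commr_sym.
  apply: commrM; first by rewrite /GRing.comm scalarC.
  apply: commrM; first exact/commrX/commr_sym/e6_cX.
  rewrite /GRing.comm mulrDl mulrDr addrC !mulrA; congr (_ + _).
  by rewrite -expr2 -[RHS]mulrA -expr2 e6_cY.
apply: commrM; first by rewrite /GRing.comm scalarC.
by apply: commrM => //; apply/commrX/commr_sym/e6_cX.
Qed.

(** The commutator of [Y] with the first three terms is that of [Y X Y X], which by [e6_swap] is a
    commutator of [X] with the power of [Y] in the potential. The coefficient of the
    correction is the one that makes its own commutator cancel this. *)
Lemma e6_comm_Y : GRing.comm e6_elt Y.
Proof.
have cY j : Y * c ^+ j = c ^+ j * Y by apply/commrX/commr_sym/e6_cY.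
have cX j : X * c ^+ j = c ^+ j * X by apply/commrX/commr_sym/e6_cX.
apply/commr_sym/eqP; rewrite -subr_eq0; apply/eqP.
have -> : Y * e6_elt - e6_elt * Y = (Y * X * Y * X - X * Y * X * Y) +
    (if b then Y * e6_corr - e6_corr * Y else 0).
  rewrite /e6_elt !mulrDl !mulrDr opprD addrACA; congr (_ + _); last first.
    by case: b => //; rewrite mulr0 mul0r subrr.
  have -> : Y * (Y * c) = Y * c * Y by rewrite -[RHS]mulrA e6_cY.
  rewrite [c * Y]e6_cY opprD addrACA subrr addr0 opprD addrACA subrr add0r.
  by rewrite !mulrA.
rewrite e6_swap; case eb: b rel_y => _; last by rewrite !mul0r mulr0 subrr addr0.
rewrite !mul1r.
(* Both the correction and the power of Y are the same multiple of a power of c, times D and E. *)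
suff [k [s [D [E [-> -> ED]]]]] : exists k s D E, [/\ e6_corr = sc k * (c ^+ s * D),
    Y ^+ n.-1 *+ n = sc k * (c ^+ s * E) & X * E - E * X + (Y * D - D * Y) = 0].
  have pull a C : GRing.comm a c -> a * (sc k * (c ^+ s * C)) = sc k * (c ^+ s * (a * C)).
    by move=> ac; rewrite mulrA -scalarC -mulrA (mulrA a) (commrX s ac) -mulrA.
  rewrite !pull; try (apply/commr_sym; (exact: e6_cX || exact: e6_cY)).
  by rewrite -!mulrA -!mulrBr -!mulrDr ED !mulr0.
have Yp j m : Y ^+ (j * 3 + m) = sc ((-3) ^+ j) * (c ^+ j * Y ^+ m).
  rewrite exprD mulnC exprM e6_Y3 exprMn_comm; last by rewrite /GRing.comm scalarC.
  by rewrite rmorphXn mulrA.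
have scn k (a : A) m : (sc k * a) *+ m = sc (k *+ m) * a.
  by rewrite rmorphMn mulrnAl.
have nE := divn_eq n 3; have t0 := e6_t_gt0; have := ltn_pmod n (isT : (0 < 3)%N).
rewrite e6_corrE; case E3: (n %% 3)%N => [|[|[|//]]] _.
- have [s tE] : exists s, t = s.+1 by exists t.-1; rewrite prednK.
  have n1 : (n.-1 = s * 3 + 2)%N by rewrite {1}nE E3 tE mulSn addn0 addnC addn3 addn2.
  exists ((-3) ^+ s *+ n), s, (X * Y + Y * X), (Y * Y); split.
  + have nE' : n = (s.+1 * 3)%N by rewrite nE E3 tE addn0.
    rewrite tE /=; congr (sc _ * _); rewrite -[RHS]mulr_natr [in RHS]nE' natrM [in RHS]exprNn.
    by rewrite !exprS; ring.
  + by rewrite n1 Yp scn expr2.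
  + by rewrite mulrDr mulrDl !mulrA cancel_swap.
- exists ((-3) ^+ t *+ n), t, 0, 1; split; rewrite ?mulr0 ?mul0r //.
  + by rewrite {1}nE E3 addn1 /= -[(t * 3)%N]addn0 Yp scn expr0.
  + by rewrite mulr1 mul1r !subrr addr0.
- exists ((-3) ^+ t *+ n), t, X, Y; split=> //.
  + have nE' : n = (3 * t + 2)%N by rewrite {1}nE E3 mulnC.
    by congr (sc _ * _); rewrite -[RHS]mulr_natr -nE' [in RHS]exprNn.
  + by rewrite {1}nE E3 addn2 /= -addn1 Yp scn expr1.
  + by rewrite addrA subrK subrr.
Qed.

Definition e6_change_of : e6_change :=
  if b then match n with 4 => change4 | 5 => change5 | 6 => change6 | _ => change7 end
  else change7.

Lemma e6_corr0 : c * X = 0 -> e6_corr = 0.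
Proof.
move=> cX0; rewrite e6_corrE; have t0 := e6_t_gt0.
case E3: (n %% 3)%N => [|[|j]] //.
  have [s ->] : exists s, t.-1 = s.+1.
    by exists t.-2; rewrite prednK // -subn1 subn_gt0 e6_t_gt1.
  rewrite (exprSr c) -[c ^+ s * c * _]mulrA mulrDr !mulrA cX0 mul0r e6_cY -[Y * c * X]mulrA cX0.
  by rewrite mulr0 addr0 !mulr0.
by rewrite -(prednK t0) (exprSr c) -[c ^+ _ * c * X]mulrA cX0 !mulr0.
Qed.

Lemma e6_pairI a1 a2 a3 :
  ch_params e6_change_of = jac_params a1 a2 a3 ->
  - (b%:R * (Y ^+ n.-1 *+ n)) =
    sc (ratr a1) * Y ^+ 3 + sc (ratr a2) * Y ^+ 4 + sc (ratr a3) * Y ^+ 5 ->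
  c * X = 0 -> e6_elt = 0 -> e6_pair (ch_params e6_change_of) X Y.
Proof.
move=> -> rho cX0 s0.
have third : sc (ratr (1 / 3)) * Y ^+ 3 = - c.
  have -> : ratr (1 / 3) = 3^-1 :> K by rewrite fmorph_div rmorph1 mul1r rmorph_nat.
  rewrite e6_Y3 mulrA -rmorphM mulrN mulVf ?pnatr_eq0 //.
  by rewrite rmorphN1 mulN1r.
have XYX : X * Y * X = - c - Y * c.
  have : e6_elt - (if b then e6_corr else 0) = 0 by rewrite s0 e6_corr0 // if_same subr0.
  rewrite /e6_elt addrK addrAC => /eqP.
  by rewrite addrC addr_eq0 => /eqP ->; rewrite opprD.
have Y4 : Y ^+ 4 = Y ^+ 3 * Y by rewrite exprSr.
case=> [|[|[|[|[|//]]]]] _; rewrite /e6_rels [nth _ _ _]/= ?neval_sub /= !rmorph1 !mulr1.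
- change (X * X - sc (ratr (- 1 / 3)) * Y ^+ 3 = 0).
  by rewrite mulNr !rmorphN mulNr third opprK -expr2 subrr.
- change (X * Y * X - (sc (ratr (1 / 3)) * Y ^+ 3 + sc (ratr (1 / 3)) * Y ^+ 4) = 0).
  by rewrite XYX Y4 mulrA third mulNr e6_cY subrr.
- change (X * Y * Y + Y * X * Y + Y * Y * X - (sc (ratr a1) * Y ^+ 3 + sc (ratr a2) * Y ^+ 4
    + sc (ratr a3) * Y ^+ 5) = 0).
  rewrite -rho opprK -[RHS]rel_y; congr (_ + _).
  by rewrite addrC [X * Y * Y + _]addrC addrA.
- change (Y ^+ 3 * X = 0).
  by rewrite e6_Y3 -mulrA cX0 mulr0.
- change (Y ^+ 6 = 0); have cc : c * c = 0 by rewrite [X in c * X]expr2 mulrA cX0 mul0r.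
  by rewrite (exprD Y 3 3) e6_Y3 -mulrA (mulrA c) -scalarC -mulrA cc !mulr0.
Qed.

(** From the sixth power on the term from the potential is zero, which leaves three exponents. *)
Lemma e6_y_term : (forall m, Y ^+ (6 + m) = 0) -> exists a1 a2 a3,
  ch_params e6_change_of = jac_params a1 a2 a3 /\
  - (b%:R * (Y ^+ n.-1 *+ n)) =
    sc (ratr a1) * Y ^+ 3 + sc (ratr a2) * Y ^+ 4 + sc (ratr a3) * Y ^+ 5.
Proof.
move=> Y6; rewrite /e6_change_of; case: b; last first.
  by exists 0, 0, 0; rewrite mul0r oppr0 !rmorph0 !mul0r !addr0.
rewrite mul1r; case: n n4 => [|[|[|[|[|[|[|m]]]]]]] // _.
- exists (-4), 0, 0; split=> //.
  by rewrite !rmorphN !rmorph_nat mulNr mulr_natl !rmorph0 !mul0r !addr0.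
- exists 0, (-5), 0; split=> //.
  by rewrite !rmorphN !rmorph_nat mulNr mulr_natl !rmorph0 !mul0r add0r addr0.
- exists 0, 0, (-6); split=> //.
  by rewrite !rmorphN !rmorph_nat mulNr mulr_natl !rmorph0 !mul0r !add0r.
- exists 0, 0, 0; split=> //.
  by rewrite (Y6 m) mul0rn oppr0 !rmorph0 !mul0r !addr0.
Qed.

Lemma e6_pair_jac : c * X = 0 -> e6_elt = 0 -> e6_pair (ch_params e6_change_of) X Y.
Proof.
move=> cX0 s0.
have cc : c * c = 0 by rewrite [X in c * X]expr2 mulrA cX0 mul0r.
have Y6 m : Y ^+ (6 + m) = 0.
  rewrite exprD (exprD Y 3 3) e6_Y3 -(mulrA _ c) (mulrA c) -scalarC -(mulrA _ c) cc !mulr0.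
  by rewrite mul0r.
have [a1 [a2 [a3 [pE rho]]]] := e6_y_term Y6.
exact: e6_pairI pE rho cX0 s0.
Qed.

(** Moving [c X] out of the correction: the right factor in [e6_corr * X = c * X * e6_eta]. *)
Definition e6_eta : A := if b then
  match (n %% 3)%N with
  | 0 => sc ((-1) ^+ t.+1 * 3 ^+ t * t%:R) * (c ^+ t.-2 * (Y * X + X * Y))
  | 1 => 0
  | _ => sc ((-1) ^+ t * 3 ^+ t * (3 * t + 2)%:R) * (c ^+ t.-1 * X)
  end else 0.

Lemma e6_corr_eta : (if b then e6_corr else 0) * X = c * X * e6_eta.
Proof.
rewrite /e6_eta; case: b; last by rewrite mul0r mulr0.
have pull k C : c * X * (sc k * C) = sc k * (c * X * C).
  by rewrite mulrA -scalarC -mulrA.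
have cX j : X * c ^+ j = c ^+ j * X by apply/commrX/commr_sym/e6_cX.
rewrite e6_corrE; case E3: (n %% 3)%N => [|[|j]]; rewrite ?mul0r ?mulr0 // pull -mulrA;
  congr (_ * _).
  have t1 := e6_t_gt1 E3.
  have [s ->] : exists s, t.-1 = s.+1 by exists t.-2; rewrite prednK // -subn1 subn_gt0.
  rewrite /= -[c * X * _]mulrA (mulrA X) cX -(mulrA _ X) [RHS]mulrA -exprS -mulrA.
  congr (_ * _); rewrite mulrDl mulrDr -mulrA; congr (_ + _).
  by rewrite -mulrA -expr2 -e6_cY mulrA.
have [s ->] : exists s, t = s.+1 by exists t.-1; rewrite prednK // e6_t_gt0.
by rewrite [RHS]mulrA -(mulrA c X) cX (mulrA c) -(exprS c).
Qed.

(** Let [T = c X]. Multiplying [s = 0] by [X] gives [T (1 + Y + eta) = - Y T], so [T = - Y T w]. Three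
    iterations give [T = - Y^3 T w^3 = 3 c T w^3], and the central [c] moves [T] to the
    left of a unit. *)
Lemma e6_socle w v : e6_elt = 0 -> (1 + Y + e6_eta) * w = 1 ->
  (1 - c * w ^+ 3 *+ 3) * v = 1 -> c * X = 0.
Proof.
move=> s0 wE vE; have [T TE] : exists T, c * X = T by eexists.
rewrite TE.
have E : e6_elt * X = T + T * Y + Y * T + T * e6_eta.
  rewrite /e6_elt !mulrDl e6_corr_eta -[Y * c * X]mulrA TE; congr (_ + _ + _ + _).
  by rewrite -[LHS]mulrA -expr2 -mulrA -e6_cY mulrA -e6_cX TE.
have TwE : T * (1 + Y + e6_eta) = - (Y * T).
  by apply/eqP; rewrite -addr_eq0 !mulrDr mulr1 addrAC -E s0 mul0r.
have TY : T = - (Y * T * w) by rewrite -mulNr -TwE -mulrA wE mulr1.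
have T3 : T = (c * T * w ^+ 3) *+ 3.
  have st j : Y ^+ j * T = - (Y ^+ j.+1 * T * w).
    by rewrite {1}TY mulrN exprSr !mulrA.
  have T3 : T = - (Y ^+ 3 * T * w * w * w).
    by rewrite -{1}[T]mul1r -(expr0 Y) (st 0) (st 1) (st 2) !mulNr !opprK.
  by rewrite [LHS]T3 e6_Y3 rmorphN rmorph_nat !mulNr opprK -!mulrA mulr_natl.
rewrite -[T]mulr1 -vE mulrA mulrBr mulr1 mulrnAr mulrA.
have -> : T * c = c * T by rewrite -TE -mulrA e6_cX.
by rewrite -T3 subrr mul0r.
Qed.

End E6Algebra.

(** * Two variables adapted to the relations of Gamma3 *)

Section CubicChange.
Variables (K : comNzRingType) (A : pzAlg K).
Implicit Types X Y a : A.
Local Notation sc c := (scalar A c).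

(** The part of the cube of [X + Y] that is linear in [X]. *)
Definition cubic_mix X Y := X * Y * Y + Y * X * Y + Y * Y * X.

Lemma expr3l a : a ^+ 3 = a * a * a.
Proof. by rewrite !exprS expr0 mulr1 mulrA. Qed.

(** The part quadratic in [X] reduces to [X Y X] when the square of [X] is zero. *)
Lemma cube_add X Y : X * X = 0 -> (Y + X) ^+ 3 = Y ^+ 3 + cubic_mix X Y + X * Y * X.
Proof.
move=> XX; have sq : (Y + X) * (Y + X) = Y * Y + X * Y + Y * X.
  by rewrite mulrDl !mulrDr XX addr0 addrAC.
rewrite [LHS]exprS expr2 sq mulrDl !mulrDr !mulrA XX mul0r addr0 expr3l addrA.
by congr (_ + _); rewrite /cubic_mix -!addrA; congr (_ + _); rewrite addrA addrC.
Qed.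

Lemma cubic_mixZ X Y k : cubic_mix (sc k * X) Y = sc k * cubic_mix X Y.
Proof.
have C a b : a * (sc k * b) = sc k * (a * b) by rewrite !mulrA scalarC.
by rewrite /cubic_mix !mulrDr -!mulrA !C !mulrA.
Qed.

Lemma scaled_square X k : X * X = 0 -> (sc k * X) * (sc k * X) = 0.
Proof. by move=> XX; rewrite mulrA -(mulrA _ X) -scalarC -!mulrA XX !mulr0. Qed.

Lemma scaled_sandwich X Y k : sc k * X * Y * (sc k * X) = sc (k ^+ 2) * (X * Y * X).
Proof.
rewrite -(mulrA _ X) -(mulrA _ (X * Y)) (mulrA (X * Y)) -(scalarC k (X * Y)).
by rewrite -mulrA mulrA -rmorphM -expr2.
Qed.

Lemma cube_add_scaled X Y k : X * X = 0 ->
  (Y + sc k * X) ^+ 3 = Y ^+ 3 + sc k * cubic_mix X Y + sc (k ^+ 2) * (X * Y * X).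
Proof.
by move=> XX; rewrite cube_add ?scaled_square // cubic_mixZ scaled_sandwich.
Qed.

Lemma cubic_mix_add X Y k : X * X = 0 ->
  cubic_mix X (Y + sc k * X) = cubic_mix X Y + sc (k *+ 2) * (X * Y * X).
Proof.
move=> XX; have C a b : a * (sc k * b) = sc k * (a * b) by rewrite !mulrA scalarC.
have XkX : X * (sc k * X) = 0 by rewrite C XX mulr0.
have Xv : X * (Y + sc k * X) = X * Y by rewrite mulrDr XkX addr0.
have vX : (Y + sc k * X) * X = Y * X by rewrite mulrDl -mulrA XX mulr0 addr0.
have E1 : X * (Y + sc k * X) * (Y + sc k * X) = X * Y * Y + sc k * (X * Y * X).
  by rewrite Xv mulrDr C.
have E2 : (Y + sc k * X) * X * (Y + sc k * X) = Y * X * Y.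
  by rewrite vX mulrDr -[X in _ + X]mulrA XkX mulr0 addr0.
have E3 : (Y + sc k * X) * (Y + sc k * X) * X = Y * Y * X + sc k * (X * Y * X).
  by rewrite -mulrA vX mulrDl !mulrA.
by rewrite /cubic_mix E1 E2 E3 mulr2n rmorphD mulrDl [X in X + _ = _]addrAC addrACA.
Qed.

End CubicChange.

(** In [Gamma3] put [Z = X + Y], so that the relations are [X^2 = Y^3 = Z^3 = 0]. The pair is symmetric
    around [v = Y + X / 2]: the cubes of [v - X / 2] and [v + X / 2] both vanish exactly when
    their even and odd parts in [X] do, which are the two relations in [u] and [v]. The
    factor [r] normalizes [X]. *)
Section GammaPair.
Variables (K : numFieldType) (A : pzAlg K) (N : rat) (r : K).
Hypotheses (N0 : N != 0) (rN : r ^+ 2 = - ratr N).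
Local Notation sc c := (scalar A c).
Implicit Types X Y u v : A.

Lemma sqrt_neq0 : r != 0.
Proof.
apply: contraNneq N0 => r0; move: rN; rewrite r0 expr0n /= => /esym/eqP.
by rewrite oppr_eq0 fmorph_eq0.
Qed.

Definition pair_u X := sc (- (2 * r)^-1) * X.
Definition pair_v X Y := Y + sc (2^-1) * X.

Lemma gamma_pairI u v : u * u = 0 -> u * v * u = sc (ratr N^-1) * v ^+ 3 -> cubic_mix u v = 0 ->
  e6_pair (gamma_params N) u v.
Proof.
move=> uu uvu S0.
have v3 : v ^+ 3 = sc (ratr N) * (u * v * u).
  by rewrite uvu mulrA -rmorphM -rmorphM mulfV // !rmorph1 mul1r.
have v3u : v ^+ 3 * u = 0 by rewrite v3 -!mulrA uu !mulr0.
case=> [|[|[|[|[|//]]]]] _; rewrite /e6_rels [nth _ _ _]/= ?neval_sub /= !rmorph1 !mulr1.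
- by rewrite uu !rmorph0 mul0r subrr.
- change (u * v * u - (sc (ratr N^-1) * v ^+ 3 + sc (ratr 0) * v ^+ 4) = 0).
  by rewrite uvu !rmorph0 mul0r addr0 subrr.
- by rewrite !rmorph0 !mul0r !addr0 subr0.
- exact: v3u.
- change (v ^+ 6 = 0); rewrite (exprD v 3 3) {2}v3 mulrA -scalarC -mulrA -!(mulrA u) (mulrA _ u).
  by rewrite v3u mul0r mulr0.
Qed.

Lemma gamma_pair_of X Y : X ^+ 2 = 0 -> Y ^+ 3 = 0 -> (X + Y) ^+ 3 = 0 ->
  e6_pair (gamma_params N) (pair_u X) (pair_v X Y).
Proof.
rewrite expr2 => XX Y3; rewrite addrC cube_add // Y3 add0r => S0.
have S : cubic_mix X Y = - (X * Y * X) by apply/eqP; rewrite -addr_eq0 S0.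
have two : 2 != 0 :> K by rewrite pnatr_eq0.
apply: gamma_pairI; rewrite /pair_u /pair_v.
- exact: scaled_square.
- rewrite cube_add_scaled // Y3 add0r S mulrN -mulNr -rmorphN -mulrDl -rmorphD.
  rewrite [RHS]mulrA -rmorphM.
  have -> : sc (- (2 * r)^-1) * X * (Y + sc 2^-1 * X) * (sc (- (2 * r)^-1) * X) =
      sc ((- (2 * r)^-1) ^+ 2) * (X * (Y + sc 2^-1 * X) * X).
    exact: scaled_sandwich.
  have -> : X * (Y + sc 2^-1 * X) * X = X * Y * X.
    by rewrite -mulrA mulrDl -(mulrA _ X) XX mulr0 addr0 mulrA.
  congr (sc _ * _); rewrite sqrrN exprVn exprMn rN fmorphV; field.
  by rewrite fmorph_eq0 N0.
- have h1 : 2^-1 *+ 2 = 1 :> K by rewrite -[_ *+ 2]mulr_natr mulVf.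
  by rewrite cubic_mixZ cubic_mix_add // S h1 rmorph1 mul1r addNr mulr0.
Qed.

(** The cube of [v + t u] is [v^3 + t^2 u v u], with no linear term, so it vanishes for both
    [t = r] and [t = - r]. *)
Lemma gamma_of_pair u v : e6_pair (gamma_params N) u v ->
  [/\ (sc (- 2 * r) * u) ^+ 2 = 0, (v + sc r * u) ^+ 3 = 0 &
      (- (sc (- 2 * r) * u + (v + sc r * u))) ^+ 3 = 0].
Proof.
move=> uv; have := pair_xx uv; rewrite /= !rmorph0 mul0r => uu.
have := pair_xyx uv; rewrite /= !rmorph0 mul0r addr0 => uvu.
have := pair_r uv; rewrite /= !rmorph0 !mul0r !addr0 -/(cubic_mix u v) => S0.
have N' : sc (- ratr N) * (sc (ratr N^-1) * v ^+ 3) = - v ^+ 3.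
  by rewrite mulrA -rmorphM mulNr -rmorphM mulfV // rmorph1 rmorphN1 mulN1r.
split.
- by rewrite expr2 scaled_square.
- by rewrite cube_add_scaled // S0 mulr0 addr0 uvu rN N' subrr.
- have -> : sc (- 2 * r) * u + (v + sc r * u) = v + sc (- r) * u.
    rewrite addrCA -mulrDl -rmorphD; congr (_ + sc _ * _); ring.
  have E3 (a : A) : (- a) ^+ 3 = - a ^+ 3 by rewrite !expr3l mulrNN mulrN.
  by rewrite E3 cube_add_scaled // S0 mulr0 addr0 uvu sqrrN rN N' subrr oppr0.
Qed.

Lemma pair_uK X : sc (- 2 * r) * pair_u X = X.
Proof.
rewrite /pair_u mulrA -rmorphM -[RHS]mul1r -(rmorph1 (scalar A)); congr (sc _ * _).
by field; rewrite sqrt_neq0.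
Qed.
Lemma pair_vK X Y : pair_v X Y + sc r * pair_u X = Y.
Proof.
rewrite /pair_u /pair_v mulrA -rmorphM -addrA -mulrDl -rmorphD -[RHS]addr0; congr (_ + _).
rewrite -[RHS](mul0r X) -(rmorph0 (scalar A)); congr (sc _ * _).
by field; rewrite sqrt_neq0.
Qed.
End GammaPair.

(** * The quotient of the Jacobi algebra of type E *)

Section E6Morphisms.
Variables (K : numFieldType) (A B : pzAlg K) (phi : {rmorphism A -> B}).
Hypothesis phiC : preserves_scalars phi.

Lemma hom_e6_elt X Y b n : phi (e6_elt X Y b n) = e6_elt (phi X) (phi Y) b n.
Proof.
rewrite /e6_elt !rmorphD !rmorphM; congr (_ + _); case: b; last exact: rmorph0.
rewrite /e6_corr; case: (n %% 3)%N => [|[|j]]; rewrite ?rmorph0 //.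
  by rewrite rmorphM phiC rmorphD !rmorphM !rmorphXn.
by rewrite rmorphM phiC rmorphXn.
Qed.

Lemma hom_e6_eta X Y b n : phi (e6_eta X Y b n) = e6_eta (phi X) (phi Y) b n.
Proof.
rewrite /e6_eta; case: b; last exact: rmorph0.
case: (n %% 3)%N => [|[|j]]; rewrite ?rmorph0 //.
  by rewrite rmorphM phiC rmorphM rmorphD !rmorphM !rmorphXn.
by rewrite rmorphM phiC rmorphM !rmorphXn.
Qed.
End E6Morphisms.

Section TypeE.
Variables (K : numFieldType) (k : nat) (b : bool) (n : nat).
Hypothesis n4 : (4 <= n)%N.
Local Notation xi := (inord k : 'I_k.+2).
Local Notation yi := (inord k.+1 : 'I_k.+2).
Local Notation x := (xvar K k).
Local Notation y := (yvar K k).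
Local Notation S := (ncps_alg K k.+2).
Local Notation f := (potE K k b n).
Local Notation g := (g6 K k (if b then Some n else None)).

Lemma g6_elt : g = e6_elt (A := S) x y b n.
Proof.
rewrite /g6 /e6_elt; case: b; last by rewrite !addr0.
congr (_ + _); rewrite /e6_corr; case: (n %% 3)%N => [|[|j]] //;
  exact: esym (mulr_algl _ _).
Qed.

Section Relations.
Variables (A : pzAlg K) (theta : {rmorphism S -> A}).

Section FromDeriv.
Hypothesis theta0 : forall i, theta (cyc_deriv i f) = 0.

Lemma relE_x : theta x ^+ 2 *+ 3 + theta y ^+ 3 = 0.
Proof. by have := theta0 xi; rewrite potE_x rmorphD rmorphMn !rmorphXn. Qed.

Lemma relE_y : theta y * theta y * theta x + theta y * theta x * theta y +
  theta x * theta y * theta y + b%:R * (theta y ^+ n.-1 *+ n) = 0.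
Proof.
by have := theta0 yi; rewrite potE_y !rmorphD !rmorphM rmorph_nat rmorphMn rmorphXn.
Qed.

Lemma relE_z j : theta (zvar K j) = 0.
Proof. by apply: alg_hom_double; rewrite -[RHS](theta0 (inord j)) potE_z. Qed.
End FromDeriv.

(** The relations of [e6_pair] imply those of the quotient of the Jacobi algebra, correction
    terms included, because the cube of [x] vanishes. *)
Lemma potE_kill : preserves_scalars theta ->
  e6_pair (ch_params (e6_change_of b n)) (theta x) (theta y) ->
  (forall j : 'I_k, theta (zvar K j) = 0) ->
  (forall i, theta (cyc_deriv i f) = 0) /\ theta g = 0.
Proof.
move=> thC; set X := theta x; set Y := theta y; set p := ch_params _ => XY tz.
have Y6 m : Y ^+ (6 + m) = 0 by rewrite exprD (pair_y6 XY) mul0r.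
have [a1 [a2 [a3 [pE rho]]]] := e6_y_term b n4 Y6.
have XY' : e6_pair (jac_params a1 a2 a3) X Y by rewrite -pE.
have r3 : ratr (1 / 3) = 3^-1 :> K by rewrite fmorph_div rmorph1 mul1r rmorph_nat.
have XX : X * X = - (scalar A 3^-1 * Y ^+ 3).
  have /= -> := pair_xx XY'.
  change (scalar A (ratr (- 1 / 3)) * Y ^+ 3 = - (scalar A 3^-1 * Y ^+ 3)).
  by rewrite mulNr !rmorphN mulNr; congr (- (scalar A _ * _)); exact: r3.
have XYX : X * Y * X = scalar A 3^-1 * Y ^+ 3 + scalar A 3^-1 * Y ^+ 4.
  have /= -> := pair_xyx XY'.
  change (scalar A (ratr (1 / 3)) * Y ^+ 3 + scalar A (ratr (1 / 3)) * Y ^+ 4 =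
    scalar A 3^-1 * Y ^+ 3 + scalar A 3^-1 * Y ^+ 4).
  by rewrite r3.
have rx : X ^+ 2 *+ 3 + Y ^+ 3 = 0.
  rewrite expr2 XX mulNrn -mulrnAl -rmorphMn -[3^-1 *+ 3]mulr_natr mulVf ?pnatr_eq0 //.
  by rewrite rmorph1 mul1r addNr.
have ry : Y * Y * X + Y * X * Y + X * Y * Y + b%:R * (Y ^+ n.-1 *+ n) = 0.
  have -> : Y * Y * X + Y * X * Y + X * Y * Y = - (b%:R * (Y ^+ n.-1 *+ n)).
    have -> : Y * Y * X + Y * X * Y + X * Y * Y = X * Y * Y + Y * X * Y + Y * Y * X.
      by rewrite addrC [Y * Y * X + _]addrC addrA.
    by rewrite (pair_r XY') rho.
  by rewrite addNr.
have X3 : X ^+ 2 * X = 0.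
  by rewrite expr2 XX mulNr -mulrA (pair_y3x XY) mulr0 oppr0.
split; last first.
  rewrite g6_elt hom_e6_elt // /e6_elt (e6_corr0 n4 rx X3) if_same addr0.
  rewrite -/X -/Y XYX expr2 XX mulrN mulrA -scalarC -mulrA -exprS.
  by rewrite addrA addNr add0r subrr.
elim/(@letterP k) => [||j].
- by rewrite potE_x rmorphD rmorphMn !rmorphXn.
- by rewrite potE_y !rmorphD !rmorphM rmorph_nat rmorphMn rmorphXn.
- by rewrite potE_z rmorphMn [theta (zvar K j)]tz mul0rn.
Qed.
End Relations.

Lemma typeE_central : central (jac_class f g).
Proof.
apply: jac_central; elim/(@letterP k) => [||j].
- have rx := relE_x (theta := jac_proj _) (@cls_deriv _ _ f).
  have := e6_comm_X b n4 rx.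
  by rewrite -(hom_e6_elt (phi := jac_proj f)) // -g6_elt.
- have rx := relE_x (theta := jac_proj _) (@cls_deriv _ _ f).
  have ry := relE_y (theta := jac_proj _) (@cls_deriv _ _ f).
  have := e6_comm_Y n4 rx ry.
  by rewrite -(hom_e6_elt (phi := jac_proj f)) // -g6_elt.
- have E := relE_z (theta := jac_proj _) (@cls_deriv _ _ f) j.
  by rewrite [class_of _ (ncvar K (inord j))]E mulr0 mul0r.
Qed.

Lemma coefM0r (a h : S) : coef h [::] = 0 -> coef (a * h) [::] = 0.
Proof. by move=> h0; apply: etrans (coefM0 a h) _; rewrite h0 mulr0. Qed.

Lemma coef_eta0 : coef (e6_eta (A := S) x y b n) [::] = 0.
Proof.
have x0 : coef x [::] = 0 by [].
have y0 : coef y [::] = 0 by [].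
rewrite /e6_eta; case: b => //; case: (n %% 3)%N => [|[|j]] //; do 2!apply: coefM0r => //.
by rewrite -(addr0 (0 : K)); congr (_ + _); apply: coefM0r.
Qed.

(** The two elements to be inverted have constant term one already as power series. *)
Lemma eta_units (A : pzAlg K) (phi : {rmorphism S -> A}) : preserves_scalars phi ->
  exists w v, (1 + phi y + e6_eta (phi x) (phi y) b n) * w = 1 /\
              (1 - phi x ^+ 2 * w ^+ 3 *+ 3) * v = 1.
Proof.
move=> phiC.
have [|w [wl _]] := @series_unit _ _ (- ((y : S) + e6_eta (A := S) x y b n) : ncps K k.+2).
  by rewrite coefN coefD coef_eta0 addr0 oppr0.
have [|v [vl _]] := @series_unit _ _ ((x ^+ 2 * w ^+ 3) *+ 3 : ncps K k.+2).
  by rewrite coefMn !coefM0 !mul0r mul0rn.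
exists (phi w), (phi v); split.
  rewrite -(hom_e6_eta phiC) -(rmorph1 phi) -!rmorphD -rmorphM; congr (phi _).
  by rewrite -[RHS]wl opprK addrA.
by rewrite -!rmorphXn -rmorphM -rmorphMn -(rmorph1 phi) -rmorphB -rmorphM; congr (phi _).
Qed.

(** In the quotient by [s] the cube of [x] vanishes, which cuts the relations down to those of a
    twelve-dimensional algebra. *)
Lemma typeE_pair (u := jac_class f g) :
  e6_pair (ch_params (e6_change_of b n)) (jq u x) (jq u y).
Proof.
have J0 := @jq_deriv _ _ f u.
have rx := relE_x J0; have ry := relE_y J0.
have gE : e6_elt (jq u x) (jq u y) b n = 0.
  by rewrite -(hom_e6_elt (phi := jq u)) // -g6_elt; apply: jq_s.
apply: (e6_pair_jac n4 rx ry) => //.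
have [w [v [wE vE]]] := eta_units (@jq_scalar _ _ f u).
exact: (e6_socle n4 rx gE wE vE).
Qed.

End TypeE.

(** * Isomorphism in type E *)

Lemma sum0_last (V : zmodType) (a b c : V) : a + b + c = 0 -> c = - (a + b).
Proof. by move/eqP; rewrite addrC addr_eq0 => /eqP. Qed.

Lemma cube_opp0 (A : pzRingType) (a : A) : (- a) ^+ 3 = 0 -> a ^+ 3 = 0.
Proof. by rewrite exprNn -signr_odd /= mulN1r => /eqP; rewrite oppr_eq0 => /eqP. Qed.

(** The tabulated change of variables composed with the normalization by a square root of
    [- N], which is not rational in general. *)
Section ChangeOfVariables.
Variables (ch : e6_change) (K : numFieldType) (r : K).
Hypotheses (ok : change_ok ch) (N0 : ch_N ch != 0) (rN : r ^+ 2 = - ratr (ch_N ch)).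
Local Notation p := (ch_params ch).
Local Notation q := (gamma_params (ch_N ch)).
Local Notation P := (ch_P ch).
Local Notation Q := (ch_Q ch).
Local Notation U := (ch_U ch).
Local Notation V := (ch_V ch).

Lemma change_pair (A : pzAlg K) (X Y : A) : e6_pair p X Y ->
  [/\ e6_pair q (neval X Y U) (neval X Y V),
      neval (neval X Y U) (neval X Y V) P = X & neval (neval X Y U) (neval X Y V) Q = Y].
Proof.
case: ch ok => p' N' U' V' P' Q' /andP[H1 /and5P[_ H3 H4 _ _]] XY.
split; first exact: e6_pair_subst XY.
- by rewrite -neval_subst (norm_eq XY H3).
- by rewrite -neval_subst (norm_eq XY H4).
Qed.

Lemma change_pair_inv (A : pzAlg K) (u v : A) : e6_pair q u v ->
  [/\ e6_pair p (neval u v P) (neval u v Q),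
      neval (neval u v P) (neval u v Q) U = u & neval (neval u v P) (neval u v Q) V = v].
Proof.
case: ch ok => p' N' U' V' P' Q' /andP[_ /and5P[H2 _ _ H5 H6]] uv.
split; first exact: e6_pair_subst uv.
- by rewrite -neval_subst (norm_eq uv H5).
- by rewrite -neval_subst (norm_eq uv H6).
Qed.

Section InAlgebra.
Variable A : pzAlg K.
Implicit Types X Y u v : A.
Local Notation sc c := (scalar A c).

Definition gamma_x X Y := sc (- 2 * r) * neval X Y U.
Definition gamma_y X Y := neval X Y V + sc r * neval X Y U.

Lemma gamma_relations X Y : e6_pair p X Y ->
  [/\ gamma_x X Y ^+ 2 = 0, gamma_y X Y ^+ 3 = 0 & (- (gamma_x X Y + gamma_y X Y)) ^+ 3 = 0].
Proof. by case/change_pair=> UV _ _; apply: (gamma_of_pair N0 rN). Qed.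

Definition jac_x X Y := neval (pair_u r X) (pair_v X Y) P.
Definition jac_y X Y := neval (pair_u r X) (pair_v X Y) Q.

Lemma jac_pair_of X Y : X ^+ 2 = 0 -> Y ^+ 3 = 0 -> (X + Y) ^+ 3 = 0 ->
  e6_pair p (jac_x X Y) (jac_y X Y).
Proof. by move=> X2 Y3 Z3; case: (change_pair_inv (gamma_pair_of N0 rN X2 Y3 Z3)). Qed.

Lemma gamma_jacK X Y : X ^+ 2 = 0 -> Y ^+ 3 = 0 -> (X + Y) ^+ 3 = 0 ->
  gamma_x (jac_x X Y) (jac_y X Y) = X /\ gamma_y (jac_x X Y) (jac_y X Y) = Y.
Proof.
move=> X2 Y3 Z3; have [_ E1 E2] := change_pair_inv (gamma_pair_of N0 rN X2 Y3 Z3).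
by rewrite /gamma_x /gamma_y E1 E2 (pair_uK N0 rN) (pair_vK N0 rN).
Qed.

Lemma jac_gammaK X Y : e6_pair p X Y ->
  jac_x (gamma_x X Y) (gamma_y X Y) = X /\ jac_y (gamma_x X Y) (gamma_y X Y) = Y.
Proof.
case/change_pair=> _ E1 E2; rewrite /jac_x /jac_y.
have -> : pair_u r (gamma_x X Y) = neval X Y U.
  rewrite /pair_u /gamma_x mulrA -rmorphM (_ : - (2 * r)^-1 * (- 2 * r) = 1) ?rmorph1 ?mul1r //.
  by field; rewrite (sqrt_neq0 N0 rN).
have -> : pair_v (gamma_x X Y) (gamma_y X Y) = neval X Y V.
  rewrite /pair_v /gamma_y /gamma_x -addrA mulrA -rmorphM -mulrDl -rmorphD.
  by rewrite (_ : r + 2^-1 * (- 2 * r) = 0) ?rmorph0 ?mul0r ?addr0 //; field.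
by [].
Qed.
End InAlgebra.

Section Morphism.
Variables (A B : pzAlg K) (phi : {rmorphism A -> B}).
Hypothesis phiC : preserves_scalars phi.

Lemma hom_gamma_x X Y : phi (gamma_x X Y) = gamma_x (phi X) (phi Y).
Proof. by rewrite rmorphM phiC (neval_hom _ _ _ phiC). Qed.
Lemma hom_gamma_y X Y : phi (gamma_y X Y) = gamma_y (phi X) (phi Y).
Proof. by rewrite rmorphD rmorphM phiC !(neval_hom _ _ _ phiC). Qed.
Lemma hom_pair_u X : phi (pair_u r X) = pair_u r (phi X).
Proof. by rewrite rmorphM phiC. Qed.
Lemma hom_pair_v X Y : phi (pair_v X Y) = pair_v (phi X) (phi Y).
Proof. by rewrite rmorphD rmorphM phiC. Qed.
Lemma hom_jac_x X Y : phi (jac_x X Y) = jac_x (phi X) (phi Y).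
Proof. by rewrite (neval_hom _ _ _ phiC) hom_pair_u hom_pair_v. Qed.
Lemma hom_jac_y X Y : phi (jac_y X Y) = jac_y (phi X) (phi Y).
Proof. by rewrite (neval_hom _ _ _ phiC) hom_pair_u hom_pair_v. Qed.
End Morphism.
End ChangeOfVariables.

Lemma e6_change_ofP b n (P : e6_change -> Prop) :
  P change4 -> P change5 -> P change6 -> P change7 -> P (e6_change_of b n).
Proof.
by move=> P4 P5 P6 P7; rewrite /e6_change_of; case: b => //; case: n => [|[|[|[|[|[|[|n]]]]]]].
Qed.

Section TypeEIso.
Variables (K : numClosedFieldType) (k : nat) (b : bool) (n : nat).
Hypothesis n4 : (4 <= n)%N.
Local Notation f := (potE K k b n).
Local Notation g := (g6 K k (if b then Some n else None)).
Local Notation x := (xvar K k).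
Local Notation y := (yvar K k).

Lemma typeE_iso : alg_isomorphic (Jac_quot (jac_class f g)) (Gamma3 K).
Proof.
pose good ch := [/\ change_ok ch, words_vanish (ch_params ch) 6 nf_one & ch_N ch != 0].
have : good (e6_change_of b n).
  apply: e6_change_ofP; split; [exact: change4_ok|exact: words4|by []|exact: change5_ok|
    exact: words5|by []|exact: change6_ok|exact: words6|by []|exact: change7_ok|exact: words7|by []].
set ch := e6_change_of b n => -[ok wv N0].
pose r : K := sqrtC (- ratr (ch_N ch)).
have rN : r ^+ 2 = - ratr (ch_N ch) by apply: sqrtCK.
set u := jac_class f g.
pose G := Gamma3 K; pose v j : G := class_of _ (free3_var K j).
have v0 : v 0 ^+ 2 = 0.
  by rewrite -rmorphXn; apply: (@gamma_nth K 2 1).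
have v1 : v 1 ^+ 3 = 0.
  by rewrite -rmorphXn; apply: (@gamma_nth K 2 2).
have v2 : v 2 ^+ 3 = 0.
  by rewrite -rmorphXn; apply: (@gamma_nth K 2 3).
have vS : v 0 + v 1 + v 2 = 0.
  by have := @gamma_nth K 2 0 isT; rewrite /= !rmorphD.
have vE : v 2 = - (v 0 + v 1) by apply: sum0_last.
have v01 : (v 0 + v 1) ^+ 3 = 0 by apply: cube_opp0; rewrite -vE.
have J0 := @jq_deriv _ _ f u.
have Jp := typeE_pair K k b n4.
have Gp := jac_pair_of ok N0 rN v0 v1 v01.
have [vx vy] := gamma_jacK ok N0 rN v0 v1 v01.
have [jx jy] := jac_gammaK ok N0 rN Jp.
have [l0 l1 l2] := gamma_relations ok N0 rN Jp.
pose a0 := gamma_x ch r (jq u x) (jq u y); pose a1 := gamma_y ch r (jq u x) (jq u y).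
(* In both algebras the words of length six vanish. *)
apply: (@iso_criterion _ _ _ _ 2 5 (jac_x ch r (v 0) (v 1)) (jac_y ch r (v 0) (v 1))
  (fun j => nth 0 [:: a0; a1; - (a0 + a1)] j)).
- by move=> j; apply: (relE_z J0).
- exact: (e6_words wv Jp).
- exact: (e6_words wv Gp).
- move=> theta thC tx ty; apply: (potE_kill n4 thC); rewrite tx ty; exact: Gp.
- move=> h /(nthP 0)[l lr <-]; case: l lr => [|[|[|[|//]]]] _ /=.
  + by rewrite !rmorphD /= !free_eval_var /= subrr.
  + rewrite rmorphXn /= free_eval_var; exact: l0.
  + rewrite rmorphXn /= free_eval_var; exact: l1.
  + rewrite rmorphXn /= free_eval_var; exact: l2.
- move=> psi psiC psiV; rewrite (hom_jac_x _ _ psiC) (hom_jac_y _ _ psiC) !psiV; split.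
  + exact: jx.
  + exact: jy.
- move=> chi chiC cx cy.
  have c0 : chi a0 = v 0 by rewrite (hom_gamma_x _ _ chiC) cx cy; exact: vx.
  have c1 : chi a1 = v 1 by rewrite (hom_gamma_y _ _ chiC) cx cy; exact: vy.
  elim/ord3P; [exact: c0|exact: c1|].
  by rewrite [LHS]rmorphN rmorphD c0 c1 -vE.
Qed.
End TypeEIso.

(** * The three families *)

Local Open Scope complex_scope.
Section Families.
Variables (K : numFieldType) (k : nat).
Local Notation xi := (inord k : 'I_k.+2).
Local Notation yi := (inord k.+1 : 'I_k.+2).
Local Notation x := (xvar K k).
Local Notation y := (yvar K k).
Implicit Type f : ncps K k.+2.

Lemma familyA_pot f : familyA f -> exists b n, geq_exp n 2 /\ f = potA K k b n.
Proof.
case=> [[n n2 ->]|->]; first by exists true, (Some n); rewrite /potA mul1r.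
by exists false, None; rewrite /potA mul0r addr0.
Qed.

Lemma familyD_pot f : familyD f ->
  exists b c n m, [/\ geq_exp n 2, geq_exp m 2 & f = potD K k b c n m].
Proof.
case=> [[n [m [n2 m2 _ ->]]]|[n n2 ->]|[m m2 ->]|->].
- by exists true, true, (Some n), (Some m); rewrite /potD !mul1r.
- by exists true, false, (Some n), None; rewrite /potD mul1r mul0r addr0.
- by exists false, true, None, (Some m); rewrite /potD mul1r mul0r addr0.
- by exists false, false, None, None; rewrite /potD !mul0r !addr0.
Qed.

Lemma familyE6_pot f : familyE6 f -> exists b n, (4 <= n)%N /\ f = potE K k b n.
Proof.
case=> [[n n4 ->]|->]; first by exists true, n; rewrite /potE mul1r.
by exists false, 4; rewrite /potE mul0r addr0.
Qed.

Let yx : (yi == xi) = false. Proof. by rewrite eq_sym (negPf (xi_neq_yi k)). Qed.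

Lemma coef_zquad w : xi \in w -> coef (zquad K k) w = 0.
Proof.
move=> xw; rewrite coef_sum big1 // => j _; rewrite coef_expn.
by case: eqP xw => // ->; rewrite mem_nseq /= eq_sym (negPf (zi_neq_xi j)).
Qed.

Lemma coef_pow_short i e w : geq_exp e (size w).+1 -> coef (pow (ncvar K i : ncps K k.+2) e) w = 0.
Proof.
case: e => //= m wm; rewrite coef_expn; case: eqP => // E.
by move: wm; rewrite {1}E size_nseq ltnn.
Qed.

Lemma coef_pow_other i l e w : l \in w -> l != i ->
  coef (pow (ncvar K i : ncps K k.+2) e) w = 0.
Proof.
move=> lw li; case: e => //= m; rewrite coef_expn.
by case: eqP lw => // ->; rewrite mem_nseq (negPf li) andbF.
Qed.

Lemma coef_xyn n w : coef (x * y ^+ n) w = (w == xi :: nseq n yi)%:R.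
Proof. by rewrite monoxyn. Qed.

(** The families are told apart by two coefficients: that of [x x] is one exactly in type A, that
    of [x y y] separates type D from type E. *)
Definition coef_x2 f := coef f [:: xi; xi].
Definition coef_xy2 f := coef f [:: xi; yi; yi].

Lemma potA_x2 b n : coef_x2 (potA K k b n) = 1.
Proof.
rewrite /coef_x2 /potA !coefD coef_eps (@coef_pow_other yi xi) ?mem_head ?xi_neq_yi //.
by rewrite coef_zquad ?mem_head // coef_expn eqxx mulr0 addr0 add0r.
Qed.

Lemma potD_x2 b c n m : geq_exp n 2 -> geq_exp m 2 -> coef_x2 (potD K k b c n m) = 0.
Proof.
move=> n2 m2; rewrite /coef_x2 /potD !coefD !coef_eps.
rewrite !coef_pow_short ?geq_double ?geq_doubleB1 // coef_zquad ?mem_head // coef_xyn.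
by rewrite !mulr0 !addr0 add0r [_ == _](_ : _ = false) ?eqseq_cons ?andbF.
Qed.

Lemma potD_xy2 b c n m : coef_xy2 (potD K k b c n m) = 1.
Proof.
rewrite /coef_xy2 /potD !coefD !coef_eps.
rewrite !(@coef_pow_other xi yi) ?yx ?inE ?eqxx ?orbT // coef_zquad ?mem_head // coef_xyn.
by rewrite !mulr0 !addr0 add0r eqxx.
Qed.

Lemma potE_x2 b n : (4 <= n)%N -> coef_x2 (potE K k b n) = 0.
Proof.
move=> n4; rewrite /coef_x2 /potE !coefD !coef_eps coef_zquad ?mem_head // coef_xyn.
rewrite (@coef_pow_other yi xi (Some n)) ?mem_head ?xi_neq_yi //.
by rewrite (@coef_pow_short xi (Some 3)) // [_ == _](_ : _ = false) ?mulr0 ?addr0 ?eqseq_cons ?andbF.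
Qed.

Lemma potE_xy2 b n : (4 <= n)%N -> coef_xy2 (potE K k b n) = 0.
Proof.
move=> n4; rewrite /coef_xy2 /potE !coefD !coef_eps coef_zquad ?mem_head // coef_xyn.
rewrite (@coef_pow_other yi xi (Some n)) ?mem_head ?xi_neq_yi //.
rewrite (@coef_pow_other xi yi (Some 3)) ?inE ?eqxx ?orbT ?yx //.
by rewrite [_ == _](_ : _ = false) ?mulr0 ?addr0 ?eqseq_cons ?andbF.
Qed.

Lemma not_familyA f : coef_x2 f = 0 -> ~ familyA f.
Proof. by move=> f0 /familyA_pot[b [n [_ E]]]; move/eqP: f0; rewrite E potA_x2 oner_eq0. Qed.

Lemma not_familyD f : coef_x2 f <> 0 \/ coef_xy2 f = 0 -> ~ familyD f.
Proof.
move=> f0 /familyD_pot[b [c [n [m [n2 m2 E]]]]]; case: f0; rewrite E.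
  by rewrite potD_x2.
by rewrite potD_xy2 => /eqP; rewrite oner_eq0.
Qed.

Lemma not_familyE6 f : coef_x2 f <> 0 \/ coef_xy2 f <> 0 -> ~ familyE6 f.
Proof. by move=> f0 /familyE6_pot[b [n [n4 E]]]; case: f0; rewrite E ?potE_x2 ?potE_xy2. Qed.

End Families.

Theorem theorem1p4 (R : realType) (k : nat) (f s : ncps R[i] k.+2)
    (hfs : potential_elt f s) :
  [/\ central (jac_class f s) /\
      (exists i : 'I_6, alg_isomorphic (Jac_quot (jac_class f s)) (Gamma_ R[i] i)),
      [/\ familyA f -> alg_isomorphic (Jac_quot (jac_class f s)) (Gamma1 R[i]),
          familyD f -> alg_isomorphic (Jac_quot (jac_class f s)) (Gamma2 R[i]) &
          familyE6 f -> alg_isomorphic (Jac_quot (jac_class f s)) (Gamma3 R[i])] &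
      (familyA f -> holds_generically
         (fun g : Jac f => alg_isomorphic (Jac_quot g) (Gamma1 R[i]))) /\
      (familyD f -> holds_generically
         (fun g : Jac f => alg_isomorphic (Jac_quot g) (Gamma2 R[i])))].
Proof.
have one0 : (1 : R[i]) <> 0 by apply/eqP/oner_neq0.
case: hfs => [b n n2|b c n m n2 m2 _|b n n4].
- have nD : ~ familyD (potA R[i] k b n) by apply: not_familyD; left; rewrite potA_x2.
  have nE : ~ familyE6 (potA R[i] k b n) by apply: not_familyE6; left; rewrite potA_x2.
  have iso := @typeA_iso R[i] k b n n2.
  split; first by split; [exact: typeA_central|exists 0; exact: iso].
    by split=> [_|/nD[]|/nE[]]; exact: iso.
  by split=> [_|/nD[]]; exact: (@typeA_generic R[i] k b n n2).
- have nA : ~ familyA (potD R[i] k b c n m) by apply: not_familyA; rewrite potD_x2.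
  have nE : ~ familyE6 (potD R[i] k b c n m) by apply: not_familyE6; right; rewrite potD_xy2.
  have iso := @typeD_iso R[i] k b c n m n2 m2.
  split; first by split; [exact: typeD_central|exists 1; exact: iso].
    by split=> [/nA[]|_|/nE[]]; exact: iso.
  by split=> [/nA[]|_]; exact: (@typeD_generic R[i] k b c n m n2 m2).
- have nA : ~ familyA (potE R[i] k b n) by apply: not_familyA; rewrite potE_x2.
  have nD : ~ familyD (potE R[i] k b n) by apply: not_familyD; right; rewrite potE_xy2.
  have iso := @typeE_iso R[i] k b n n4.
  split; first by split; [exact: typeE_central|exists 2; exact: iso].
    by split=> [/nA[]|/nD[]|_]; exact: iso.
  by split=> [/nA[]|/nD[]].
Qed.
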